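(* Let $(\mathcal{A},\mathcal{B},\mathcal{C})$ be a boundary control and observation system on Hilbert spaces $X,U,Y$, let $(S,E,F)$ be the exosystem data on $W=\mathbb{C}^q$, $q\in\mathbb{N}$ (with $\sigma(S)=\{i\omega_k\}_{k=1}^q\subset i\mathbb{R}$ consisting of $q$ eigenvalues of algebraic multiplicity one), and suppose that $(\mathcal{A},\mathcal{B},\mathcal{C},E,F)$ satisfies the standing assumptions (i)--(iv) listed in the context. Let $(\mathcal{G}_1,\mathcal{G}_2,K)$ be an error feedback controller on a Banach space $Z$, with $\mathcal{G}_1\in\mathcal{L}(Z)$, $\mathcal{G}_2\in\mathcal{L}(Y,Z)$, $K\in\mathcal{L}(Z,U)$. Assume that the controller exponentially stabilizes the closed-loop system, i.e. the semigroup generated by $A_e$ is exponentially stable. If the controller satisfies the $\mathcal{G}$-conditions, i.e. $$\operatorname{Ran}(i\omega_k-\mathcal{G}_1)\cap\operatorname{Ran}(\mathcal{G}_2)=\{0\}\quad\text{for all }k\in\{1,\dots,q\},\qquad \ker(\mathcal{G}_2)=\{0\},$$ then the controller solves the robust output regulation problem, that is: (1) The closed-loop system generated by $A_e$ is exponentially stable. (2) There is $\alpha>0$ such that for all initial states $\xi_{e0}\in X\times Z$ and $v_0\in W$ the regulation error satisfies $e^{\alpha\cdot}e(\cdot)\in L^2(0,\infty;Y)$. (3) Whenever $(\mathcal{A},\mathcal{B},\mathcal{C},E,F)$ is perturbed to $(\tilde{\mathcal{A}},\tilde{\mathcal{B}},\tilde{\mathcal{C}},\tilde E,\tilde F)$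 satisfying (i)--(iv), in such a way that the perturbed closed-loop system (generated by $\tilde A_e$, with the same controller and the same $S$) is exponentially stable, there is $\tilde\alpha>0$ such that for all $\xi_{e0}\in X\times Z$ and $v_0\in W$ the regulation error of the perturbed closed-loop system satisfies $e^{\tilde\alpha\cdot}e(\cdot)\in L^2(0,\infty;Y)$. In particular, the controller is robust with respect to all perturbations satisfying (i)--(iv) under which the closed-loop system remains exponentially stable.
   Context: **Notation.** $\mathcal{L}(X,Y)$ denotes bounded linear operators, $\rho(A)$ the resolvent set, $R(\lambda,A)=(\lambda-A)^{-1}$. A $C_0$-semigroup (or its generator) is exponentially stable if its growth bound is negative. **Boundary control and observation system.** Let $X,U,Y$ be Hilbert spaces. Linear operators $\mathcal{A}:D(\mathcal{A})\subset X\to X$, $\mathcal{B}:D(\mathcal{B})\subset X\to U$, $\mathcal{C}:D(\mathcal{C})\subset X\to Y$ form a boundary control and observation system if: (1) $D(\mathcal{A})\subset D(\mathcal{B})$ and $D(\mathcal{A})\subset D(\mathcal{C})$; (2) the restriction $A=\mathcal{A}|_{\ker\mathcal{B}}$ (with domain $D(A)=D(\mathcal{A})\cap\ker\mathcal{B}$) generates a $C_0$-semigroup $T_A(t)$ on $X$; (3) there is a right inverse $B\in\mathcal{L}(U,X)$ of $\mathcal{B}$ with $\operatorname{Ran}(B)\subset D(\mathcal{A})$, $\mathcal{A}B\in\mathcal{L}(U,X)$ and $\mathcal{B}B=I_U$; (4) $\mathcal{C}$ is bounded from $D(A)$ (with the graph norm of $A$) to $Y$. Such a $B$ is fixed for each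 system. **Admissibility.** $\mathcal{C}$ is admissible for $A$ if for some $\tau>0$ there is $K_\tau$ with $\int_0^\tau\|\mathcal{C}T_A(t)x_0\|_Y^2\,dt\le K_\tau^2\|x_0\|_X^2$ for all $x_0\in D(A)$. **$\Lambda$-extension.** $\mathcal{C}_\Lambda x=\lim_{\lambda\to\infty}\lambda\mathcal{C}R(\lambda,A)x$, with domain the set of $x\in X$ for which the limit exists; it extends $\mathcal{C}|_{D(A)}$. **Transfer function.** $P(\lambda)=\mathcal{C}R(\lambda,A)(\mathcal{A}B-\lambda B)+\mathcal{C}B$ for $\lambda\in\rho(A)$. **Plant.** $\dot x(t)=\mathcal{A}x(t)$, $x(0)=x_0$, $\mathcal{B}x(t)=u(t)+w(t)$, $y(t)=\mathcal{C}x(t)$. **Exosystem.** On $W=\mathbb{C}^q$: $\dot v(t)=Sv(t)$, $v(0)=v_0$, $w(t)=Ev(t)$, $y_{ref}(t)=-Fv(t)$, where $S\in\mathbb{C}^{q\times q}$ has spectrum $\{i\omega_k\}_{k=1}^q\subset i\mathbb{R}$ with all eigenvalues of algebraic multiplicity one. **Standing assumptions (i)--(iv)** on a tuple $(\mathcal{A},\mathcal{B},\mathcal{C},E,F)$ (nominal or perturbed, with $X,U,Y,W,S$ fixed): (i) $(\mathcal{A},\mathcal{B},\mathcal{C})$ is a boundary control and observation system; (ii) $\mathcal{C}$ is admissible for $A=\mathcal{A}|_{\ker\mathcal{B}}$; (iii) for every eigenvalue $i\omega_k$ of $S$ the transfer function value $P(i\omega_k)$ is defined ($i\omega_k\in\rho(A)$),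 and is a bounded and surjective operator $U\to Y$; (iv) $E\in\mathcal{L}(W,U)$, $F\in\mathcal{L}(W,Y)$. **Controller.** $\dot z(t)=\mathcal{G}_1z(t)+\mathcal{G}_2(y(t)-y_{ref}(t))$, $z(0)=z_0$, $u(t)=Kz(t)$, on the Banach space $Z$. **Closed-loop system.** Put $G:=BE$. With $\xi(t)=x(t)-Bu(t)-Gv(t)$ and $\xi_e=(\xi,z)^T$ on $X_e=X\times Z$, the closed-loop system is $$\dot\xi_e(t)=A_e\xi_e(t)+B_ev(t),\quad \xi_e(0)=\xi_{e0},\qquad e(t)=C_e\xi_e(t)+D_ev(t),$$ where $e=y-y_{ref}$ is the regulation error, $D(A_e)=D(A)\times Z$, $C_e=[\mathcal{C}_\Lambda\ \ \mathcal{C}BK]$, $D_e=\mathcal{C}G+F$, $$A_e=\begin{bmatrix}A-BK\mathcal{G}_2\mathcal{C}_\Lambda & \mathcal{A}BK-BK(\mathcal{G}_1+\mathcal{G}_2\mathcal{C}BK)\\ \mathcal{G}_2\mathcal{C}_\Lambda & \mathcal{G}_1+\mathcal{G}_2\mathcal{C}BK\end{bmatrix},\qquad B_e=\begin{bmatrix}\mathcal{A}G-GS-BK\mathcal{G}_2(\mathcal{C}G+F)\\ \mathcal{G}_2(\mathcal{C}G+F)\end{bmatrix}.$$ $A_e$ generates a $C_0$-semigroup; solutions are mild solutions and $e(t)$ is defined for a.e. $t$. For a perturbed tuple, $\tilde A,\tilde B,\tilde G=\tilde B\tilde E,\tilde{\mathcal{C}}_\Lambda,\tilde A_e,\tilde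 B_e,\tilde C_e,\tilde D_e$ are defined by the same formulas from the perturbed data. *)

(* Defs.v *)
From HB Require Import structures.
From mathcomp Require Import all_boot all_order all_algebra.
From mathcomp Require Import complex.
From mathcomp Require Import all_classical all_reals all_analysis.

Set Implicit Arguments.
Unset Strict Implicit.
Unset Printing Implicit Defensive.

Import Order.TTheory GRing.Theory Num.Theory.
Import numFieldNormedType.Exports.

Local Open Scope classical_set_scope.
Local Open Scope complex_scope.
Local Open Scope ring_scope.

Section OperatorTheory.
Context {R : realType}.
Local Notation C := R[i].

(* Norms over the complex field take values in R[i]; they are real there. *)
Definition rnorm {V : normedModType C} (x : V) : R := complex.Re `|x|.

(* A Banach space is a Hilbert space when its norm comes from an inner
   product; the inner product is then unique by polarization. *)
Definition hilbert (V : completeNormedModType C) : Prop :=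
  exists ip : {dot V for Num.conj}, forall x : V, ip x x = `|x| ^+ 2.

Definition bounded_linear {V W : normedModType C} (f : V -> W) : Prop :=
  linear f /\ exists M : R, forall x, rnorm (f x) <= M * rnorm x.

(* Values of [app] outside [dom] carry no information. *)
Record unbounded_op (V W : normedModType C) := UnboundedOp {
  dom : set V;
  app :> V -> W }.

Definition linear_op {V W : normedModType C} (A : unbounded_op V W) : Prop :=
  dom A 0 /\
  forall (a : C) (x y : V), dom A x -> dom A y ->
    dom A (a *: x + y) /\ A (a *: x + y) = a *: A x + A y.

Definition ker_op {V W : normedModType C} (A : unbounded_op V W) : set V :=
  [set x | dom A x /\ A x = 0].

(* Only the values at times t >= 0 are meaningful. *)
Definition C0_semigroup {V : normedModType C} (T : R -> V -> V) : Prop :=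
  [/\ forall t, 0 <= t -> bounded_linear (T t),
      forall x, T 0 x = x,
      forall s t, 0 <= s -> 0 <= t -> forall x, T (s + t) x = T s (T t x)
    & forall x, T t x @[t --> (0 : R)^'+] --> x].

(* The graph of A is that of the right derivative at 0 of the orbits. *)
Definition generator_of {V : normedModType C}
    (A : unbounded_op V V) (T : R -> V -> V) : Prop :=
  forall x y, (dom A x /\ A x = y) <->
    (h^-1)%:C *: (T h x - x) @[h --> (0 : R)^'+] --> y.

Definition generates_C0_semigroup {V : normedModType C}
    (A : unbounded_op V V) : Prop :=
  exists T, C0_semigroup T /\ generator_of A T.

Definition semigroup_of {V : normedModType C} (A : unbounded_op V V) :
    R -> V -> V :=
  get [set T | C0_semigroup T /\ generator_of A T].

Definition growth_bound {V : normedModType C} (T : R -> V -> V) : \bar R :=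
  ereal_inf [set w%:E | w in [set w : R | exists M : R, forall t x, 0 <= t ->
    rnorm (T t x) <= M * expR (w * t) * rnorm x]].

Definition exp_stable {V : normedModType C} (A : unbounded_op V V) : Prop :=
  generates_C0_semigroup A /\ (growth_bound (semigroup_of A) < 0)%E.

Definition resolvent_set {V : normedModType C} (A : unbounded_op V V) :
    set C :=
  [set l | exists Q : V -> V, [/\ bounded_linear Q,
    forall y, dom A (Q y) /\ l *: Q y - A (Q y) = y
  & forall x, dom A x -> Q (l *: x - A x) = x]].

Definition resolvent {V : normedModType C} (A : unbounded_op V V) (l : C)
    (y : V) : V :=
  get [set x | dom A x /\ l *: x - A x = y].

Definition lambda_ext {V W : normedModType C}
    (A : unbounded_op V V) (Cop : unbounded_op V W) : unbounded_op V W :=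
  let approx x (l : R) := l%:C *: Cop (resolvent A l%:C x) in
  UnboundedOp [set x | cvg (approx x l @[l --> +oo])]
              (fun x => lim (approx x l @[l --> +oo])).

Definition is_riemann_integral {V : normedModType C} (f : R -> V) (a b : R)
    (I : V) : Prop :=
  forall eps : R, 0 < eps -> exists2 delta : R, 0 < delta &
    forall (n : nat) (s tag : nat -> R), s 0%N = a -> s n = b ->
      (forall k, (k < n)%N ->
        [/\ s k <= tag k, tag k <= s k.+1 & s k.+1 - s k < delta]) ->
      rnorm (\sum_(k < n) (s k.+1 - s k)%:C *: f (tag k) - I) < eps.

Definition riemann_integral {V : normedModType C} (f : R -> V) (a b : R) : V :=
  get (is_riemann_integral f a b).

(* Mild solution of xi' = A xi + f, xi(0) = xi0. It is used below only for
   continuous f, for which the Riemann integral equals the Bochner one. *)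
Definition mild_solution {V : normedModType C} (A : unbounded_op V V)
    (f : R -> V) (xi0 : V) (t : R) : V :=
  semigroup_of A t xi0 +
  riemann_integral (fun s => semigroup_of A (t - s) (f s)) 0 t.

Definition simple_function {V : normedModType C} (s : R -> V) : Prop :=
  finite_set (range s) /\
  forall y, measurable (s @^-1` [set y] : set (measurableTypeR R)).

(* f in L^2(0,oo;V), where f is only defined on the set D: f has to be defined
   almost everywhere, strongly (Bochner) measurable and square integrable. *)
Definition in_L2_pos {V : normedModType C} (D : set R) (f : R -> V) : Prop :=
  [/\ {ae @lebesgue_measure R, forall t : R, 0 < t -> D t},
      exists s : nat -> R -> V, (forall n, simple_function (s n)) /\
        {ae @lebesgue_measure R, forall t : R, 0 < t ->
           s n t @[n --> \oo] --> f t}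
    & (\int[@lebesgue_measure R]_(t in `]0%R, +oo[)
         (rnorm (f t) ^+ 2)%:E < +oo)%E].

End OperatorTheory.

Section RobustOutputRegulation.
Context {R : realType}.
Local Notation C := R[i].
Context {X U Y Z : completeNormedModType C} {q : nat}.
Local Notation W := ('cV[C]_q : normedModType C).

(* [rinv] is the fixed right inverse of the boundary operator [opB]. *)
Record plant := Plant {
  opA : unbounded_op X X;
  opB : unbounded_op X U;
  opC : unbounded_op X Y;
  rinv : U -> X;
  opE : W -> U;
  opF : W -> Y }.

Definition opA0 (P : plant) : unbounded_op X X :=
  UnboundedOp (dom (opA P) `&` ker_op (opB P)) (opA P).

Definition bc_system (P : plant) : Prop :=
  [/\ [/\ linear_op (opA P), linear_op (opB P) & linear_op (opC P)],
      dom (opA P) `<=` dom (opB P) /\ dom (opA P) `<=` dom (opC P),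
      generates_C0_semigroup (opA0 P),
      [/\ bounded_linear (rinv P),
          range (rinv P) `<=` dom (opA P),
          bounded_linear (opA P \o rinv P)
        & forall u, opB P (rinv P u) = u]
    & exists M : R, forall x, dom (opA0 P) x ->
        rnorm (opC P x) <= M * (rnorm x + rnorm (opA0 P x))].

Definition admissible (P : plant) : Prop :=
  exists2 tau : R, 0 < tau & exists K : R, forall x0, dom (opA0 P) x0 ->
    (\int[@lebesgue_measure R]_(t in `[0%R, tau])
       (rnorm (opC P (semigroup_of (opA0 P) t x0)) ^+ 2)%:E
     <= (K ^+ 2 * rnorm x0 ^+ 2)%:E)%E.

Definition transfer (P : plant) (l : C) (u : U) : Y :=
  opC P (resolvent (opA0 P) l (opA P (rinv P u) - l *: rinv P u)) +
  opC P (rinv P u).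

Definition iomega (w : R) : C := 0 +i* w.

Definition simple_imaginary_spectrum (S : 'M[C]_q) (omega : 'I_q -> R) : Prop :=
  [/\ injective omega,
      forall l, eigenvalue S l <-> exists k, l = iomega (omega k)
    & forall k, mup (iomega (omega k)) (char_poly S) = 1%N].

Definition standing_assumptions (omega : 'I_q -> R) (P : plant) : Prop :=
  [/\ bc_system P,
      admissible P,
      forall k, [/\ resolvent_set (opA0 P) (iomega (omega k)),
                    bounded_linear (transfer P (iomega (omega k)))
                  & range (transfer P (iomega (omega k))) = setT]
    & bounded_linear (opE P) /\ bounded_linear (opF P)].

(* On [0, oo): [within] makes the derivative one-sided at t = 0. *)
Definition exosystem_solution (S : 'M[C]_q) (v0 : W) (v : R -> W) : Prop :=
  v 0 = v0 /\ forall t, 0 <= t ->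
    (h^-1)%:C *: (v (t + h) - v t)
      @[h --> within [set h | 0 <= t + h] (0 : R)^'] --> (S *m v t : W).

Section ClosedLoop.
Variables (S : 'M[C]_q) (P : plant).
Variables (G1 : Z -> Z) (G2 : Y -> Z) (K : Z -> U).

Let BK (z : Z) : X := rinv P (K z).
Let ABK (z : Z) : X := opA P (BK z).
Let CBK (z : Z) : Y := opC P (BK z).
Let G (w : W) : X := rinv P (opE P w).
Let CL : unbounded_op X Y := lambda_ext (opA0 P) (opC P).

Definition De (w : W) : Y := opC P (G w) + opF P w.

Definition Ae : unbounded_op (X * Z)%type (X * Z)%type :=
  UnboundedOp [set xi | dom (opA0 P) xi.1]
    (fun xi =>
       (opA0 P xi.1 - BK (G2 (CL xi.1))
          + (ABK xi.2 - BK (G1 xi.2 + G2 (CBK xi.2))),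
        G2 (CL xi.1) + (G1 xi.2 + G2 (CBK xi.2)))).

Definition Be (w : W) : (X * Z)%type :=
  (opA P (G w) - G (S *m w) - BK (G2 (De w)), G2 (De w)).

Definition Ce : unbounded_op (X * Z)%type Y :=
  UnboundedOp [set xi | dom CL xi.1] (fun xi => CL xi.1 + CBK xi.2).

Definition closed_loop_state (xi0 : (X * Z)%type) (v : R -> W) :
    R -> (X * Z)%type :=
  mild_solution Ae (Be \o v) xi0.

Definition regulation_error (xi0 : (X * Z)%type) (v : R -> W)
    (t : R) : Y :=
  Ce (closed_loop_state xi0 v t) + De (v t).

Definition output_regulated : Prop :=
  exists2 alpha : R, 0 < alpha &
    forall (xi0 : (X * Z)%type) (v0 : W) (v : R -> W),
      exosystem_solution S v0 v ->
      in_L2_pos [set t | dom Ce (closed_loop_state xi0 v t)]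
        (fun t => (expR (alpha * t))%:C *: regulation_error xi0 v t).

End ClosedLoop.

Definition G_conditions (omega : 'I_q -> R) (G1 : Z -> Z) (G2 : Y -> Z) :
    Prop :=
  (forall k, range (fun z => iomega (omega k) *: z - G1 z) `&` range G2
             = [set 0]) /\
  [set y | G2 y = 0] = [set 0].

Definition solves_robust_output_regulation (S : 'M[C]_q) (omega : 'I_q -> R)
    (P : plant) (G1 : Z -> Z) (G2 : Y -> Z) (K : Z -> U) : Prop :=
  [/\ exp_stable (Ae P G1 G2 K),
      output_regulated S P G1 G2 K
    & forall P' : plant, standing_assumptions omega P' ->
        exp_stable (Ae P' G1 G2 K) -> output_regulated S P' G1 G2 K].

End RobustOutputRegulation.

Arguments plant {R} X U Y q.

(* Main.v *)
Require Import Defs.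
From HB Require Import structures.
From mathcomp Require Import all_boot all_order all_algebra.
From mathcomp Require Import complex.
From mathcomp Require Import all_classical all_reals all_analysis.
From mathcomp Require Import measurable_realfun ring lra.

Set Implicit Arguments.
Unset Strict Implicit.
Unset Printing Implicit Defensive.

Import Order.TTheory GRing.Theory Num.Theory.
Import numFieldNormedType.Exports.

Local Open Scope classical_set_scope.
Local Open Scope complex_scope.
Local Open Scope ring_scope.

(** Let [phi_k] be an eigenbasis of [S] and let [pi_k] solve
    [i omega_k pi_k - Ae pi_k = Be phi_k]; write [Pi] for the linear map
    [phi_k |-> pi_k]. The closed-loop state is then
    [Te(t) (xi0 - Pi v0) + Pi v(t)]. The second row of the equation for [pi_k]
    says that [(i omega_k - G1) pi_k.2] is [G2] of the error at [pi_k], so the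
    G-conditions make [Ce Pi + De] vanish, and the error is the transient
    [Ce Te(t) xi]. This applies verbatim to every perturbed plant.

    The transient lies in a weighted [L^2] space because admissibility survives
    the feedback: [int_0^tau (1 - s/tau) |C T_A(s) x|^2 ds] is a Lyapunov
    function which, along [x' = A x + f] with [f] bounded by [C x] and [x],
    decreases at rate [|C x|^2 / 2] up to multiples of [|x|^2], and the closed
    loop makes [|x|^2] decay exponentially. For an initial state outside
    [D(Ae)], approximate by [x_n] in [D(Ae)] so fast that
    [sum_n |C Te(t) (x_(n+1) - x_n)|] is integrable: at its Lebesgue points the
    Lambda-limit of the state exists and equals [lim_n C Te(t) x_n]. *)

(** Estimates are available only on the domain of [Ae], whereas the error involves the
    Lambda-extension along an arbitrary mild solution. The limit found from the orbits uses
    resolvents of [Ae]; [lambda_transfer] converts it into the limit with resolvents of [A] that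
    defines the Lambda-extension. The output enters the first row of [Ae] through an unbounded term,
    so bounded perturbation arguments do not carry admissibility from [A] to [Ae]. The Lyapunov
    function is not known to be differentiable along closed-loop orbits: its decrease is proved over
    short steps, up to an arbitrary [eps], and propagated by real induction. As the observation is
    bounded only in the graph norm on [D(A)], the boundedness of [C B K] is extracted from the
    closedness of [Ae] and the injectivity of [G2]. The vectors [pi_k] exist because stability puts
    the imaginary axis into the resolvent set of [Ae]. Half of the decay rate [om] becomes the
    weight of the error; the other half keeps the weighted orbits square integrable. *)

(* Square-zero extension K + V of a module V: identities in V become ring
   identities. *)
Section TrivialExtension.
Context {K : comNzRingType}.
Definition sqz (V : lmodType K) : Type := (K * V)%type.
Context {V : lmodType K}.
HB.instance Definition _ := GRing.Zmodule.on (sqz V).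
Implicit Types x y z : sqz V.
Definition sqz1 : sqz V := (1, 0).
Definition sqz_mul x y : sqz V := (x.1 * y.1, x.1 *: y.2 + y.1 *: x.2).
Fact sqz_mulA : associative sqz_mul.
Proof.
move=> [a x] [b y] [c z]; rewrite /sqz_mul /= mulrA; congr pair.
by rewrite !scalerDr !scalerA addrA [c * a]mulrC [c * b]mulrC.
Qed.
Fact sqz_mulC : commutative sqz_mul.
Proof. by move=> [a x] [b y]; rewrite /sqz_mul /= mulrC addrC. Qed.
Fact sqz_mul1 : left_id sqz1 sqz_mul.
Proof. by move=> [a x]; rewrite /sqz_mul /= mul1r scale1r scaler0 addr0. Qed.
Fact sqz_mulDl : left_distributive sqz_mul +%R.
Proof.
move=> [a x] [b y] [c z]; rewrite /sqz_mul /=; congr pair; rewrite /= ?mulrDl //.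
by rewrite scalerDl scalerDr addrACA.
Qed.
Fact sqz_1neq0 : sqz1 != 0.
Proof. by apply/eqP => -[/eqP]; rewrite oner_eq0. Qed.
HB.instance Definition _ := GRing.Zmodule_isComNzRing.Build (sqz V) sqz_mulA sqz_mulC sqz_mul1 sqz_mulDl sqz_1neq0.
Definition sqv (x : V) : sqz V := (0, x).
Definition sqk (a : K) : sqz V := (a, 0).
Lemma sqv_inj : injective sqv. Proof. by move=> x y []. Qed.
Lemma sqvD (x y : V) : sqv (x + y) = sqv x + sqv y.
Proof. by congr pair; rewrite /= ?addr0. Qed.
Lemma sqvN (x : V) : sqv (- x) = - sqv x.
Proof. by congr pair; rewrite /= ?oppr0. Qed.
Lemma sqv0 : sqv 0 = 0. Proof. by []. Qed.
Lemma sqvZ a (x : V) : sqv (a *: x) = sqk a * sqv x.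
Proof. by congr pair; rewrite /= ?mulr0 // scale0r addr0. Qed.
Lemma sqkD (x y : K) : sqk (x + y) = sqk x + sqk y.
Proof. by congr pair; rewrite /= ?addr0. Qed.
Lemma sqkN (x : K) : sqk (- x) = - sqk x.
Proof. by congr pair; rewrite /= ?oppr0. Qed.
Lemma sqkM (x y : K) : sqk (x * y) = sqk x * sqk y.
Proof. by congr pair; rewrite /= ?scaler0 ?addr0. Qed.
Lemma sqk1 : sqk 1 = 1. Proof. by []. Qed.
Lemma sqk0 : sqk 0 = 0. Proof. by []. Qed.
Definition sqE := (sqvD, sqvN, sqv0, sqvZ, sqkD, sqkN, sqkM, sqk1, sqk0).
End TrivialExtension.

Section RealScalars.
Context {R : realType}.
Implicit Types x y : R.
Lemma rcD x y : (x + y)%:C = x%:C + y%:C. Proof. exact: rmorphD. Qed.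
Lemma rcN x : (- x)%:C = - x%:C. Proof. exact: rmorphN. Qed.
Lemma rcM x y : (x * y)%:C = x%:C * y%:C. Proof. exact: rmorphM. Qed.
Lemma rcV x : (x^-1)%:C = (x%:C)^-1. Proof. exact: fmorphV. Qed.
Lemma rc0 : (0 : R)%:C = 0. Proof. by []. Qed.
Lemma rc1 : (1 : R)%:C = 1. Proof. by []. Qed.
Definition rcE := (rcD, rcN, rcM, rcV, rc0, rc1).
End RealScalars.

Ltac lmod := apply: sqv_inj; rewrite ?rcE ?sqE; ring.

(** * Real-valued norms and induction along intervals *)

Section RNorm.
Context {R : realType}.
Local Notation C := R[i].
Implicit Types V W : normedModType C.

Lemma normE V (x : V) : `|x| = (rnorm x)%:C.
Proof.
by apply/eqP; rewrite eq_complex /= eqxx /= (ger0_Im (normr_ge0 x)).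
Qed.

Lemma rnorm_ge0 V (x : V) : 0 <= rnorm x.
Proof. by rewrite -lecR -normE normr_ge0. Qed.

Lemma rnorm0 V : rnorm (0 : V) = 0.
Proof. by rewrite /rnorm normr0. Qed.

Lemma rnormD V (x y : V) : rnorm (x + y) <= rnorm x + rnorm y.
Proof. by rewrite -lecR rmorphD /= -!normE ler_normD. Qed.

Lemma rnormN V (x : V) : rnorm (- x) = rnorm x.
Proof. by rewrite /rnorm normrN. Qed.

Lemma rnorm_distC V (x y : V) : rnorm (x - y) = rnorm (y - x).
Proof. by rewrite /rnorm distrC. Qed.

Lemma rnormB V (x y : V) : rnorm (x - y) <= rnorm x + rnorm y.
Proof. by rewrite (le_trans (rnormD _ _)) // rnormN. Qed.

Lemma rnorm_dist_ge V (x y : V) : rnorm x <= rnorm y + rnorm (x - y).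
Proof. by rewrite -{1}(subrK y x) addrC (le_trans (rnormD _ _)) // addrC. Qed.

Lemma rnorm_triangle V (x y z : V) : rnorm (x - z) <= rnorm (x - y) + rnorm (y - z).
Proof. by rewrite (le_trans _ (rnormD _ _)) // addrA subrK. Qed.

Lemma rnorm_eq0 V (x : V) : rnorm x = 0 -> x = 0.
Proof. by move=> h; apply/eqP; rewrite -normr_eq0 normE h. Qed.

Lemma rnorm_le0 V (x : V) : rnorm x <= 0 -> x = 0.
Proof. by move=> h; apply/rnorm_eq0/le_anti; rewrite h rnorm_ge0. Qed.

Lemma normcRe (r : R) : `|r%:C : C| = `|r|%:C.
Proof. by rewrite normc_def /= expr0n /= addr0 sqrtr_sqr. Qed.

Lemma rnormZ V (a : C) (x : V) : rnorm (a *: x) = complex.Re `|a| * rnorm x.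
Proof.
apply/complexI; rewrite -normE normrZ normE.
by rewrite [X in _ = X]rmorphM /=; congr (_ * _).
Qed.

Lemma rnormZr V (r : R) (x : V) : rnorm (r%:C *: x) = `|r| * rnorm x.
Proof. by rewrite rnormZ normcRe. Qed.

Lemma eq_lerR (x y : R) : x = y -> x <= y.
Proof. by move=> ->. Qed.

Lemma archi_lt (x : R) : exists N, forall n, (N <= n)%N -> x < n.+1%:R.
Proof.
exists (Num.truncn x) => n Nn; rewrite (lt_le_trans (truncnS_gt x)) // ler_nat.
by rewrite ltnS.
Qed.

Lemma le_eps (x y : R) : (forall e : R, 0 < e -> x <= y + e) -> x <= y.
Proof. by move=> h; apply/ler_addgt0Pr. Qed.

Lemma le_epsM (x y c : R) : (forall e : R, 0 < e -> x <= y + c * e) -> x <= y.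
Proof.
move=> h; apply: le_eps => e e0.
have c1 : 0 < `|c| + 1 by rewrite ltr_wpDl.
have := h (e / (`|c| + 1)) (divr_gt0 e0 c1) => /le_trans; apply.
rewrite lerD2l mulrA ler_pdivrMr //.
rewrite mulrC ler_wpM2l ?(ltW e0) //.
by rewrite (le_trans (ler_norm c)) // lerDl.
Qed.

Lemma rnorm_small V (x : V) (c : R) : (forall e : R, 0 < e -> rnorm x <= c * e) -> x = 0.
Proof.
by move=> h; apply/rnorm_le0/(@le_epsM _ _ c) => e e0; rewrite add0r h.
Qed.

(** The supremum of the points up to which [Q] holds satisfies [Q] by the second hypothesis, and the
    third would carry [Q] beyond it if it were smaller than [b]. *)
Lemma real_induction (a b : R) (Q : R -> Prop) : a <= b -> Q a ->
  (forall s, a < s -> s <= b -> (forall u, a <= u -> u < s -> Q u) -> Q s) ->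
  (forall s, a <= s -> s < b -> Q s ->
     exists2 d : R, 0 < d & forall v, s < v -> v < s + d -> v <= b -> Q v) -> Q b.
Proof.
move=> ab Qa lim step.
pose S := [set t | a <= t <= b /\ forall u, a <= u -> u <= t -> Q u].
have Sa : S a.
  by split; [rewrite lexx|move=> u au ua; have -> : u = a by apply/le_anti/andP].
have Sb t : S t -> t <= b by case=> /andP[].
have hS : has_sup S by split; [exists a|exists b => t /Sb].
set s := sup S.
have as_ : a <= s by apply: ub_le_sup => //; exact: hS.2.
have sb : s <= b by apply: ge_sup => //; exists a.
have Qlt u : a <= u -> u < s -> Q u.
  move=> au us; have [|t St] := @sup_adherent _ S (s - u) _ hS; first by rewrite subr_gt0.
  by rewrite opprB addrC subrK => ut; apply: St.2 => //; exact: ltW.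
have Qs : Q s.
  move: as_; rewrite le_eqVlt => /predU1P[<-//|as_]; exact: lim.
have [<-//|sb'] := eqVneq s b.
have {}sb' : s < b by rewrite lt_neqAle sb' sb.
have [d d0 hd] := step _ as_ sb' Qs.
pose v := Num.min b (s + d / 2).
have sv : s < v by rewrite lt_min sb' ltrDl divr_gt0.
have vb : v <= b by rewrite ge_min lexx.
have vd : v < s + d by rewrite gt_min; apply/orP; right; rewrite ltrD2l ltr_pdivrMr // ltr_pMr // ltr1n.
have Sv : S v.
  split; first by rewrite (le_trans as_ (ltW sv)).
  move=> u au; have [us _|su|-> //] := ltgtP u s; first exact: Qlt.
  move=> uv; apply: hd => //; [exact: le_lt_trans vd|exact: le_trans vb].
have : v <= s by apply: ub_le_sup => //; exact: hS.2.
by rewrite leNgt sv.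
Qed.

(** Compactness for properties of intervals (Cousin's lemma). It replaces subdivision arguments in
    the mean value inequality, the existence of step sums and uniform continuity. *)
Lemma creeping (a b : R) (Q : R -> R -> Prop) : a <= b ->
  (forall p, a <= p <= b -> Q p p) ->
  (forall c d e, c <= d -> d <= e -> a <= c -> e <= b -> Q c d -> Q d e -> Q c e) ->
  (forall p, a <= p <= b -> exists2 d : R, 0 < d &
     forall u v, a <= u -> v <= b -> u <= p <= v -> p - d < u -> v < p + d -> Q u v) ->
  Q a b.
Proof.
move=> ab Qpp tr loc; apply: (@real_induction a b (Q a)) => //.
- by apply: Qpp; rewrite lexx.
- move=> s as_ sb h; have [|d d0 hd] := loc s; first by rewrite (ltW as_).
  pose u := Num.max a (s - d / 2).
  have us : u < s by rewrite gt_max as_ ltrBlDr ltrDl divr_gt0.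
  have au : a <= u by rewrite le_max lexx.
  apply: (tr a u s) => //; [exact: ltW|exact: h|].
  apply: hd => //; [by rewrite lexx ltW|rewrite lt_max|by rewrite ltrDl].
  by apply/orP; right; rewrite ltrD2l ltrN2 ltr_pdivrMr // ltr_pMr // ltr1n.
- move=> s as_ sb Qs; have [|d d0 hd] := loc s; first by rewrite as_ ltW.
  exists d => // v sv vd vb; apply: (tr a s v) => //; first exact: ltW.
  by apply: hd => //; [by rewrite lexx ltW|rewrite ltrBlDr ltrDl].
Qed.

End RNorm.

(** * Calculus of vector-valued functions *)

Section Calculus.
Context {R : realType}.
Local Notation C := R[i].
Context {V : normedModType C}.
Implicit Types (D : set R) (f F : R -> V).

Definition cont_on D f := forall p, D p -> forall e : R, 0 < e ->
  exists2 d : R, 0 < d & forall u, D u -> `|u - p| < d -> rnorm (f u - f p) <= e.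

(** The difference quotient is multiplied out, so [u = p] needs no exclusion; confining [u] to [D]
    makes the derivative one-sided at an endpoint of [D]. *)
Definition deriv_at D F (p : R) (y : V) := forall e : R, 0 < e ->
  exists2 d : R, 0 < d & forall u, D u -> `|u - p| < d ->
    rnorm (F u - F p - (u - p)%:C *: y) <= e * `|u - p|.

Definition deriv_on D F f := forall p, D p -> deriv_at D F p (f p).

Lemma deriv_atS D D' F p y : D' `<=` D -> deriv_at D F p y -> deriv_at D' F p y.
Proof.
move=> DD h e e0; have [d d0 hd] := h e e0; exists d => // u /DD; exact: hd.
Qed.

Lemma deriv_onS D D' F f : D' `<=` D -> deriv_on D F f -> deriv_on D' F f.
Proof. by move=> DD h p Dp; apply: (deriv_atS DD); apply: h; exact: DD. Qed.

Lemma cont_onS D D' f : D' `<=` D -> cont_on D f -> cont_on D' f.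
Proof.
move=> DD h p Dp e e0; have [d d0 hd] := h p (DD _ Dp) e e0.
by exists d => // u /DD; exact: hd.
Qed.

Lemma is_derive_eps (G : R -> R) (p y : R) : is_derive p 1 G y -> forall e : R, 0 < e ->
  exists2 d : R, 0 < d & forall u, `|u - p| < d -> `|G u - G p - (u - p) * y| <= e * `|u - p|.
Proof.
move=> [dG dE] e e0; rewrite /derivable in dG; rewrite /derive in dE.
have /cvgrPdist_le/(_ e e0) : h^-1 *: (G (h *: 1 + p) - G p) @[h --> 0^'] --> y by rewrite -dE.
rewrite /dnbhs => /nbhs_ballP[d /= d0 hd]; exists d => // u upd.
have [->|up] := eqVneq u p; first by rewrite !subrr mul0r subr0 !normr0 mulr0.
have up0 : u - p != 0 by rewrite subr_eq0.
have := hd (u - p); rewrite /ball /= sub0r normrN => /(_ upd up0).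
rewrite scaler1 subrK -(ler_pM2r (x := `|u - p|)) ?normr_gt0 // -normrM.
move=> h; rewrite distrC in h *; apply: le_trans h; apply: eq_lerR.
rewrite -[RHS]normrN; by congr `|_|; rewrite /GRing.scale /=; field.
Qed.

Lemma deriv_at_cont D F p y : deriv_at D F p y -> forall e : R, 0 < e ->
  exists2 d : R, 0 < d & forall u, D u -> `|u - p| < d -> rnorm (F u - F p) <= e.
Proof.
move=> h e e0; have [d d0 hd] := h 1 ltr01.
have y1 : 0 < rnorm y + 1 by rewrite ltr_wpDl ?rnorm_ge0.
exists (Num.min d (e / (rnorm y + 1))); first by rewrite lt_min d0 divr_gt0.
move=> u Du; rewrite lt_min => /andP[ud ue].
rewrite (le_trans (rnorm_dist_ge _ ((u - p)%:C *: y))) // rnormZr.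
have := hd u Du ud; rewrite mul1r => h1.
rewrite (le_trans (lerD (lexx _) h1)) //.
move: ue; rewrite ltr_pdivlMr // => /ltW; rewrite mulrDr mulr1 //.
Qed.

Lemma deriv_on_cont D F f : deriv_on D F f -> cont_on D F.
Proof. by move=> h p Dp; exact: (deriv_at_cont (h p Dp)). Qed.

Lemma mean_value (a b : R) F f (G g : R -> R) : a <= b ->
  deriv_on `[a, b] F f ->
  (forall t, a <= t <= b -> is_derive t 1 G (g t)) ->
  (forall t, a <= t <= b -> rnorm (f t) <= g t) ->
  rnorm (F b - F a) <= G b - G a.
Proof.
move=> ab dF dG fg; apply: (@le_epsM _ _ _ (b - a)) => e e0.
(* The slack is proportional to the length of the interval, hence additive under concatenation. *)
apply: (@creeping _ a b (fun c d => rnorm (F d - F c) <= G d - G c + (d - c) * e)) => //.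
- by move=> p _; rewrite !subrr rnorm0 mul0r addr0.
- move=> c d e' cd de _ _ h1 h2.
  apply: le_trans (rnorm_triangle _ (F d) _) _; apply: le_trans (lerD h2 h1) _.
  by apply: eq_lerR; ring.
move=> p pab; have e4 : 0 < e / 2 by rewrite divr_gt0.
have Dp : `[a, b]%classic p by rewrite /= in_itv.
have [d1 d10 h1] := dF p Dp _ e4.
have [d2 d20 h2] := is_derive_eps (dG p pab) e4.
have main u : a <= u <= b -> `|u - p| < Num.min d1 d2 ->
    rnorm (F u - F p) <= `|u - p| * (g p + e / 2) /\
    `|G u - G p - (u - p) * g p| <= e / 2 * `|u - p|.
  move=> uab; rewrite lt_min => /andP[u1 u2]; split; last exact: h2.
  rewrite (le_trans (rnorm_dist_ge _ ((u - p)%:C *: f p))) //.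
  rewrite mulrDr [X in _ <= _ + X]mulrC lerD //; first by rewrite rnormZr ler_wpM2l ?fg.
  by apply: h1 => //=; rewrite in_itv.
exists (Num.min d1 d2); first by rewrite lt_min d10.
move=> u v au vb /andP[up pv] ud vd.
have [| |F1 G1] := main u; first by rewrite au (le_trans up) // (le_trans pv).
  by rewrite distrC ger0_norm ?subr_ge0 // ltrBlDl -ltrBlDr.
have [| |F2 G2] := main v; first by rewrite vb (le_trans au) // (le_trans up).
  by rewrite ger0_norm ?subr_ge0 // ltrBlDl.
rewrite [X in rnorm X <= _](_ : _ = (F v - F p) + (F p - F u)); last by rewrite addrA subrK.
rewrite (le_trans (rnormD _ _)) // [rnorm (F p - _)]rnorm_distC.
rewrite (le_trans (lerD F2 F1)) //.
move: G1 G2; rewrite !ler_norml => /andP[G1 G1'] /andP[G2 G2'].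
move: G1 G1' G2 G2'; rewrite (ler0_norm (x := u - p)) ?subr_le0 // (ger0_norm (x := v - p)) ?subr_ge0 //.
nra.
Qed.

Lemma mean_value_cst (a b c : R) F f : a <= b ->
  deriv_on `[a, b] F f -> (forall t, a <= t <= b -> rnorm (f t) <= c) ->
  rnorm (F b - F a) <= c * (b - a).
Proof.
move=> ab dF fc; rewrite mulrBr.
apply: (@mean_value a b F f (fun t => c * t) (fun _ => c)) => //.
move=> t _; apply: is_derive_eq; by rewrite /GRing.scale /=; ring.
Qed.

End Calculus.

(** * Bounded linear maps, limits and completeness *)

Section Lin.
Context {R : realType}.
Local Notation C := R[i].
Implicit Types V W : normedModType C.

Lemma bounded_linear_ge0 V W (L : V -> W) : bounded_linear L ->
  exists2 M, 0 <= M & forall x, rnorm (L x) <= M * rnorm x.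
Proof.
move=> [_ [M hM]]; exists `|M|; first exact: normr_ge0.
by move=> x; rewrite (le_trans (hM x)) // ler_wpM2r ?rnorm_ge0 ?ler_norm.
Qed.

Section LinearFun.
Context {V W : normedModType C} (L : V -> W) (lL : linear L).

Lemma linfD x y : L (x + y) = L x + L y.
Proof. by have := lL 1 x y; rewrite !scale1r. Qed.

Lemma linf0 : L 0 = 0.
Proof. by apply: (@addrI _ (L 0)); rewrite -linfD !addr0. Qed.

Lemma linfZ a x : L (a *: x) = a *: L x.
Proof. by have := lL a x 0; rewrite !addr0 linf0 addr0. Qed.

Lemma linfN x : L (- x) = - L x.
Proof. by rewrite -scaleN1r linfZ scaleN1r. Qed.

Lemma linfB x y : L (x - y) = L x - L y.
Proof. by rewrite linfD linfN. Qed.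

Lemma linf_sum (I : Type) (r : seq I) (F : I -> V) :
  L (\sum_(i <- r) F i) = \sum_(i <- r) L (F i).
Proof.
elim: r => [|i r IH]; first by rewrite !big_nil linf0.
by rewrite !big_cons linfD IH.
Qed.
End LinearFun.

Definition tends V (u : nat -> V) (x : V) :=
  forall e : R, 0 < e -> exists N, forall n, (N <= n)%N -> rnorm (u n - x) <= e.

Definition tends_infty V (f : R -> V) (x : V) :=
  forall e : R, 0 < e -> exists L, forall l : R, L <= l -> rnorm (f l - x) <= e.

(** A predicate on normed modules, so that it can be established for the product [X * Z] that
    carries the closed-loop state. *)
Definition complete_rn V := forall u : nat -> V,
  (forall e : R, 0 < e -> exists N, forall m n, (N <= m)%N -> (N <= n)%N -> rnorm (u m - u n) <= e) ->
  exists l, tends u l.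

Lemma posc_real (e : C) : 0 < e -> e = (complex.Re e)%:C /\ 0 < complex.Re e.
Proof.
move=> e0; have e1 : e = (complex.Re e)%:C.
  by apply/eqP; rewrite eq_complex /= eqxx /= (ger0_Im (ltW e0)).
by split => //; rewrite -ltcR -e1.
Qed.

Lemma complete_rnP (V : completeNormedModType C) : complete_rn V.
Proof.
move=> u hu; have : cvg (u @ \oo).
  apply: cauchy_cvg; apply: cauchy_exP => e e0.
  have [-> e'0] := posc_real e0.
  have e4 : 0 < complex.Re e / 2 by rewrite divr_gt0.
  have [N hN] := hu _ e4; exists (u N); exists N => // n /= Nn.
  rewrite -ball_normE /= normE ltcR (le_lt_trans (hN _ _ (leqnn _) Nn)) //.
  by rewrite ltr_pdivrMr // ltr_pMr // ltr1n.
move=> /cvg_ex[l hl]; exists l => e e0.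
have e0c : 0 < e%:C :> C by rewrite ltcR.
move/cvgrPdist_le : hl => /(_ _ e0c)[N _ hN]; exists N => n Nn.
by rewrite -lecR -normE distrC; exact: hN.
Qed.

Lemma rnorm_pair V W (x : V) (y : W) :
  rnorm ((x, y) : (V * W)%type) = Num.max (rnorm x) (rnorm y).
Proof.
rewrite /rnorm; have -> : `|(x, y) : (V * W)%type| = Num.max `|x| `|y| by [].
rewrite !normE; have [h|h] := leP (rnorm x) (rnorm y).
  by rewrite max_r ?lecR // max_r.
by rewrite max_l ?lecR ?(ltW h) // max_l // ltW.
Qed.

Lemma complete_rn_prod V W : complete_rn V -> complete_rn W ->
  complete_rn ((V * W)%type : normedModType C).
Proof.
have np (x : V * W) : rnorm x = Num.max (rnorm x.1) (rnorm x.2) by case: x => *; exact: rnorm_pair.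
move=> cV cW u hu.
have [l1 h1] : exists l, tends (fst \o u) l.
  apply: cV => e /hu[N hN]; exists N => m n mN nN.
  by have := hN m n mN nN; rewrite np ge_max => /andP[].
have [l2 h2] : exists l, tends (snd \o u) l.
  apply: cW => e /hu[N hN]; exists N => m n mN nN.
  by have := hN m n mN nN; rewrite np ge_max => /andP[].
exists (l1, l2) => e e0; have [N1 H1] := h1 e e0; have [N2 H2] := h2 e e0.
exists (maxn N1 N2) => n; rewrite geq_max => /andP[n1 n2].
by rewrite np ge_max [X in X && _]H1 // [X in _ && X]H2.
Qed.

End Lin.

(** * Differentiation rules *)

Section DerivRules.
Context {R : realType}.
Local Notation C := R[i].
Context {V : normedModType C}.
Implicit Types (D : set R) (f F : R -> V).

Lemma deriv_atD D F G p y z : deriv_at D F p y -> deriv_at D G p z ->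
  deriv_at D (fun u => F u + G u) p (y + z).
Proof.
move=> h1 h2 e e0; have e4 : 0 < e / 2 by rewrite divr_gt0.
have [d1 d10 H1] := h1 _ e4; have [d2 d20 H2] := h2 _ e4.
exists (Num.min d1 d2); first by rewrite lt_min d10.
move=> u Du; rewrite lt_min => /andP[u1 u2].
rewrite [X in rnorm X](_ : _ = (F u - F p - (u - p)%:C *: y) + (G u - G p - (u - p)%:C *: z)).
  apply: le_trans (rnormD _ _) _; apply: le_trans (lerD (H1 u Du u1) (H2 u Du u2)) _.
  by rewrite -mulrDl -splitr.
by lmod.
Qed.

Lemma deriv_atL {W : normedModType C} D (L : V -> W) F p y : bounded_linear L ->
  deriv_at D F p y -> deriv_at D (L \o F) p (L y).
Proof.
move=> bL; have [lL _] := bL; have [M M0 hM] := bounded_linear_ge0 bL.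
move=> h e e0; have M1 : 0 < M + 1 by rewrite ltr_wpDl.
have [d d0 H] := h (e / (M + 1)) (divr_gt0 e0 M1).
exists d => // u Du ud; rewrite /= -(linfZ lL) -!(linfB lL).
rewrite (le_trans (hM _)) // (le_trans (ler_wpM2l M0 (H u Du ud))) //.
rewrite mulrA ler_wpM2r // mulrA ler_pdivrMr // mulrC ler_wpM2l ?(ltW e0) //.
by rewrite lerDl.
Qed.

Lemma deriv_at_cst D p (y : V) : deriv_at D (fun _ => y) p 0.
Proof. by move=> e e0; exists 1 => // u _ _; rewrite subrr scaler0 subr0 rnorm0 mulr_ge0 // ltW. Qed.

Lemma deriv_at_id D p (y : V) : deriv_at D (fun u => u%:C *: y) p y.
Proof.
move=> e e0; exists 1 => // u _ _.
by rewrite rmorphB /= -!scalerBl subrr scale0r rnorm0 mulr_ge0 // ltW.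
Qed.

Lemma deriv_at_eq D F p y z : deriv_at D F p y -> y = z -> deriv_at D F p z.
Proof. by move=> + <-. Qed.

Lemma deriv_at_ext D F G p y : D p -> (forall u, D u -> F u = G u) ->
  deriv_at D F p y -> deriv_at D G p y.
Proof.
move=> Dp FG h e e0; have [d d0 H] := h e e0; exists d => // u Du ud.
by rewrite -!FG // H.
Qed.

Lemma bounded_linearN : bounded_linear (fun x : V => - x).
Proof.
split; first by move=> a x y; rewrite opprD scalerN.
by exists 1 => x; rewrite rnormN mul1r.
Qed.

Lemma bounded_linearZ (a : C) : bounded_linear (fun x : V => a *: x).
Proof.
split; first by move=> b x y; rewrite scalerDr !scalerA mulrC.
by exists (complex.Re `|a|) => x; rewrite rnormZ.
Qed.

Lemma deriv_atN D F p y : deriv_at D F p y -> deriv_at D (fun u => - F u) p (- y).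
Proof. exact: (deriv_atL bounded_linearN). Qed.

Lemma deriv_atB D F G p y z : deriv_at D F p y -> deriv_at D G p z ->
  deriv_at D (fun u => F u - G u) p (y - z).
Proof. by move=> h1 /deriv_atN; exact: deriv_atD. Qed.

Lemma deriv_at_sum D (I : Type) (r : seq I) (F : I -> R -> V) p (y : I -> V) :
  (forall i, deriv_at D (F i) p (y i)) ->
  deriv_at D (fun u => \sum_(i <- r) F i u) p (\sum_(i <- r) y i).
Proof.
move=> h; elim: r => [|i r IH].
  rewrite big_nil; under eq_fun do rewrite big_nil; exact: deriv_at_cst.
by rewrite big_cons; under eq_fun do rewrite big_cons; exact: deriv_atD.
Qed.

Lemma deriv_at_scal D (a : R -> C^o) F p (b : C^o) y : D p ->
  deriv_at D a p b -> deriv_at D F p y ->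
  deriv_at D (fun u => a u *: F u) p (b *: F p + a p *: y).
Proof.
move=> Dp ha hF e e0.
have Re0 (z : C) : 0 <= complex.Re `|z| by rewrite -lecR -(@normE R C^o) normr_ge0.
have p1 : 0 < rnorm (F p) + 1 by rewrite ltr_wpDl ?rnorm_ge0.
have p2 : 0 < complex.Re `|a p| + 1 by rewrite ltr_wpDl.
have p3 : 0 < complex.Re `|b| + 1 by rewrite ltr_wpDl.
have e3 : 0 < e / 3 by rewrite divr_gt0.
have [d1 d10 H1] := ha _ (divr_gt0 e3 p1).
have [d2 d20 H2] := hF _ (divr_gt0 e3 p2).
have e3b : 0 < Num.min 1 (e / 3 / (complex.Re `|b| + 1)) by rewrite lt_min ltr01 divr_gt0.
have [d3 d30 H3] := deriv_at_cont hF (divr_gt0 e3 p3).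
have [d4 d40 H4] := deriv_at_cont hF ltr01.
exists (Num.min (Num.min d1 d2) (Num.min d3 d4)); first by rewrite !lt_min d10 d20 d30.
move=> u Du; rewrite !lt_min => /andP[/andP[u1 u2] /andP[u3 u4]].
have {}H1 := H1 u Du u1; have {}H2 := H2 u Du u2; have {}H3 := H3 u Du u3.
have H5 := H4 u Du u4.
(* The remainder of the product rule in three terms, each at most a third of the allowed error. *)
rewrite [X in rnorm X](_ : _ = (a u - a p - (u - p)%:C *: b : C) *: F u
  + a p *: (F u - F p - (u - p)%:C *: y) + ((u - p)%:C * b) *: (F u - F p)); last first.
  rewrite -[(u - p)%:C *: b]/((u - p)%:C * b); by lmod.
apply: le_trans (rnormD _ _) _; apply: le_trans (lerD (rnormD _ _) (lexx _)) _.
rewrite !rnormZ.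
have -> : complex.Re `|(u - p)%:C * b| = `|u - p| * complex.Re `|b|.
  by rewrite -[LHS]/(rnorm ((u - p)%:C *: b : C^o)) rnormZr.
have Fu : rnorm (F u) <= rnorm (F p) + 1.
  by rewrite (le_trans (rnorm_dist_ge _ (F p))) // lerD2l H5.
have A1 : rnorm (a u - a p - (u - p)%:C *: b) * rnorm (F u) <= e / 3 * `|u - p|.
  apply: le_trans (ler_pM (rnorm_ge0 _) (rnorm_ge0 _) H1 Fu) _.
  by rewrite mulrAC divfK // gt_eqF.
have A2 : complex.Re `|a p| * rnorm (F u - F p - (u - p)%:C *: y) <= e / 3 * `|u - p|.
  have h0 : complex.Re `|a p| <= complex.Re `|a p| + 1 by rewrite lerDl.
  apply: le_trans (ler_pM (Re0 _) (rnorm_ge0 _) h0 H2) _.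
  by rewrite mulrA mulrCA divff ?mulr1 // gt_eqF.
have A3 : `|u - p| * complex.Re `|b| * rnorm (F u - F p) <= e / 3 * `|u - p|.
  rewrite -mulrA [leRHS]mulrC ler_wpM2l //.
  have h0 : complex.Re `|b| <= complex.Re `|b| + 1 by rewrite lerDl.
  apply: le_trans (ler_pM (Re0 _) (rnorm_ge0 _) h0 H3) _.
  by rewrite mulrCA divff ?mulr1 // gt_eqF.
by apply: le_trans (lerD (lerD A1 A2) A3) _; rewrite -!mulrDl; nra.
Qed.

Lemma deriv_at_comp_add D F p h y : deriv_at [set u | D (u - h)] F (p + h) y ->
  deriv_at D (fun u => F (u + h)) p y.
Proof.
move=> H e e0; have [d d0 Hd] := H e e0; exists d => // u Du ud.
have -> : u - p = (u + h) - (p + h) by ring.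
by apply: Hd; [rewrite /= addrK|rewrite opprD addrACA subrr addr0].
Qed.

Lemma deriv_at_rev D F t p y : deriv_at [set u | D (t - u)] F (t - p) y ->
  deriv_at D (fun u => F (t - u)) p (- y).
Proof.
move=> H e e0; have [d d0 Hd] := H e e0; exists d => // u Du ud.
have e1 : (t - u) - (t - p) = - (u - p) by ring.
have := Hd (t - u); rewrite /= e1 normrN opprB addrC subrK => /(_ Du ud) h.
by apply: le_trans h; apply: eq_lerR; congr rnorm; lmod.
Qed.

End DerivRules.

(** * Antiderivatives and the Riemann integral of continuous functions *)

Section Integral.
Context {R : realType}.
Local Notation C := R[i].
Context {V : normedModType C}.
Implicit Types (D : set R) (f F : R -> V).

(* [step_sum f e c d I]: I is the integral over [c, d] of a step function that
   stays within e of f. *)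
Inductive step_sum f (e : R) : R -> R -> V -> Prop :=
| step_leaf c d y : c <= d -> (forall s, c <= s <= d -> rnorm (f s - y) <= e) ->
    step_sum f e c d ((d - c)%:C *: y)
| step_node c m d I J : step_sum f e c m I -> step_sum f e m d J ->
    step_sum f e c d (I + J).

Lemma step_sum_le f e c d I : step_sum f e c d I -> c <= d.
Proof. by elim=> // {}c m {}d ? ? _ cm _ md; exact: le_trans md. Qed.

Lemma step_sum_split f e c d I : step_sum f e c d I -> forall m, c <= m <= d ->
  exists I1 I2, [/\ step_sum f e c m I1, step_sum f e m d I2 & I = I1 + I2].
Proof.
elim=> [{}c {}d y cd h m /andP[cm md]|{}c k {}d {}I J h1 IH1 h2 IH2 m /andP[cm md]].
  exists ((m - c)%:C *: y), ((d - m)%:C *: y); split; last by lmod.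
    by constructor=> // s /andP[cs sm]; rewrite h // cs (le_trans sm).
  by constructor=> // s /andP[cs sm]; rewrite h // sm (le_trans cm).
have [mk|km] := leP m k.
  have [|I1 [I2 [H1 H2 ->]]] := IH1 m; first by rewrite cm mk.
  exists I1, (I2 + J); split => //; last by rewrite addrA.
  exact: step_node H2 h2.
have [|I1 [I2 [H1 H2 ->]]] := IH2 m; first by rewrite md (ltW km).
exists (I + I1), I2; split => //; last by rewrite addrA.
exact: step_node h1 H1.
Qed.

Lemma step_sum_cst f e e' c d J y : step_sum f e' c d J ->
  (forall s, c <= s <= d -> rnorm (f s - y) <= e) ->
  rnorm ((d - c)%:C *: y - J) <= (e + e') * (d - c).
Proof.
elim=> [{}c {}d z cd h H|{}c m {}d I {}J h1 IH1 h2 IH2 H].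
  rewrite -scalerBr rnormZr ger0_norm ?subr_ge0 // mulrC ler_wpM2r ?subr_ge0 //.
  have cc : c <= c <= d by rewrite lexx.
  by rewrite (le_trans (rnorm_triangle _ (f c) _)) // lerD ?h // rnorm_distC H.
have cm := step_sum_le h1; have md := step_sum_le h2.
have -> : (d - c)%:C *: y - (I + J) =
  ((m - c)%:C *: y - I) + ((d - m)%:C *: y - J) by lmod.
rewrite (le_trans (rnormD _ _)) //.
have /IH1 H1 : forall s, c <= s <= m -> rnorm (f s - y) <= e.
  by move=> s /andP[cs sm]; rewrite H // cs (le_trans sm).
have /IH2 H2 : forall s, m <= s <= d -> rnorm (f s - y) <= e.
  by move=> s /andP[cs sm]; rewrite H // sm (le_trans cm).
by apply: le_trans (lerD H1 H2) _; apply: eq_lerR; ring.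
Qed.

(** Induction on the first sum splits the second one at its nodes, so no common refinement has to be
    constructed. *)
Lemma step_sum_dist f e e' c d I J : step_sum f e c d I -> step_sum f e' c d J ->
  rnorm (I - J) <= (e + e') * (d - c).
Proof.
move=> h; elim: h J => [{}c {}d y cd h J hJ|{}c m {}d {}I I' h1 IH1 h2 IH2 J hJ].
  exact: step_sum_cst hJ h.
have cm := step_sum_le h1; have md := step_sum_le h2.
have [|J1 [J2 [H1 H2 ->]]] := step_sum_split hJ (m := m); first by rewrite cm.
have -> : I + I' - (J1 + J2) = (I - J1) + (I' - J2) by lmod.
rewrite (le_trans (rnormD _ _)) // (le_trans (lerD (IH1 _ H1) (IH2 _ H2))) //.
by apply: eq_lerR; ring.
Qed.

Lemma step_sum_exists f e a b : a <= b -> cont_on `[a, b] f -> 0 < e ->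
  exists I, step_sum f e a b I.
Proof.
move=> ab cf e0.
apply: (@creeping _ a b (fun c d => exists I, step_sum f e c d I)) => //.
- move=> p _; exists ((p - p)%:C *: f p); constructor => // s /andP[ps sp].
  by have -> : s = p; [apply/le_anti/andP|rewrite subrr rnorm0 ltW].
- by move=> c d e' _ _ _ _ [I hI] [J hJ]; exists (I + J); exact: step_node hI hJ.
move=> p pab; have [||d d0 hd] := cf p _ e; rewrite ?in_itv //.
exists d => // u v au vb /andP[up pv] ud vd; exists ((v - u)%:C *: f p).
constructor => [|s /andP[us sv]]; first exact: le_trans pv.
apply: hd; first by rewrite /= in_itv /= (le_trans au) // (le_trans sv).
by rewrite ltr_norml; lra.
Qed.

(** [F t] is the limit of step sums over [[a, t]] whose tolerance tends to 0; [step_sum_dist] makes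
    them Cauchy and the limit independent of the chosen sums. *)
Lemma antiderivative (a : R) f : complete_rn V -> cont_on `[a, +oo[ f ->
  exists F, deriv_on `[a, +oo[ F f.
Proof.
move=> cV cf.
have cft t : cont_on `[a, t] f.
  by apply: cont_onS cf => s /=; rewrite !in_itv /= andbT => /andP[].
pose P t l := forall (e : R) I, 0 < e -> step_sum f e a t I -> rnorm (I - l) <= e * (t - a).
have exF t : exists l, a <= t -> P t l.
  have [at_|] := leP a t; last by exists 0.
  have n0 n : 0 < n.+1%:R^-1 :> R by rewrite invr_gt0.
  have /choice[u hu] n := step_sum_exists at_ (@cft t) (n0 n).
  have ta0 : 0 <= t - a by rewrite subr_ge0.
  have small (e : R) : 0 < e -> exists N, forall n, (N <= n)%N -> n.+1%:R^-1 * (t - a) <= e.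
    move=> e0; have [N hN] := archi_lt ((t - a) / e); exists N => n /hN h.
    by rewrite mulrC ler_pdivrMr // mulrC -ler_pdivrMr // ltW.
  have [|l hl] := cV u.
    move=> e e0; have [N hN] := small _ (divr_gt0 e0 (ltr0Sn _ 1)).
    exists N => m n mN nN; rewrite (le_trans (step_sum_dist (hu m) (hu n))) //.
    by rewrite mulrDl [leRHS]splitr lerD ?hN.
  exists l => _ e I e0 hI; apply: le_eps => h h0.
  have h4 : 0 < h / 2 by rewrite divr_gt0.
  have [N1 H1] := small _ h4; have [N2 H2] := hl _ h4.
  pose n := maxn N1 N2.
  rewrite (le_trans (rnorm_triangle _ (u n) _)) //.
  rewrite (le_trans (lerD (step_sum_dist hI (hu n)) (H2 n (leq_maxr _ _)))) //.
  by have := H1 n (leq_maxl _ _); rewrite [(e + _) * _]mulrDl; move: (_^-1 * _) => x; lra.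
have [F hF] := choice exF.
(* A step sum over [[a, s]] extended by one over [[s, t]] is a step sum over [[a, t]], so the
   increment of [F] is a limit of step sums over [[s, t]] alone. *)
have key s t y e : a <= s -> s <= t -> 0 < e -> (forall r, s <= r <= t -> rnorm (f r - y) <= e) ->
    rnorm (F t - F s - (t - s)%:C *: y) <= e * (t - s).
  move=> as_ st e0 h; apply: (@le_epsM _ _ _ (t - s + (t - a) + (s - a))) => k k0.
  have [I hI] := step_sum_exists as_ (@cft s) k0.
  have cst : cont_on `[s, t] f.
    by apply: cont_onS cf => r /=; rewrite !in_itv /= andbT => /andP[sr _]; exact: le_trans sr.
  have [J hJ] := step_sum_exists st cst k0.
  have A1 := hF s as_ k I k0 hI.
  have A2 := hF t (le_trans as_ st) k (I + J) k0 (step_node hI hJ).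
  have A3 := step_sum_cst hJ h.
  have -> : F t - F s - (t - s)%:C *: y =
     - (I + J - F t) + (I - F s) - ((t - s)%:C *: y - J) by lmod.
  rewrite (le_trans (rnormB _ _)) // (le_trans (lerD (rnormD _ _) (lexx _))) // rnormN.
  by rewrite (le_trans (lerD (lerD A2 A1) A3)) //; apply: eq_lerR; ring.
exists F => p /=; rewrite in_itv /= andbT => ap e e0.
have [|d d0 hd] := cf p _ e e0; first by rewrite /= in_itv /= ap.
exists d => // u; rewrite /= in_itv /= andbT => au ud.
have [pu|up] := leP p u.
  rewrite ger0_norm ?subr_ge0 //; apply: key => // r /andP[pr ru].
  apply: hd; first by rewrite /= in_itv /= andbT (le_trans ap).
  by move: ud; rewrite !ltr_norml; lra.
have -> : F u - F p - (u - p)%:C *: f p = - (F p - F u - (p - u)%:C *: f p) by lmod.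
rewrite rnormN distrC ger0_norm ?subr_ge0 ?(ltW up) //.
apply: key => //; first exact: ltW.
move=> r /andP[ur rp]; apply: hd; first by rewrite /= in_itv /= andbT (le_trans au).
by move: ud; rewrite !ltr_norml; lra.
Qed.

Lemma unif_cont f a b : a <= b -> cont_on `[a, b] f -> forall e : R, 0 < e ->
  exists2 d : R, 0 < d & forall p w, a <= p <= b -> a <= w <= b -> `|p - w| < d ->
    rnorm (f p - f w) <= e.
Proof.
move=> ab cf e e0.
suff [d d0 hd] : exists2 d : R, 0 < d & forall p w, a <= p <= b -> a <= w <= b ->
   `|p - w| < d -> rnorm (f p - f w) <= e by exists d.
(* [w] ranges over all of [[a, b]] while only [p] is confined to [[u, v]]: adjacent pieces then glue
   without comparing points on different sides. *)
pose Q u v := exists2 d : R, 0 < d & forall p w, u <= p <= v -> a <= w <= b ->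
   `|p - w| < d -> rnorm (f p - f w) <= e.
apply: (@creeping _ a b Q) => //.
- move=> p pab; have [||d d0 hd] := cf p _ e; rewrite ?in_itv //.
  exists d => // q w /andP[pq qp] wab; have -> : q = p by apply/le_anti/andP.
  by rewrite rnorm_distC distrC => h; apply: hd => //=; rewrite in_itv.
- move=> c d e' cd de _ _ [d1 d10 h1] [d2 d20 h2].
  exists (Num.min d1 d2); first by rewrite lt_min d10.
  move=> p w /andP[cp pe] wab; rewrite lt_min => /andP[p1 p2].
  have [pd|dp] := leP p d; first by apply: h1 => //; rewrite cp.
  by apply: h2 => //; rewrite pe ltW.
move=> p pab; have e2 : 0 < e / 2 by rewrite divr_gt0.
have [|d d0 hd] := cf p _ _ e2; first by rewrite /= in_itv.
exists (d / 2); first by rewrite divr_gt0.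
move=> u v au vb /andP[up pv] ud vd; exists (d / 2); first by rewrite divr_gt0.
move=> q w /andP[uq qv] wab qw.
rewrite (le_trans (rnorm_triangle _ (f p) _)) // [leRHS]splitr lerD //.
  apply: hd; first by rewrite /= in_itv /= (le_trans au) // (le_trans qv).
  by rewrite ltr_norml; lra.
rewrite rnorm_distC; apply: hd; first by rewrite /= in_itv.
by move: qw; rewrite !ltr_norml; lra.
Qed.

Lemma deriv_dev F f a b y (e : R) : a <= b -> deriv_on `[a, b] F f ->
  (forall r, a <= r <= b -> rnorm (f r - y) <= e) ->
  rnorm (F b - F a - (b - a)%:C *: y) <= e * (b - a).
Proof.
move=> ab dF h.
have -> : F b - F a - (b - a)%:C *: y = (F b - b%:C *: y) - (F a - a%:C *: y) by lmod.
apply: (@mean_value_cst _ _ a b e (fun u => F u - u%:C *: y) (fun u => f u - y)) => //.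
by move=> p pab; apply: deriv_atB; [exact: dF|exact: deriv_at_id].
Qed.

Lemma is_riemann_ftc F f a b : a <= b -> deriv_on `[a, b] F f -> cont_on `[a, b] f ->
  is_riemann_integral f a b (F b - F a).
Proof.
move=> ab dF cf eps eps0.
(* The summand 1 covers [a = b]; the factor 2 leaves room for the strict inequality in the
   definition of the integral. *)
have c0 : 0 < 2 * (b - a + 1) by rewrite mulr_gt0 // ltr_wpDl // subr_ge0.
have e0 : 0 < eps / (2 * (b - a + 1)) by rewrite divr_gt0.
have [d d0 hd] := unif_cont ab cf e0; exists d => // n s tag s0 sn hs.
have mono k : (k <= n)%N -> a <= s k.
  elim: k => [_|k IH kn]; first by rewrite s0.
  by have [h1 h2 _] := hs k kn; rewrite (le_trans (IH (ltnW kn))) // (le_trans h1).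
have mono' k : (k <= n)%N -> s (n - k)%N <= b.
  elim: k => [_|k IH kn]; first by rewrite subn0 sn.
  rewrite (le_trans _ (IH (ltnW kn))) //.
  have [|h1 h2 _] := hs (n - k.+1)%N; first by rewrite ltn_subrL (leq_ltn_trans _ kn).
  by move: h2; rewrite -subSn // subSS => h2; rewrite (le_trans h1).
have itv k : (k <= n)%N -> a <= s k <= b.
  by move=> kn; rewrite mono //= -(subKn kn) mono' // leq_subr.
have tel : F b - F a = \sum_(k < n) (F (s k.+1) - F (s k)).
  by rewrite -s0 -sn -(@telescope_sumr _ 0%N n (F \o s)) // big_mkord.
have telR : b - a = \sum_(k < n) (s k.+1 - s k).
  by rewrite -s0 -sn -(@telescope_sumr _ 0%N n s) // big_mkord.
rewrite tel -sumrB.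
have sumle (I : nat -> V) m : rnorm (\sum_(k < m) I k) <= \sum_(k < m) rnorm (I k).
  elim: m => [|m IH]; first by rewrite !big_ord0 rnorm0.
  by rewrite !big_ord_recr (le_trans (rnormD _ _)) // lerD.
rewrite (le_lt_trans (sumle (fun k => (s k.+1 - s k)%:C *: f (tag k) - (F (s k.+1) - F (s k))) n)) //.
apply: (@le_lt_trans _ _ (eps / (2 * (b - a + 1)) * (b - a))); last first.
  have : 0 <= b - a by rewrite subr_ge0.
  move: (b - a) c0 => x c0 x0; rewrite mulrAC ltr_pdivrMr // ltr_pM2l //; lra.
rewrite [X in _ <= _ * X]telR mulr_sumr; apply: ler_sum => k _.
have [h1 h2 h3] := hs k (ltn_ord k).
have /andP[ak kb] := itv k (ltnW (ltn_ord k)); have /andP[ak1 kb1] := itv k.+1 (ltn_ord k).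
rewrite rnorm_distC; apply: (deriv_dev (f := f)) => //; first exact: le_trans h2.
  by apply: deriv_onS dF => r /=; rewrite !in_itv /= => /andP[kr rk]; rewrite (le_trans ak) // (le_trans rk).
move=> r /andP[kr rk]; apply: hd.
- by rewrite (le_trans ak) // (le_trans rk).
- by rewrite (le_trans ak) // (le_trans h2).
- by rewrite ltr_norml; lra.
Qed.

Lemma is_riemann_unique f a b I J : a <= b ->
  is_riemann_integral f a b I -> is_riemann_integral f a b J -> I = J.
Proof.
move=> ab hI hJ; apply/eqP; rewrite -subr_eq0; apply/eqP.
apply: (@rnorm_small _ _ _ 2) => e e0.
have [d1 d10 H1] := hI e e0; have [d2 d20 H2] := hJ e e0.
pose d := Num.min d1 d2; have d0 : 0 < d by rewrite lt_min d10.
have [N hN] := archi_lt ((b - a) / d); pose n := N.+1.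
have n0 : 0 < n%:R :> R by rewrite ltr0n.
have ba0 : 0 <= b - a by rewrite subr_ge0.
have mesh : (b - a) / n%:R < d.
  by rewrite ltr_pdivrMr // mulrC -ltr_pdivrMr // hN.
pose s k := a + k%:R * ((b - a) / n%:R).
have sS k : s k.+1 - s k = (b - a) / n%:R by rewrite /s -natr1; ring.
have s0 : s 0%N = a by rewrite /s mul0r addr0.
have sn : s n = b by rewrite /s mulrCA divff ?gt_eqF // mulr1 addrC subrK.
have hs dd : d <= dd -> forall k, (k < n)%N -> [/\ s k <= s k, s k <= s k.+1 & s k.+1 - s k < dd].
  move=> ddd k _; split => //; last by rewrite sS (lt_le_trans mesh).
  by rewrite -subr_ge0 sS divr_ge0 // ltW.
have h1 := H1 n s s s0 sn (hs _ _); have h2 := H2 n s s s0 sn (hs _ _).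
set S := \sum_(k < n) _ in h1 h2.
have -> : I - J = (S - J) - (S - I) by lmod.
rewrite (le_trans (rnormB _ _)) //.
have := h1 _; have := h2 _; rewrite !ge_min !lexx orbT => /(_ erefl) A /(_ erefl) B.
by lra.
Qed.

Lemma riemann_ftc F f a b : a <= b -> deriv_on `[a, b] F f -> cont_on `[a, b] f ->
  riemann_integral f a b = F b - F a.
Proof.
move=> ab dF cf; have h := is_riemann_ftc ab dF cf.
by apply: (is_riemann_unique ab _ h); rewrite /riemann_integral; apply: getPex; exists (F b - F a).
Qed.

End Integral.

(** * Zabreiko's lemma and the closed graph theorem *)

Section Gelfand.
Context {R : realType}.
Local Notation C := R[i].
Context {V : normedModType C}.

Lemma expn2_gt0 n : 0 < 2 ^+ n :> R. Proof. by rewrite exprn_gt0. Qed.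

Lemma expn2_small (e : R) : 0 < e -> exists N, forall n, (N <= n)%N -> (2 ^+ n)^-1 <= e.
Proof.
move=> e0; have [N hN] := archi_lt e^-1; exists N.+1 => -[//|n] Nn.
rewrite invf_ple ?posrE ?expn2_gt0 // (le_trans (ltW (hN n.+1 (ltnW Nn)))) //.
by rewrite -natrX ler_nat ltn_expl.
Qed.

(* Zabreiko's lemma: Baire's argument with nested balls, then successive
   approximation. *)
Lemma countably_subadditive_bounded (p : V -> R) : complete_rn V ->
  (forall x y, p (x + y) <= p x + p y) ->
  (forall (a : R) x, p (a%:C *: x) <= `|a| * p x) ->
  (forall (u : nat -> V) x (c : R), (forall n, p (u n) <= c / 2 ^+ n) ->
     tends (fun n => \sum_(k < n) u k) x ->
     p x <= 2 * c) ->
  exists M, forall x, p x <= M * rnorm x.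
Proof.
move=> cV pD pZ pS.
have pN x : p (- x) <= p x.
  by have := pZ (-1) x; rewrite rcN rc1 scaleN1r normrN normr1 mul1r.
(* Baire: some sublevel set of [p] is dense in a ball. Otherwise balls can be nested so that each
   avoids the next sublevel set, and [p] would exceed every integer at their common point. *)
have [N [a [r [r0 dens]]]] : exists (N : nat) a (r : R), 0 < r /\ forall x, rnorm (x - a) < r ->
    forall e : R, 0 < e -> exists2 y, p y <= N%:R & rnorm (x - y) < e.
  apply: contrapT => nex.
  have step (nar : nat * V * R) : exists xs : V * R, 0 < nar.2 ->
     [/\ 0 < xs.2, xs.2 <= nar.2 / 2, rnorm (xs.1 - nar.1.2) + xs.2 <= nar.2 &
      forall y, rnorm (xs.1 - y) <= xs.2 -> nar.1.1%:R < p y].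
    case: nar => -[n a] r /=; have [r0|] := ltP 0 r; last by exists (0, 0).
    have /existsNP[x] : ~ forall x, rnorm (x - a) < r ->
        forall e : R, 0 < e -> exists2 y, p y <= n%:R & rnorm (x - y) < e.
      by move=> h; apply: nex; exists n, a, r.
    move=> /not_implyP[xa] /existsNP[e] /not_implyP[e0 he].
    exists (x, Num.min (e / 2) (Num.min ((r - rnorm (x - a)) / 2) (r / 2))) => _ /=; split.
    - by rewrite !lt_min !divr_gt0 // subr_gt0.
    - by rewrite !ge_min lexx !orbT.
    - have rx : 0 < r - rnorm (x - a) by rewrite subr_gt0.
      rewrite -lerBrDl; apply: (@le_trans _ _ ((r - rnorm (x - a)) / 2)); last lra.
      by rewrite !ge_min lexx !orbT.
    - move=> y; rewrite le_min => /andP[ye _]; rewrite ltNge; apply/negP => py.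
      by apply: he; exists y => //; lra.
  have [f hf] := choice step.
  pose fix s n : V * R := if n is m.+1 then f (m, (s m).1, (s m).2) else (0, 1).
  have s0 n : 0 < (s n).2.
    by elim: n => [|n IH] //=; have [] := hf (n, (s n).1, (s n).2) IH.
  have sS n : [/\ (s n.+1).2 <= (s n).2 / 2, rnorm ((s n.+1).1 - (s n).1) + (s n.+1).2 <= (s n).2
     & forall y, rnorm ((s n.+1).1 - y) <= (s n.+1).2 -> n%:R < p y].
    by have [] := hf (n, (s n).1, (s n).2) (s0 n).
  have s2 n : (s n).2 <= (2 ^+ n)^-1.
    elim: n => [|n IH]; first by rewrite expr0 invr1.
    have [h _ _] := sS n; rewrite (le_trans h) // exprS invfM mulrC.
    by rewrite ler_wpM2l ?invr_ge0.
  have nest n k : rnorm ((s (n + k)%N).1 - (s n).1) + (s (n + k)%N).2 <= (s n).2.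
    elim: k => [|k IH]; first by rewrite addn0 subrr rnorm0 add0r.
    have [_ h _] := sS (n + k)%N; rewrite addnS.
    have := rnorm_triangle (s (n + k).+1).1 (s (n + k)%N).1 (s n).1.
    by lra.
  have cau m n N : (N <= m)%N -> (N <= n)%N -> rnorm ((s m).1 - (s n).1) <= 2 * (s N).2.
    move=> /subnKC <- /subnKC <-.
    rewrite (le_trans (rnorm_triangle _ (s N).1 _)) // [X in _ + X]rnorm_distC.
    have := nest N (m - N)%N; have := nest N (n - N)%N.
    have := s0 (N + (m - N))%N; have := s0 (N + (n - N))%N; lra.
  have [|l hl] := cV (fun n => (s n).1).
    move=> e e0; have [N hN] := expn2_small (divr_gt0 e0 (ltr0Sn _ 1)).
    exists N => m n Nm Nn; rewrite (le_trans (cau _ _ _ Nm Nn)) //.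
    by have := s2 N; have := hN N (leqnn _); lra.
  have lclose n : rnorm ((s n).1 - l) <= (s n).2.
    apply: le_eps => e e0; have [N hN] := hl e e0.
    rewrite (le_trans (rnorm_triangle _ (s (n + N)%N).1 _)) // lerD ?hN ?leq_addl //.
    by rewrite rnorm_distC; have := nest n N; have := s0 (n + N)%N; lra.
  have [n hn] := archi_lt (p l).
  have [_ _ h] := sS n.+1; have := h l (lclose n.+2).
  by rewrite ltNge (ltW (hn n (leqnn _))).
(* Differences of points of the dense set move its centre to 0. *)
have dens0 x : rnorm x < r -> forall e : R, 0 < e -> exists2 y, p y <= 2 * N%:R & rnorm (x - y) < e.
  move=> xr e e0; have e2 : 0 < e / 2 by rewrite divr_gt0.
  have [|y1 p1 d1] := dens (x + a) _ _ e2; first by rewrite addrK.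
  have [|y2 p2 d2] := dens a _ _ e2; first by rewrite subrr rnorm0.
  exists (y1 - y2); first by rewrite (le_trans (pD _ _)) //; have := pN y2; lra.
  have -> : x - (y1 - y2) = (x + a - y1) - (a - y2) by lmod.
  by rewrite (le_lt_trans (rnormB _ _)) //; lra.
(* [approx] scales a vector of norm at most [rho] by [r / (2 rho)] into the ball of radius [r].
   Undoing this turns the bound [2 N] into [K rho] and the distance [r / 4] into [rho / 2]. *)
pose K := 4 * N%:R / r.
have approx x (rho : R) : 0 < rho -> rnorm x <= rho ->
    exists2 y, p y <= K * rho & rnorm (x - y) <= rho / 2.
  move=> rho0 xr; pose s := r / (2 * rho).
  have s0 : 0 < s by rewrite divr_gt0 // mulr_gt0.
  have [||y py yx] := dens0 (s%:C *: x) _ (r / 4).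
  - rewrite rnormZr gtr0_norm // (le_lt_trans (ler_wpM2l (ltW s0) xr)) //.
    rewrite /s -mulrA [(_ * _)^-1]invfM -mulrA mulVf ?gt_eqF //.
    by rewrite mulr1 ltr_pdivrMr // ltr_pMr // ltr1n.
  - by rewrite divr_gt0.
  exists (s^-1%:C *: y).
    rewrite (le_trans (pZ _ _)) // gtr0_norm ?invr_gt0 //.
    rewrite (le_trans (ler_wpM2l _ py)) ?invr_ge0 ?(ltW s0) //.
    by apply: eq_lerR; rewrite /s /K; field; rewrite !gt_eqF.
  have -> : x - s^-1%:C *: y = s^-1%:C *: (s%:C *: x - y).
    by rewrite scalerBr scalerA -rcM mulVf ?gt_eqF // scale1r.
  rewrite rnormZr gtr0_norm ?invr_gt0 // (le_trans (ler_wpM2l _ (ltW yx))) ?invr_ge0 ?(ltW s0) //.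
  by apply: eq_lerR; rewrite /s; field; rewrite !gt_eqF.
have next (xr : V * R) : exists y, 0 < xr.2 -> rnorm xr.1 <= xr.2 ->
    p y <= K * xr.2 /\ rnorm (xr.1 - y) <= xr.2 / 2.
  case: xr => x rho /=; have [r1|] := ltP 0 rho; last by exists 0.
  by have [r2|] := leP (rnorm x) rho; [have [y] := approx _ _ r1 r2; exists y|exists 0].
have [f hf] := choice next.
exists (2 * K) => x; have [x0|] := ltP 0 (rnorm x); last first.
  move=> /rnorm_le0 ->; rewrite rnorm0 mulr0.
  by have := pZ 0 0; rewrite scaler0 normr0 mul0r.
set rho := rnorm x.
(* Remainders of the successive approximation. The [n]-th is at most [rho / 2 ^ n], so the
   subtracted terms form a series with sum [x] to which countable subadditivity applies. *)
pose fix xs n : V := if n is m.+1 then xs m - f (xs m, rho / 2 ^+ m) else x.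
have rn n : 0 < rho / 2 ^+ n by rewrite divr_gt0 ?expn2_gt0.
have hxs n : rnorm (xs n) <= rho / 2 ^+ n.
  elim: n => [|n IH]; first by rewrite expr0 divr1.
  have [_ h] := hf (xs n, rho / 2 ^+ n) (rn n) IH.
  by rewrite (le_trans h) //= exprS invfM mulrCA mulrC.
rewrite -mulrA; apply: (pS (fun n => f (xs n, rho / 2 ^+ n))).
  by move=> n; have [h _] := hf (xs n, rho / 2 ^+ n) (rn n) (hxs n); rewrite -mulrA.
have sumE n : \sum_(k < n) f (xs k, rho / 2 ^+ k) = x - xs n.
  elim: n => [|n IH]; first by rewrite big_ord0 subrr.
  by rewrite big_ord_recr /= IH; lmod.
move=> e e0; have [m hm] := expn2_small (divr_gt0 e0 x0).
exists m => n mn; rewrite sumE addrC addrA addNr add0r rnormN (le_trans (hxs n)) //.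
by rewrite -ler_pdivlMl // mulrC hm.
Qed.

(** Zabreiko's lemma for [x -> |L x|]. Closedness supplies countable subadditivity: when [|L (u k)|]
    decays geometrically, the image series is Cauchy, and its sum must be [L x]. *)
Lemma closed_linear_bounded {W : normedModType C} (L : V -> W) :
  complete_rn V -> complete_rn W -> linear L ->
  (forall (u : nat -> V) x y,
     tends u x -> tends (L \o u) y -> L x = y) -> bounded_linear L.
Proof.
move=> cV cW lL clL; split => //.
apply: (countably_subadditive_bounded cV) => [x y|a x|u x c hu hx].
- by rewrite (linfD lL) rnormD.
- by rewrite (linfZ lL) rnormZr.
have c0 : 0 <= c by have := le_trans (rnorm_ge0 _) (hu 0%N); rewrite expr0 divr1.
pose S n := \sum_(k < n) L (u k).
have tail m k : rnorm (S (m + k)%N - S m) <= 2 * c / 2 ^+ m - 2 * c / 2 ^+ (m + k).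
  elim: k => [|k IH]; first by rewrite addn0 !subrr rnorm0.
  rewrite addnS /S big_ord_recr /= addrAC (le_trans (rnormD _ _)) //.
  rewrite (le_trans (lerD IH (hu _))) // exprS.
  by apply: eq_lerR; field; rewrite !gt_eqF ?expn2_gt0.
have tail' m n : (m <= n)%N -> rnorm (S n - S m) <= 2 * c / 2 ^+ m.
  move=> /subnKC <-; rewrite (le_trans (tail _ _)) // gerBl.
  by rewrite divr_ge0 ?mulr_ge0 // ltW ?expn2_gt0.
have [|l hl] := cW S.
  move=> e e0; have c4 : 0 < 4 * c + 1 by rewrite ltr_wpDl ?mulr_ge0.
  have [N hN] := expn2_small (divr_gt0 e0 c4).
  exists N => m n Nm Nn; rewrite (le_trans (rnorm_triangle _ (S N) _)) //.
  rewrite [X in _ + X]rnorm_distC (le_trans (lerD (tail' _ _ Nm) (tail' _ _ Nn))) //.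
  have := hN N (leqnn _); rewrite ler_pdivlMr // => h; apply: le_trans h.
  have : 0 <= (2 ^+ N : R)^-1 by rewrite invr_ge0 ltW ?expn2_gt0.
  by move: (_^-1) => z; nra.
have -> : L x = l.
  apply: (clL _ _ _ hx) => e e0; have [N hN] := hl e e0.
  by exists N => n Nn; rewrite /= (linf_sum lL) hN.
apply: le_eps => e e0; have [N hN] := hl e e0.
rewrite (le_trans (rnorm_dist_ge _ (S N))) // lerD //; last by rewrite rnorm_distC hN.
have := tail' 0%N N (leq0n _); rewrite /S big_ord0 subr0 expr0 divr1 //.
Qed.

End Gelfand.

(** * C0-semigroups *)

Section Semigroup.
Context {R : realType}.
Local Notation C := R[i].
Context {V : normedModType C}.
Local Notation pos := (`[0, +oo[%classic : set R).

Lemma posP (t : R) : pos t <-> 0 <= t.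
Proof. by rewrite /= in_itv /= andbT. Qed.

Lemma right_derivP (F : R -> V) y :
  (h^-1)%:C *: (F h - F 0) @[h --> (0 : R)^'+] --> y <-> deriv_at pos F 0 y.
Proof.
split=> [/cvgrPdist_le h e e0|h].
  have e0c : 0 < e%:C :> C by rewrite ltcR.
  have /nbhs_ballP[d /= d0 hd] := h _ e0c; exists d => // u /posP u0; rewrite subr0 => ud.
  move: u0; rewrite le_eqVlt => /predU1P[<-|u0].
    by rewrite subrr scale0r subr0 rnorm0 normr0 mulr0.
  have := hd u; rewrite /ball /= sub0r normrN => /(_ ud u0).
  rewrite normE lecR rnorm_distC => h1.
  have -> : F u - F 0 - u%:C *: y = u%:C *: ((u^-1)%:C *: (F u - F 0) - y).
    by rewrite scalerBr scalerA -rcM divff ?gt_eqF // scale1r.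
  by rewrite rnormZr mulrC ler_wpM2r.
apply/cvgrPdist_le => e e0; have [-> e'0] := posc_real e0.
have [d d0 hd] := h _ e'0; apply/nbhs_ballP; exists d => //= u.
rewrite /ball /= sub0r normrN => ud u0.
have := hd u ((posP u).2 (ltW u0)); rewrite subr0 => /(_ ud) h1.
rewrite normE lecR rnorm_distC.
have -> : (u^-1)%:C *: (F u - F 0) - y = (u^-1)%:C *: (F u - F 0 - u%:C *: y).
  by rewrite [RHS]scalerBr scalerA -rcM mulVf ?gt_eqF // scale1r.
rewrite rnormZr gtr0_norm ?invr_gt0 // mulrC ler_pdivrMr //.
by rewrite (gtr0_norm u0) in h1.
Qed.

Lemma deriv_const_unique (a b : R) (F G f : R -> V) : a <= b ->
  deriv_on `[a, b] F f -> deriv_on `[a, b] G f -> F b - F a = G b - G a.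
Proof.
move=> ab dF dG; apply/eqP; rewrite -subr_eq0; apply/eqP/rnorm_le0.
have -> : F b - F a - (G b - G a) = (F b - G b) - (F a - G a) by lmod.
rewrite -(mul0r (b - a)).
apply: (@mean_value_cst _ _ a b 0 (fun u => F u - G u) (fun u => f u - f u)) => //.
  by move=> p pab; apply: deriv_atB; [exact: dF|exact: dG].
by move=> t _; rewrite subrr rnorm0.
Qed.

Lemma tends_bounded (u : nat -> V) x : tends u x -> exists2 B : R, 0 <= B & forall n, rnorm (u n) <= B.
Proof.
move=> h; have [N hN] := h 1 ltr01.
exists (\sum_(k < N) rnorm (u k) + (rnorm x + 1)) => [|n].
  by rewrite addr_ge0 ?sumr_ge0 ?addr_ge0 // => *; exact: rnorm_ge0.
have [Nn|nN] := leqP N n.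
  rewrite (le_trans (rnorm_dist_ge _ x)) // (le_trans (lerD (lexx _) (hN n Nn))) //.
  by rewrite lerDr sumr_ge0 // => *; exact: rnorm_ge0.
rewrite (bigD1 (Ordinal nN)) //= -addrA lerDl addr_ge0 ?addr_ge0 ?rnorm_ge0 //.
by rewrite sumr_ge0 // => *; exact: rnorm_ge0.
Qed.

Definition exp_bounded (T : R -> V -> V) (M w : R) := forall (t : R) x, 0 <= t ->
  rnorm (T t x) <= M * expR (w * t) * rnorm x.

(** A failure yields times [t_n -> 0] and vectors with too large images. Strong continuity at 0
    makes the supremum of [|T(t_n) x|] over [n] finite for each [x], and Zabreiko's lemma bounds it
    by a multiple of [|x|], a contradiction. *)
Lemma C0_near0_bounded (T : R -> V -> V) : complete_rn V -> C0_semigroup T -> exists2 d : R, 0 < d &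
  exists M : R, forall (t : R) x, 0 <= t -> t <= d -> rnorm (T t x) <= M * rnorm x.
Proof.
move=> cV [bT T0 _ Tc].
have Tc' x (e : R) : 0 < e -> exists2 d : R, 0 < d & forall t, 0 <= t -> t < d -> rnorm (T t x - x) <= e.
  move=> e0; have e0c : 0 < e%:C :> C by rewrite ltcR.
  move/cvgrPdist_le : (Tc x) => /(_ _ e0c)/nbhs_ballP[d /= d0 hd].
  exists d => // t; rewrite le_eqVlt => /predU1P[<- _|t0 td].
    by rewrite T0 subrr rnorm0 ltW.
  have := hd t; rewrite /ball /= sub0r normrN gtr0_norm // => /(_ td t0).
  by rewrite normE lecR rnorm_distC.
apply: contrapT => nex.
have bad (n : nat) : exists tx : R * V, [/\ 0 <= tx.1, tx.1 <= n.+1%:R^-1 &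
    n%:R * rnorm tx.2 < rnorm (T tx.1 tx.2)].
  apply: contrapT => h; apply: nex; exists n.+1%:R^-1; first by rewrite invr_gt0.
  exists n%:R => t x t0 tn; rewrite leNgt; apply/negP => hx.
  by apply: h; exists (t, x).
have [f hf] := choice bad.
pose S x := [set rnorm (T (f n).1 x) | n in [set: nat]].
have Tlim x : tends (fun n => T (f n).1 x) x.
  move=> e e0; have [d d0 hd] := Tc' x e e0; have [N hN] := archi_lt d^-1.
  exists N => n Nn; have [h1 h2 _] := hf n; apply: hd => //.
  by rewrite (le_lt_trans h2) // invf_plt ?posrE // hN.
have hS x : has_sup (S x).
  split; first by exists (rnorm (T (f 0%N).1 x)); exists 0%N.
  by have [B _ hB] := tends_bounded (Tlim x); exists B => _ [n _ <-].
pose p x := sup (S x).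
have pge n x : rnorm (T (f n).1 x) <= p x by apply: ub_le_sup; [exact: (hS x).2|exists n].
have ple x c : (forall n, rnorm (T (f n).1 x) <= c) -> p x <= c.
  by move=> h; apply: ge_sup; [exact: (hS x).1|move=> _ [n _ <-]].
have lT n : linear (T (f n).1) by have [h1 _ _] := hf n; exact: (bT _ h1).1.
have [|||M hM] := countably_subadditive_bounded (p := p) cV.
- by move=> x y; apply: ple => n; rewrite (linfD (lT n)) (le_trans (rnormD _ _)) // lerD.
- by move=> a x; apply: ple => n; rewrite (linfZ (lT n)) rnormZr ler_wpM2l.
- move=> u x c hu hx; apply: ple => n.
  have c0 : 0 <= c.
    by have := le_trans (rnorm_ge0 _) (le_trans (pge 0%N _) (hu 0%N)); rewrite expr0 divr1.
  have [h1 _ _] := hf n; have [K K0 hK] := bounded_linear_ge0 (bT _ h1).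
  apply: (@le_epsM _ _ _ K) => e e0; have [N hN] := hx e e0.
  rewrite (le_trans (rnorm_dist_ge _ (T (f n).1 (\sum_(k < N) u k)))) //.
  apply: lerD; last first.
    by rewrite -(linfB (lT n)) (le_trans (hK _)) // ler_wpM2l // rnorm_distC hN.
  rewrite (linf_sum (lT n)); apply: (@le_trans _ _ (2 * c - 2 * c / 2 ^+ N)); last first.
    by rewrite gerBl divr_ge0 ?mulr_ge0 // ltW ?expn2_gt0.
  elim: N {hN} => [|N IH]; first by rewrite big_ord0 rnorm0 expr0 divr1 subrr.
  rewrite big_ord_recr /= (le_trans (rnormD _ _)) //.
  rewrite (le_trans (lerD IH (le_trans (pge n _) (hu N)))) // exprS.
  by apply: eq_lerR; field; rewrite gt_eqF ?expn2_gt0.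
have [N hN] := archi_lt M; have [_ _ h] := hf N.+1.
have h1 := le_trans (pge N.+1 (f N.+1).2) (hM _).
have := lt_le_trans h h1; rewrite ltNge ler_wpM2r ?rnorm_ge0 //.
by rewrite ltW // hN.
Qed.

Lemma C0_exp_bounded (T : R -> V -> V) : complete_rn V -> C0_semigroup T ->
  exists M w, [/\ 1 <= M, 0 <= w & exp_bounded T M w].
Proof.
move=> cV hT; have [d d0 [M0 hM0]] := C0_near0_bounded cV hT.
have [bT T0 TD _] := hT.
pose M := Num.max 1 M0; have M1 : 1 <= M by rewrite le_max lexx.
have Mp : 0 < M by rewrite (lt_le_trans ltr01).
(* A time step of length [d] costs a factor [M], which the rate [ln M / d] pays for; [M >= 1] makes
   this rate nonnegative. *)
have w0 : 0 <= ln M / d by rewrite divr_ge0 ?ln_ge0 // ltW.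
exists M, (ln M / d); split => // t x t0.
have key n : forall t x, 0 <= t -> t <= n.+1%:R * d -> rnorm (T t x) <= M * expR (ln M / d * t) * rnorm x.
  elim: n => [|n IH] {}t {}x {}t0 tn.
    rewrite mul1r in tn; rewrite (le_trans (hM0 t x t0 tn)) // ler_wpM2r ?rnorm_ge0 //.
    rewrite (@le_trans _ _ M) ?le_max ?lexx ?orbT // ler_peMr ?(ltW Mp) //.
    by rewrite -expR0 ler_expR mulr_ge0.
  have [td|dt] := leP t d.
    by apply: IH => //; rewrite (le_trans td) // ler_peMl ?(ltW d0) // ler1n.
  have td0 : 0 <= t - d by rewrite subr_ge0 ltW.
  rewrite -{1}(subrK d t) addrC TD ?(ltW d0) //.
  rewrite (le_trans (hM0 _ _ (ltW d0) (lexx _))) //.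
  have h1 : rnorm (T (t - d) x) <= M * expR (ln M / d * (t - d)) * rnorm x.
    by apply: IH => //; rewrite lerBlDr (le_trans tn) // -[n.+2%:R]natr1 mulrDl mul1r.
  have M0M : M0 <= M by rewrite le_max lexx orbT.
  rewrite (le_trans (ler_wpM2r (rnorm_ge0 _) M0M)) // (le_trans (ler_wpM2l (ltW Mp) h1)) //.
  rewrite mulrBr divfK ?gt_eqF // expRD expRN lnK ?posrE //.
  by apply: eq_lerR; field; rewrite gt_eqF.
have [N hN] := archi_lt (t / d); apply: (key N) => //.
by rewrite -ler_pdivrMr // ltW // hN.
Qed.

End Semigroup.

(** * Orbits and the generator *)

Section Generator.
Context {R : realType}.
Local Notation C := R[i].
Context {V : normedModType C} (cV : complete_rn V).
Context {T : R -> V -> V} {A : unbounded_op V V}.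
Hypothesis hT : C0_semigroup T.
Hypothesis hA : generator_of A T.
Context {M w : R}.
Hypothesis hM : exp_bounded T M w.
Local Notation pos := (`[0, +oo[%classic : set R).

Lemma C0_0 x : T 0 x = x. Proof. by case: hT. Qed.
Lemma C0_bl t : 0 <= t -> bounded_linear (T t). Proof. by case: hT => + _ _ _; apply. Qed.
Lemma C0_lin t : 0 <= t -> linear (T t). Proof. by move=> /C0_bl[]. Qed.
Lemma C0_D s t x : 0 <= s -> 0 <= t -> T (s + t) x = T s (T t x).
Proof. by case: hT => _ _ + _ s0 t0; apply. Qed.

Lemma generatorP x y : (dom A x /\ A x = y) <-> deriv_at pos (T^~ x) 0 y.
Proof. by rewrite -right_derivP C0_0; exact: hA. Qed.

Lemma generator_lin (a : C) x y : dom A x -> dom A y ->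
  dom A (a *: x + y) /\ A (a *: x + y) = a *: A x + A y.
Proof.
move=> dx dy; apply/generatorP.
have h : deriv_at pos (fun t => a *: T t x + T t y) 0 (a *: A x + A y).
  apply: deriv_atD; last exact/generatorP.
  exact: (deriv_atL (bounded_linearZ a) (proj1 (generatorP _ _) (conj dx erefl))).
apply: deriv_at_ext h; first by apply/posP.
by move=> u /posP u0; rewrite (C0_lin u0).
Qed.

Lemma dom_generator0 : dom A 0 /\ A 0 = 0.
Proof.
apply/generatorP; apply: (@deriv_at_ext _ _ _ (fun=> 0)); last exact: deriv_at_cst.
  by apply/posP.
by move=> u /posP u0; rewrite (linf0 (C0_lin u0)).
Qed.

Lemma dom_generatorD x y : dom A x -> dom A y -> dom A (x + y) /\ A (x + y) = A x + A y.
Proof. by move=> dx dy; have := generator_lin 1 dx dy; rewrite !scale1r. Qed.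

Lemma dom_generatorZ a x : dom A x -> dom A (a *: x) /\ A (a *: x) = a *: A x.
Proof.
by move=> dx; have [d0 e0] := dom_generator0; have := generator_lin a dx d0; rewrite e0 !addr0.
Qed.

Lemma dom_generatorB x y : dom A x -> dom A y -> dom A (x - y) /\ A (x - y) = A x - A y.
Proof.
move=> dx /(dom_generatorZ (-1)) []; rewrite !scaleN1r => dy <-; exact: dom_generatorD.
Qed.

Lemma C0_bounded (b : R) : exists2 B : R, 0 < B & forall (t : R) x, 0 <= t -> t <= b ->
  rnorm (T t x) <= B * rnorm x.
Proof.
exists (`|M| * expR (`|w| * `|b|) + 1); first by rewrite ltr_wpDl // mulr_ge0 // expR_ge0.
move=> t x t0 tb; rewrite (le_trans (hM x t0)) // ler_wpM2r ?rnorm_ge0 //.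
rewrite (@le_trans _ _ (`|M| * expR (`|w| * `|b|))) ?lerDl //.
apply: le_trans (ler_wpM2r (expR_ge0 _) (ler_norm M)) _.
rewrite ler_wpM2l // ler_expR (le_trans (ler_wpM2r t0 (ler_norm w))) // ler_wpM2l //.
by rewrite (le_trans tb) ?ler_norm.
Qed.

Lemma C0_right x (e : R) : 0 < e -> exists2 d : R, 0 < d & forall t : R, 0 <= t -> t < d -> rnorm (T t x - x) <= e.
Proof.
have [_ _ _ Tc] := hT; move=> e0; have e0c : 0 < e%:C :> C by rewrite ltcR.
move/cvgrPdist_le : (Tc x) => /(_ _ e0c)/nbhs_ballP[d /= d0 hd].
exists d => // t; rewrite le_eqVlt => /predU1P[<- _|t0 td].
  by rewrite C0_0 subrr rnorm0 ltW.
have := hd t; rewrite /ball /= sub0r normrN gtr0_norm // => /(_ td t0).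
by rewrite normE lecR rnorm_distC.
Qed.

Lemma orbit_cont x : cont_on pos (T^~ x).
Proof.
move=> p /posP p0 e e0; have [B B0 hB] := C0_bounded (p + 1).
have [d d0 hd] := C0_right x (divr_gt0 e0 B0).
exists (Num.min d 1); first by rewrite lt_min d0 ltr01.
move=> u /posP u0; rewrite lt_min => /andP[ud u1].
have Be y : rnorm y <= e / B -> B * rnorm y <= e.
  by move=> h; rewrite (le_trans (ler_wpM2l (ltW B0) h)) // mulrC divfK // gt_eqF.
have [pu|up] := leP p u.
  have up0 : 0 <= u - p by rewrite subr_ge0.
  have -> : T u x = T p (T (u - p) x) by rewrite -C0_D // addrC subrK.
  rewrite -(linfB (C0_lin p0)).
  rewrite (le_trans (hB _ _ p0 _)) ?lerDl // Be // hd //.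
  by rewrite ger0_norm in ud.
have up0 : 0 <= p - u by rewrite subr_ge0 ltW.
have -> : T p x = T u (T (p - u) x) by rewrite -C0_D // addrC subrK.
rewrite rnorm_distC -(linfB (C0_lin u0)).
rewrite (le_trans (hB _ _ u0 _)) ?(le_trans (ltW up)) ?lerDl // Be // hd //.
by rewrite distrC ger0_norm in ud.
Qed.

Lemma generator_orbit x t : dom A x -> 0 <= t -> dom A (T t x) /\ A (T t x) = T t (A x).
Proof.
move=> dx t0; apply/generatorP.
have h := deriv_atL (C0_bl t0) (proj1 (generatorP _ _) (conj dx erefl)).
apply: deriv_at_ext h; first exact/posP.
by move=> u /posP u0 /=; rewrite -!C0_D // addrC.
Qed.

(** The generator provides only a right derivative at 0. To the left of [p] the operator [T u] with
    [u < p] is factored out, and continuity of the orbit of [A x] replaces [T u (A x)] by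
    [T p (A x)]. *)
Lemma orbit_deriv x : dom A x -> deriv_on pos (T^~ x) (fun t => T t (A x)).
Proof.
move=> dx p /posP p0 e e0; have [B B0 hB] := C0_bounded p.
have e2 : 0 < e / 2 by rewrite divr_gt0.
have [d d0 hd] := proj1 (generatorP _ _) (conj dx erefl) _ (divr_gt0 e2 B0).
have [d' d'0 hd'] := orbit_cont (A x) ((posP p).2 p0) e2.
exists (Num.min d d'); first by rewrite lt_min d0.
move=> u /posP u0; rewrite lt_min => /andP[ud ud'].
have Be y h : rnorm y <= e / 2 / B * h -> B * rnorm y <= e / 2 * h.
  by move=> h1; rewrite (le_trans (ler_wpM2l (ltW B0) h1)) // mulrA [B * _]mulrC divfK // gt_eqF.
have [pu|up] := leP p u.
  have up0 : 0 <= u - p by rewrite subr_ge0.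
  have -> : T u x - T p x - (u - p)%:C *: T p (A x) = T p (T (u - p) x - T 0 x - (u - p - 0)%:C *: A x).
    by rewrite !(linfB (C0_lin p0)) (linfZ (C0_lin p0)) C0_0 -C0_D // subr0 [p + _]addrC subrK.
  rewrite (le_trans (hB _ _ p0 _)) // (@le_trans _ _ (e / 2 * `|u - p|)) //; last by rewrite ler_wpM2r // ler_pdivrMr // ler_peMr ?(ltW e0) // ler1n.
  apply: Be; have := hd (u - p); rewrite !subr0 => h; apply: h => //.
  exact/posP.
have up0 : 0 <= p - u by rewrite subr_ge0 ltW.
have -> : T u x - T p x - (u - p)%:C *: T p (A x) =
  - (T u (T (p - u) x - T 0 x - (p - u - 0)%:C *: A x)) - (u - p)%:C *: (T p (A x) - T u (A x)).
  have eT : T u (T (p - u) x) = T p x by rewrite -C0_D // addrC subrK.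
  rewrite !(linfB (C0_lin u0)) (linfZ (C0_lin u0)) C0_0 eT subr0; lmod.
rewrite (le_trans (rnormB _ _)) // rnormN [e]splitr mulrDl lerD //.
  rewrite (le_trans (hB _ _ u0 (ltW up))) //; apply: Be.
  rewrite [`|u - p|]distrC -[in leRHS](subr0 (p - u)); apply: hd; first exact/posP.
  by rewrite subr0 distrC.
by rewrite rnormZr mulrC ler_wpM2r // rnorm_distC hd' //; apply/posP.
Qed.

(** The orbit of [u n] has derivative [T r (A (u n))], which for small [r] is close to [y] uniformly
    in large [n]. The mean value estimate over [[0, h]] therefore survives the passage to the limit
    in [n]. *)
Lemma generator_closed (u : nat -> V) x y : (forall n, dom A (u n)) ->
  tends u x -> tends (fun n => A (u n)) y -> dom A x /\ A x = y.
Proof.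
move=> du hx hy; apply/generatorP => e e0.
have [B B0 hB] := C0_bounded 1.
have e2 : 0 < e / 2 by rewrite divr_gt0.
have [d d0 hd] := C0_right y e2.
exists (Num.min d 1); first by rewrite lt_min d0 ltr01.
move=> h /posP h0; rewrite subr0 lt_min ger0_norm // => /andP[hd1 h1].
rewrite C0_0; apply: (@le_epsM _ _ _ (B + 1 + h * B)) => k k0.
have [N1 H1] := hx k k0; have [N2 H2] := hy k k0.
pose n := maxn N1 N2; have {}H1 := H1 n (leq_maxl _ _); have {}H2 := H2 n (leq_maxr _ _).
have key : rnorm (T h (u n) - T 0 (u n) - (h - 0)%:C *: y) <= (B * k + e / 2) * (h - 0).
  apply: (@deriv_dev _ _ (T^~ (u n)) (fun t => T t (A (u n))) 0 h) => //.
    by apply: deriv_onS (orbit_deriv (du n)) => r /=; rewrite !in_itv /= andbT => /andP[].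
  move=> r /andP[r0 rh].
  rewrite (le_trans (rnorm_triangle _ (T r y) _)) // lerD //.
    rewrite -(linfB (C0_lin r0)) (le_trans (hB _ _ r0 _)) ?(le_trans rh) ?(ltW h1) //.
    by rewrite ler_wpM2l ?(ltW B0).
  by apply: hd => //; exact: le_lt_trans hd1.
have -> : T h x - x - h%:C *: y = (T h (u n) - T 0 (u n) - (h - 0)%:C *: y) - T h (u n - x) + (u n - x).
  rewrite (linfB (C0_lin h0)) C0_0 subr0; lmod.
rewrite (le_trans (rnormD _ _)) // (le_trans (lerD (rnormB _ _) (lexx _))) //.
rewrite (le_trans (lerD (lerD key (hB _ _ h0 (ltW h1))) H1)) // subr0.
have : B * rnorm (u n - x) <= B * k by rewrite ler_wpM2l ?(ltW B0).
by nra.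
Qed.

(** [T h] carries the integral of the orbit over [[0, t]] to that over [[h, h + t]], so its
    derivative in [h] comes from the two end points only. *)
Lemma orbit_integral F y : deriv_on pos F (T^~ y) -> forall t, 0 <= t ->
  dom A (F t - F 0) /\ A (F t - F 0) = T t y - y.
Proof.
move=> dF t t0; apply/generatorP.
have pos0 : pos 0 by apply/posP.
have h1 : deriv_at pos (fun h => F (h + t)) 0 (T t y).
  apply: deriv_at_comp_add; rewrite add0r; apply: deriv_atS (dF t ((posP t).2 t0)).
  by move=> u /posP; rewrite subr_ge0 => tu; apply/posP; exact: le_trans tu.
have h2 := dF 0 pos0; rewrite C0_0 in h2.
apply: deriv_at_ext pos0 _ (deriv_atB h1 h2) => h /posP h0.
have -> : T h (F t - F 0) = T h (F t) - T h (F 0) by rewrite (linfB (C0_lin h0)).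
have := @deriv_const_unique _ _ 0 t (fun s => F (h + s)) (fun s => T h (F s)) (fun s => T h (T s y)) t0.
rewrite addr0 addrC => ->; [by []| |].
  move=> s /=; rewrite in_itv /= => /andP[s0 st].
  under [X in deriv_at _ X]eq_fun do rewrite addrC.
  apply: deriv_at_comp_add; rewrite -C0_D // [h + s]addrC.
  apply: deriv_atS (dF _ _); last by apply/posP; rewrite addr_ge0.
  by move=> u /=; rewrite !in_itv /= andbT => /andP[+ _]; rewrite subr_ge0; exact: le_trans.
move=> s /=; rewrite in_itv /= => /andP[s0 st].
apply: (deriv_atL (C0_bl h0)); apply: deriv_atS (dF _ _); last exact/posP.
by move=> u /=; rewrite !in_itv /= andbT => /andP[].
Qed.

(** Short-time averages of the orbit of [x] lie in the domain by [orbit_integral] and tend to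
    [x]. *)
Lemma generator_dense x (e : R) : 0 < e -> exists2 z, dom A z & rnorm (z - x) <= e.
Proof.
move=> e0; have [F dF] := antiderivative cV (orbit_cont x).
have [d d0 hd] := dF 0 ((posP 0).2 (lexx _)) e e0.
have d2 : 0 < d / 2 by rewrite divr_gt0.
exists ((d / 2)^-1%:C *: (F (d / 2) - F 0)).
  by apply: (dom_generatorZ _ _).1; exact: (orbit_integral dF (ltW d2)).1.
have := hd (d / 2) ((posP _).2 (ltW d2)); rewrite subr0 gtr0_norm // C0_0.
rewrite ltr_pdivrMr // ltr_pMr // ltr1n => /(_ isT) h.
have -> : (d / 2)^-1%:C *: (F (d / 2) - F 0) - x =
    (d / 2)^-1%:C *: (F (d / 2) - F 0 - (d / 2)%:C *: x).
  by rewrite [RHS]scalerBr scalerA -rcM mulVf ?gt_eqF // scale1r.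
by rewrite rnormZr gtr0_norm ?invr_gt0 // mulrC ler_pdivrMr.
Qed.

End Generator.

(** * The complex exponential and rescaled semigroups *)

Section ComplexExponential.
Context {R : realType}.
Local Notation C := R[i].

Definition cexp (z : C) (t : R) : C^o :=
  (expR (complex.Re z * t))%:C * (cos (complex.Im z * t) +i* sin (complex.Im z * t)).

Lemma cexp0 z : cexp z 0 = 1.
Proof. by rewrite /cexp !mulr0 expR0 cos0 sin0 mul1r. Qed.

Lemma cexpD z s t : cexp z (s + t) = cexp z s * cexp z t.
Proof.
rewrite /cexp !mulrDr expRD cosD sinD rcM.
rewrite [RHS]mulrACA; congr (_ * _); apply/eqP; rewrite eq_complex /= eqxx /=.
by rewrite [X in X == _]addrC.
Qed.

Lemma cexpN z t : cexp (- z) t * cexp z t = 1.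
Proof.
have -> : cexp (- z) t = cexp z (- t) by rewrite /cexp raddfN /= raddfN /= !mulrN !mulNr.
by rewrite -cexpD addNr cexp0.
Qed.

Lemma norm_cexp z t : complex.Re `|cexp z t| = expR (complex.Re z * t).
Proof.
rewrite normrM normcRe (ger0_norm (expR_ge0 _)) normc_def /=.
by rewrite cos2Dsin2 sqrtr1 !mulr1 /= ?mulr0 ?subr0.
Qed.

Lemma deriv_at_real (D : set R) (g : R -> R) (p y : R) : is_derive p 1 g y ->
  deriv_at D (fun t => (g t)%:C : C^o) p (y%:C).
Proof.
move=> dg e e0; have [d d0 hd] := is_derive_eps dg e0; exists d => // u _ /hd.
rewrite -[X in rnorm X]/((g u)%:C - (g p)%:C - (u - p)%:C * y%:C).
by rewrite -!rcN -!rcM -!rcN -!rcD /rnorm normcRe.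
Qed.

Lemma deriv_cexp (D : set R) z p : deriv_at D (cexp z) p (z * cexp z p).
Proof.
pose a := complex.Re z; pose b := complex.Im z.
have -> : cexp z = fun t => (expR (a * t) * cos (b * t))%:C + 'i%C *: ((expR (a * t) * sin (b * t))%:C : C^o).
  apply/funext => t; rewrite /cexp -/a -/b; apply/eqP; rewrite eq_complex /=.
  by rewrite !mul0r !mul1r ?mulr0 !subr0 ?add0r ?addr0 ?mul0r ?addr0 ?subr0 !eqxx.
have da : is_derive p 1 (fun t => a * t) a.
  by apply: is_derive_eq; rewrite /GRing.scale /= mulr1.
have db : is_derive p 1 (fun t => b * t) b.
  by apply: is_derive_eq; rewrite /GRing.scale /= mulr1.
have de : is_derive p 1 (fun t => expR (a * t)) (expR (a * p) * a) by exact: is_derive1_comp.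
have dc : is_derive p 1 (fun t => cos (b * t)) (- sin (b * p) * b) by exact: is_derive1_comp.
have ds : is_derive p 1 (fun t => sin (b * t)) (cos (b * p) * b) by exact: is_derive1_comp.
apply: deriv_at_eq.
  apply: deriv_atD; last apply: (deriv_atL (bounded_linearZ 'i%C)).
    by apply: deriv_at_real; exact: is_deriveM.
  by apply: deriv_at_real; exact: is_deriveM.
have zE : z = a +i* b by rewrite /a /b; case: (z).
rewrite /cexp -/a -/b [in RHS]zE; apply/eqP; rewrite eq_complex /= /GRing.scale /=.
by apply/andP; split; apply/eqP; ring.
Qed.

End ComplexExponential.

Section Rescale.
Context {R : realType}.
Local Notation C := R[i].
Context {V : normedModType C}.
Context {T : R -> V -> V} {A : unbounded_op V V}.
Hypothesis hT : C0_semigroup T.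
Hypothesis hA : generator_of A T.
Local Notation pos := (`[0, +oo[%classic : set R).

Definition rescale (z : C) (S : R -> V -> V) : R -> V -> V := fun t x => cexp z t *: S t x.

Definition shift_op (z : C) : unbounded_op V V :=
  UnboundedOp (dom A) (fun x => A x + z *: x).

Lemma right_cvg (W : normedModType C) (F : R -> W) : (forall e : R, 0 < e ->
  exists2 d : R, 0 < d & forall u, pos u -> `|u - 0| < d -> rnorm (F u - F 0) <= e) ->
  F t @[t --> (0 : R)^'+] --> F 0.
Proof.
move=> h; apply/cvgrPdist_le => e e0; have [-> e'0] := posc_real e0.
have [d d0 hd] := h _ e'0; apply/nbhs_ballP; exists d => //= u.
rewrite /ball /= sub0r normrN => ud u0.
rewrite normE lecR rnorm_distC; apply: hd; last by rewrite subr0.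
by apply/posP; exact: ltW.
Qed.

Lemma rescale_C0 z : C0_semigroup (rescale z T).
Proof.
have [bT T0 TD Tc] := hT; split.
- move=> t t0; have [lT [K hK]] := bT t t0; split.
    by move=> a x y; rewrite /rescale lT; lmod.
  exists (complex.Re `|cexp z t| * K) => x.
  rewrite /rescale rnormZ -mulrA ler_wpM2l ?hK //.
  by rewrite norm_cexp expR_ge0.
- by move=> x; rewrite /rescale cexp0 scale1r T0.
- move=> s t s0 t0 x; rewrite /rescale TD // cexpD.
  have [lT _] := bT s s0; by rewrite (linfZ lT) scalerA.
- move=> x; rewrite -[X in _ --> X]scale1r -(cexp0 z); apply: cvgZ; last exact: Tc.
  by apply: right_cvg; exact: deriv_at_cont (deriv_cexp _ _ _).
Qed.

Lemma rescale_generator z : generator_of (shift_op z) (rescale z T).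
Proof.
have pos0 : pos 0 by apply/posP.
have [_ T0 _ _] := hT.
have hgen x y : (dom A x /\ A x = y) <-> deriv_at pos (T^~ x) 0 y := generatorP hT hA x y.
move=> x y; have -> : (fun h : R => (h^-1)%:C *: (rescale z T h x - x)) =
   (fun h : R => (h^-1)%:C *: (rescale z T h x - rescale z T 0 x)).
  by apply/funext => h; rewrite /rescale cexp0 scale1r T0.
rewrite (right_derivP (fun h => rescale z T h x)); split=> [[dx <-]|h].
  apply: deriv_at_eq (deriv_at_scal pos0 (deriv_cexp _ _ _) ((hgen _ _).1 (conj dx erefl))) _.
  by rewrite cexp0 T0 /= scale1r mulr1 addrC.
have : deriv_at pos (T^~ x) 0 (y - z *: x).
  have := deriv_at_scal pos0 (deriv_cexp pos (- z) 0) h.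
  rewrite !cexp0 /rescale cexp0 T0 mulr1 !scale1r scaleNr addrC.
  apply: deriv_at_ext => // u _.
  by rewrite scalerA cexpN scale1r.
by move=> /hgen[dx Ax]; split => //=; rewrite Ax subrK.
Qed.

Lemma rescale_bounded z M w : exp_bounded T M w ->
  exp_bounded (rescale z T) M (w + complex.Re z).
Proof.
move=> h t x t0; rewrite /rescale rnormZ norm_cexp.
rewrite (le_trans (ler_wpM2l (expR_ge0 _) (h t x t0))) // mulrDl expRD.
by apply: eq_lerR; ring.
Qed.

End Rescale.

(** * Invertibility of the generator of an exponentially decaying semigroup *)

Section Stable.
Context {R : realType}.
Local Notation C := R[i].
Context {V : normedModType C} (cV : complete_rn V).
Context {T : R -> V -> V} {A : unbounded_op V V}.
Hypothesis hT : C0_semigroup T.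
Hypothesis hA : generator_of A T.
Context {M c : R}.
Hypothesis M0 : 0 <= M.
Hypothesis c0 : 0 < c.
Hypothesis hM : exp_bounded T M (- c).
Local Notation pos := (`[0, +oo[%classic : set R).

Lemma expR_small (K a e : R) : 0 < a -> 0 < e -> exists2 t, 0 <= t & forall s, t <= s -> K * expR (- a * s) <= e.
Proof.
move=> a0 e0; exists (`|K| / (e * a)); first by rewrite divr_ge0 // mulr_ge0 // ltW.
move=> s ts; have s0 : 0 <= s by apply: le_trans ts; rewrite divr_ge0 // mulr_ge0 // ltW.
rewrite (le_trans (ler_wpM2r (expR_ge0 _) (ler_norm K))) //.
rewrite mulNr expRN ler_pdivrMr ?expR_gt0 //.
rewrite (@le_trans _ _ (e * (1 + a * s))) //; last by rewrite ler_wpM2l ?(ltW e0) // expR_ge1Dx.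
by move: ts; rewrite ler_pdivrMr ?mulr_gt0 //; nra.
Qed.

Lemma is_derive_expM (k a t : R) : is_derive t 1 (fun s => k * expR (a * s)) (k * (a * expR (a * t))).
Proof.
have da : is_derive t 1 (fun t => a * t) a.
  by apply: is_derive_eq; rewrite /GRing.scale /= mulr1.
have de : is_derive t 1 (fun t => expR (a * t)) (expR (a * t) * a) by exact: is_derive1_comp.
by apply: is_derive_eq; rewrite /GRing.scale /=; ring.
Qed.

Lemma exp_integral_bound (F f : R -> V) (N a b : R) : 0 <= a -> a <= b ->
  deriv_on `[a, b] F f -> (forall t, a <= t <= b -> rnorm (f t) <= M * expR (- c * t) * N) ->
  rnorm (F b - F a) <= M / c * N * expR (- c * a) - M / c * N * expR (- c * b).
Proof.
move=> a0 ab dF hf.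
have := @mean_value _ _ a b F f (fun s => - (M / c * N) * expR (- c * s)) (fun t => - (M / c * N) * (- c * expR (- c * t))) ab dF.
move=> /(_ (fun t _ => is_derive_expM _ _ _)) h; apply: le_trans (h _) _; last first.
  by apply: eq_lerR; ring.
move=> t /hf h1; apply: le_trans h1 _; apply: eq_lerR; field; exact: lt0r_neq0.
Qed.

(** [x] is minus the integral of [T s (A x)] over the half-line: the orbit is differentiated on
    [[0, t]] and its end point decays. *)
Lemma stable_lower x : dom A x -> rnorm x <= M / c * rnorm (A x).
Proof.
move=> dx; apply: (@le_epsM _ _ _ (rnorm x)) => e e0.
have [t t0 ht] := expR_small M c0 e0; have {}ht := ht t (lexx _).
have h : rnorm (T t x - T 0 x) <= M / c * rnorm (A x).
  have h := @exp_integral_bound (T^~ x) (fun s => T s (A x)) (rnorm (A x)) 0 t (lexx _) t0.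
  apply: le_trans (h _ _) _.
  - by apply: deriv_onS (orbit_deriv hT hA hM dx) => r /=; rewrite !in_itv /= andbT => /andP[].
  - by move=> s /andP[s0 _]; exact: hM.
  rewrite mulr0 expR0 mulr1 gerBl mulr_ge0 ?expR_ge0 //.
  by rewrite mulr_ge0 ?rnorm_ge0 // divr_ge0 // ltW.
rewrite (C0_0 hT) in h.
rewrite (le_trans (rnorm_dist_ge _ (T t x))) // rnorm_distC addrC lerD //.
by rewrite (le_trans (hM _ t0)) // mulrC ler_wpM2l ?rnorm_ge0.
Qed.

(** The preimage is minus the integral of [T s y] over the half-line. The integrals [u n] over
    [[0, n]] are Cauchy, [A (u n) = T n y - y] tends to [- y], and [A] is closed. *)
Lemma stable_surj y : exists2 x, dom A x & A x = y.
Proof.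
have [F dF] := antiderivative cV (orbit_cont hT hM y).
pose u (n : nat) := F n%:R - F 0.
have n0 (n : nat) : 0 <= n%:R :> R by [].
have uA n : dom A (u n) /\ A (u n) = T n%:R y - y := orbit_integral hT hA dF (n0 n).
have small e : 0 < e -> exists N : nat, forall n, (N <= n)%N -> M / c * rnorm y * expR (- c * n%:R) <= e /\ M * rnorm y * expR (- c * n%:R) <= e.
  move=> e0; have [t t0 ht] := expR_small (M / c * rnorm y) c0 e0.
  have [s s0 hs] := expR_small (M * rnorm y) c0 e0.
  have [N1 H1] := archi_lt t; have [N2 H2] := archi_lt s.
  exists (maxn N1 N2).+1 => -[//|n]; rewrite ltnS geq_max => /andP[n1 n2].
  by split; [apply: ht; rewrite ltW // H1|apply: hs; rewrite ltW // H2].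
have dist (m n : nat) : (m <= n)%N -> rnorm (u n - u m) <= M / c * rnorm y * expR (- c * m%:R).
  move=> mn; have -> : u n - u m = F n%:R - F m%:R by rewrite /u; lmod.
  apply: le_trans (@exp_integral_bound F (T^~ y) (rnorm y) _ _ (n0 m) _ _ _) _.
  - by rewrite ler_nat.
  - by apply: deriv_onS dF => r /=; rewrite !in_itv /= andbT => /andP[mr _]; exact: le_trans mr.
  - by move=> t /andP[mt _]; apply: hM; exact: le_trans mt.
  rewrite gerBl mulr_ge0 ?expR_ge0 //.
  by rewrite mulr_ge0 ?rnorm_ge0 // divr_ge0 // ltW.
have [|l hl] := @cV u.
  move=> e e0; have [N hN] := small _ e0; exists N => m n Nm Nn.
  have [mn|/ltnW nm] := leqP m n.
    by rewrite rnorm_distC (le_trans (dist _ _ mn)) // (hN m Nm).1.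
  by rewrite (le_trans (dist _ _ nm)) // (hN n Nn).1.
have [|dl Al] := generator_closed hT hA hM (u := u) (x := l) (y := - y) (fun n => (uA n).1) hl.
  move=> e e0; have [N hN] := small _ e0; exists N => n Nn.
  rewrite (uA n).2 opprK subrK (le_trans (hM _ (n0 n))) //.
  by rewrite mulrAC (hN n Nn).2.
have [dl' Al'] := dom_generatorZ hT hA (-1) dl.
by exists (-1 *: l) => //; rewrite Al' Al scaleN1r opprK.
Qed.

End Stable.

(** * The resolvent to the right of the growth rate *)

Section Resolvent.
Context {R : realType}.
Local Notation C := R[i].
Context {V : normedModType C} (cV : complete_rn V).
Context {T : R -> V -> V} {A : unbounded_op V V}.
Hypothesis hT : C0_semigroup T.
Hypothesis hA : generator_of A T.
Context {M w : R}.
Hypothesis M0 : 0 <= M.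
Hypothesis hM : exp_bounded T M w.

(** The rescaled semigroup [exp(- l t) T(t)] decays at rate [Re l - w] and is generated by [A - l],
    so the stable case applies. *)
Lemma resolvent_lower (l : C) x : w < complex.Re l -> dom A x ->
  rnorm x <= M / (complex.Re l - w) * rnorm (l *: x - A x).
Proof.
move=> wl dx; have c0 : 0 < complex.Re l - w by rewrite subr_gt0.
have hM' : exp_bounded (rescale (- l) T) M (- (complex.Re l - w)).
  by rewrite opprB -raddfN; exact: rescale_bounded.
have := stable_lower (rescale_C0 hT (- l)) (rescale_generator hT hA (- l)) M0 c0 hM' (x := x) dx.
by rewrite /= rnorm_distC scaleNr.
Qed.

Lemma resolvent_surj (l : C) y : w < complex.Re l -> exists x, dom A x /\ l *: x - A x = y.
Proof.
move=> wl; have c0 : 0 < complex.Re l - w by rewrite subr_gt0.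
have hM' : exp_bounded (rescale (- l) T) M (- (complex.Re l - w)).
  by rewrite opprB -raddfN; exact: rescale_bounded.
have [x /= dx Ax] := stable_surj cV (rescale_C0 hT (- l)) (rescale_generator hT hA (- l)) M0 c0 hM' (- y).
by exists x; split => //; rewrite -[y]opprK -Ax scaleNr opprB.
Qed.

Section FixedPoint.
Context (l : C).
Hypothesis wl : w < complex.Re l.
Local Notation Q := (resolvent A l).

Lemma resolventP y : dom A (Q y) /\ l *: Q y - A (Q y) = y.
Proof. exact: (getPex (resolvent_surj y wl)). Qed.

Lemma resolvent_unique x y : dom A x -> l *: x - A x = y -> Q y = x.
Proof.
move=> dx <-; have [dQ eQ] := resolventP (l *: x - A x).
have [dB eB] := dom_generatorB hT hA dQ dx.
apply/eqP; rewrite -subr_eq0; apply/eqP/rnorm_le0.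
rewrite (le_trans (resolvent_lower wl dB)) // eB.
set v := Q _ in eQ *.
have -> : l *: (v - x) - (A v - A x) = (l *: v - A v) - (l *: x - A x) by lmod.
by rewrite eQ subrr rnorm0 mulr0.
Qed.

Lemma resolvent_linear : linear Q.
Proof.
move=> a x y; have [dx ex] := resolventP x; have [dy ey] := resolventP y.
have [d e] := generator_lin hT hA a dx dy; apply: resolvent_unique => //.
by rewrite e -[in RHS]ex -[in RHS]ey; lmod.
Qed.

Lemma resolvent_bound y : rnorm (Q y) <= M / (complex.Re l - w) * rnorm y.
Proof. by have [dQ {2}<-] := resolventP y; exact: resolvent_lower. Qed.

Lemma resolvent_comm x : dom A x -> A (Q x) = Q (A x).
Proof.
move=> dx; have := resolvent_unique dx erefl.
rewrite (linfB resolvent_linear) (linfZ resolvent_linear) => h.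
have [_ e] := resolventP x.
by apply: oppr_inj; apply: (@addrI _ (l *: Q x)); rewrite e h.
Qed.

End FixedPoint.

(** The threshold on [l] makes [l / (l - w)] at most 2. *)
Lemma resolvent_real_bound (l : R) y : 2 * `|w| + 1 <= l ->
  rnorm (l%:C *: resolvent A l%:C y) <= 2 * M * rnorm y.
Proof.
move=> wl; have wn := ler_norm w; have w0 := normr_ge0 w.
have l0 : 0 < l by lra.
have wl' : w < complex.Re l%:C by rewrite /=; lra.
rewrite rnormZr gtr0_norm // (le_trans (ler_wpM2l (ltW l0) (resolvent_bound wl' y))) //=.
rewrite mulrA ler_wpM2r ?rnorm_ge0 // mulrA ler_pdivrMr; last lra.
have h : 0 <= l - 2 * w by lra.
by have := mulr_ge0 M0 h; nra.
Qed.

(** On the domain, [l R(l) z - z = R(l) A z] is of order [1 / l]; density and the uniform bound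
    [2 M] extend the convergence to every [x]. *)
Lemma resolvent_approx x (e : R) : 0 < e -> exists L, forall l : R, L <= l ->
  rnorm (l%:C *: resolvent A l%:C x - x) <= e.
Proof.
move=> e0; have K0 : 0 < 2 * (2 * M + 1) by rewrite mulr_gt0 // ltr_wpDl // mulr_ge0.
have [z dz zx] := generator_dense cV hT hA hM x (divr_gt0 e0 K0).
exists (Num.max (2 * `|w| + 1) (4 * M * rnorm (A z) / e)) => l.
rewrite ge_max => /andP[wl le]; have wn := ler_norm w; have w0 := normr_ge0 w.
have l0 : 0 < l by lra.
have wl' : w < complex.Re l%:C by rewrite /=; lra.
have lin := resolvent_linear wl'; set Q := resolvent A l%:C in lin *.
have -> : l%:C *: Q x - x = l%:C *: Q (x - z) + (l%:C *: Q z - z) + (z - x).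
  by rewrite (linfB lin); lmod.
have e1 : l%:C *: Q z - z = Q (A z).
  have [_ {2}<-] := resolventP wl' z; rewrite -/Q.
  by rewrite /Q -(resolvent_comm wl' dz); lmod.
have b1 : rnorm (l%:C *: Q (x - z)) <= 2 * M * (e / (2 * (2 * M + 1))).
  rewrite (le_trans (resolvent_real_bound _ wl)) // ler_wpM2l ?mulr_ge0 //.
  by rewrite rnorm_distC.
have b2 : rnorm (Q (A z)) <= e / 2.
  rewrite (le_trans (resolvent_bound wl' _)) //=.
  move: le; rewrite ler_pdivrMr // => le.
  rewrite mulrAC ler_pdivrMr ?subr_gt0 //; have := rnorm_ge0 (A z); nra.
rewrite (le_trans (rnormD _ _)) // (le_trans (lerD (rnormD _ _) zx)) // e1.
rewrite (le_trans (lerD (lerD b1 b2) (lexx _))) //.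
by apply: eq_lerR; field; apply: lt0r_neq0; lra.
Qed.

End Resolvent.

(** * Comparison of real derivatives and primitives *)

Section RealCalculus.
Context {R : realType}.
Local Notation mu := (@lebesgue_measure R).
Implicit Types (g F G : R -> R).

Lemma is_derive_cont F (t f : R) : is_derive t 1 F f -> {for t, continuous F}.
Proof. by move=> [dF _]; apply: differentiable_continuous; exact/derivable1_diffP. Qed.

Lemma deriv_le F G (f g : R -> R) (a b : R) : a <= b ->
  (forall t, a <= t <= b -> is_derive t 1 F (f t)) ->
  (forall t, a <= t <= b -> is_derive t 1 G (g t)) ->
  (forall t, a <= t <= b -> f t <= g t) -> F b - F a <= G b - G a.
Proof.
rewrite le_eqVlt => /predU1P[<- _ _ _|ab dF dG fg]; first by rewrite !subrr.
have sub x : x \in `]a, b[ -> a <= x <= b by rewrite in_itv /= => /andP[/ltW -> /ltW ->].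
have [||c cab] := @MVT _ (fun t => G t - F t) (fun t => g t - f t) _ _ ab.
- by move=> x /sub xab; have := dF x xab; have := dG x xab => h1 h2; exact: is_deriveB.
- apply: derivable_within_continuous => x; rewrite in_itv /= => xab.
  by have [] := is_deriveB (dG x xab) (dF x xab).
move=> h; have : 0 <= (g c - f c) * (b - a).
  by rewrite mulr_ge0 ?subr_ge0 ?(ltW ab) // fg // sub.
by rewrite -h; lra.
Qed.

Lemma deriv_eq F G (f : R -> R) (a b : R) : a <= b ->
  (forall t, a <= t <= b -> is_derive t 1 F (f t)) ->
  (forall t, a <= t <= b -> is_derive t 1 G (f t)) -> F b - F a = G b - G a.
Proof.
by move=> ab dF dG; apply/le_anti/andP; split; apply: deriv_le ab _ _ _; eauto.
Qed.

Lemma is_derive_shift F (f t h : R) : is_derive (t + h) 1 F f ->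
  is_derive t 1 (fun s => F (s + h)) f.
Proof.
move=> dF; have dh : is_derive t 1 (fun s => s + h) 1.
  by apply: is_derive_eq; rewrite addr0.
by have := is_derive1_comp (f := F) (g := fun s => s + h) dF dh; rewrite mulr1.
Qed.

Lemma is_derive_neg F (f : R) : is_derive (0 : R) 1 F f -> f < 0 -> F 0 = 0 ->
  exists2 d : R, 0 < d & forall h, 0 < h -> h < d -> F h <= 0.
Proof.
move=> dF f0 F0; have nf : 0 < - f by rewrite oppr_gt0.
have [d d0 hd] := is_derive_eps dF nf; exists d => // h h0 hd'.
have := hd h; rewrite subr0 gtr0_norm // F0 subr0 => /(_ hd').
by rewrite ler_norml => /andP[_]; lra.
Qed.

(* The base point -1 makes [prim g] differentiable on the whole of [0, oo). *)
Definition prim g (x : R) : R := \int[mu]_(t in `[-1, x]) g t.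

Lemma cont_integrable g (a b : R) : continuous g -> mu.-integrable `[a, b] (EFin \o g).
Proof.
move=> cg; apply: continuous_compact_integrable; first exact: segment_compact.
exact: continuous_subspaceT.
Qed.

Lemma prim_deriv g (x : R) : continuous g -> 0 <= x -> is_derive x 1 (prim g) (g x).
Proof.
move=> cg x0; have xx : x < x + 1 by rewrite ltrDl.
have x1 : -1 < x by rewrite (lt_le_trans _ x0) // oppr_lt0.
have [d e] := continuous_FTC1_closed xx (cont_integrable (-1) (x + 1) cg) x1 (cg x).
split; first exact: d.
by rewrite -derive1E; exact: e.
Qed.

Lemma integral_prim g (a b : R) : continuous g -> 0 <= a -> a <= b ->
  (\int[mu]_(t in `[a, b]) (g t)%:E = (prim g b - prim g a)%:E)%E.
Proof.
move=> cg a0; rewrite le_eqVlt => /predU1P[<-|ab].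
  by rewrite set_itv1 integral_set1 subrr.
have dp x : a <= x -> is_derive x 1 (prim g) (g x).
  by move=> ax; apply: prim_deriv => //; exact: le_trans ax.
rewrite (@continuous_FTC2 _ g (prim g)) //.
- exact: continuous_subspaceT.
- split => [x||].
  + by rewrite in_itv /= => /andP[/ltW ax _]; have [] := dp x ax.
  + by apply: cvg_at_right_filter; exact: is_derive_cont (dp a (lexx _)).
  + by apply: cvg_at_left_filter; exact: is_derive_cont (dp b (ltW ab)).
- move=> x; rewrite in_itv /= => /andP[/ltW ax _].
  by have [d e] := dp x ax; rewrite derive1E e.
Qed.

Lemma prim_le g h (a b : R) : continuous g -> continuous h -> 0 <= a -> a <= b ->
  (forall t, a <= t <= b -> g t <= h t) -> prim g b - prim g a <= prim h b - prim h a.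
Proof.
move=> cg ch a0 ab; apply: deriv_le => // t /andP[at_ _]; apply: prim_deriv => //.
  exact: le_trans at_.
exact: le_trans at_.
Qed.

Lemma prim_homo g (a b : R) : continuous g -> 0 <= a -> a <= b ->
  (forall t, a <= t <= b -> 0 <= g t) -> prim g a <= prim g b.
Proof.
move=> cg a0 ab g0; rewrite -subr_ge0.
have := @deriv_le (cst 0) (prim g) (cst 0) g a b ab; rewrite /cst subrr; apply => //.
  by move=> t /andP[at_ _]; apply: prim_deriv => //; exact: le_trans at_.
Qed.

Lemma cont_max0 : continuous (fun s : R => Num.max 0 s).
Proof.
move=> x; apply/cvgrPdist_le => e e0; apply/nbhs_ballP; exists e => //= y.
rewrite /ball /= => xy; apply: le_trans (ltW xy); rewrite !ler_norml.
have := ler_norm (x - y); rewrite -[in X in X -> _]opprB.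
have := ler_norm (y - x); rewrite [`|y - x|]distrC opprB => h1 h2.
by rewrite /Num.max; do 2!case: ifPn; rewrite -?leNgt => *; lra.
Qed.

Lemma max0l (s : R) : 0 <= s -> Num.max 0 s = s.
Proof. by move=> s0; rewrite max_r. Qed.

Lemma cont_rnorm_max0 {V : normedModType R[i]} (F : R -> V) : cont_on `[0, +oo[ F ->
  continuous (fun s : R => rnorm (F (Num.max 0 s))).
Proof.
move=> cF x; apply/cvgrPdist_le => e e0.
have m0 : 0 <= Num.max 0 x by rewrite le_max lexx.
have [d d0 hd] := cF _ ((posP _).2 m0) e e0.
have /cvgrPdist_lt/(_ d d0)/nbhs_ballP[d' d'0 hd'] := @cont_max0 x.
apply/nbhs_ballP; exists d' => //= y xy.
have := hd (Num.max 0 y); rewrite distrC => /(_ _ (hd' y xy)).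
have p0 : (`[0, +oo[%classic : set R) (Num.max 0 y) by apply/posP; rewrite le_max lexx.
move=> /(_ p0) h; apply: le_trans h; rewrite ler_norml.
have := rnorm_dist_ge (F (Num.max 0 y)) (F (Num.max 0 x)).
have := rnorm_dist_ge (F (Num.max 0 x)) (F (Num.max 0 y)).
by rewrite [rnorm (F (Num.max 0 x) - _)]rnorm_distC; lra.
Qed.

Lemma contM g h : continuous g -> continuous h -> continuous (fun t => g t * h t).
Proof. by move=> cg ch x; apply: cvgM; [exact: cg|exact: ch]. Qed.

Lemma contD g h : continuous g -> continuous h -> continuous (fun t => g t + h t).
Proof. by move=> cg ch x; apply: cvgD; [exact: cg|exact: ch]. Qed.

Lemma cont_sqr g : continuous g -> continuous (fun t => g t ^+ 2).
Proof. by move=> cg; under eq_fun do rewrite expr2; exact: contM. Qed.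

Lemma cont_cst (c : R) : continuous (fun _ : R => c).
Proof. by move=> x; exact: cvg_cst. Qed.

Lemma cont_expM (a : R) : continuous (fun t : R => expR (a * t)).
Proof.
move=> x; have h := is_derive_cont (is_derive_expM 1 a x).
by under eq_fun do rewrite -[expR _]mul1r; exact: h.
Qed.

End RealCalculus.

(** * Operations on continuous paths *)

Section Continuity.
Context {R : realType}.
Local Notation C := R[i].
Implicit Types V W : normedModType C.

Lemma cont_onL {V W} (D : set R) (L : V -> W) F : bounded_linear L -> cont_on D F ->
  cont_on D (L \o F).
Proof.
move=> bL cF p Dp e e0; have [M M0 hM] := bounded_linear_ge0 bL.
have M1 : 0 < M + 1 by rewrite ltr_wpDl.
have [d d0 hd] := cF p Dp _ (divr_gt0 e0 M1); exists d => // u Du ud.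
rewrite /= -(linfB bL.1) (le_trans (hM _)) // (le_trans (ler_wpM2l M0 (hd u Du ud))) //.
by rewrite mulrA ler_pdivrMr // [e * _]mulrC ler_wpM2r ?(ltW e0) // lerDl.
Qed.

Lemma cont_onD {V} (D : set R) (F G : R -> V) : cont_on D F -> cont_on D G ->
  cont_on D (fun t => F t + G t).
Proof.
move=> cF cG p Dp e e0; have e2 : 0 < e / 2 by rewrite divr_gt0.
have [d d0 hd] := cF p Dp _ e2; have [d' d'0 hd'] := cG p Dp _ e2.
exists (Num.min d d'); first by rewrite lt_min d0.
move=> u Du; rewrite lt_min => /andP[/(hd _ Du) h1 /(hd' _ Du) h2].
rewrite opprD addrACA (le_trans (rnormD _ _)) //; lra.
Qed.

Lemma cont_onZ {V} (D : set R) (g : R -> C^o) (F : R -> V) : cont_on D g -> cont_on D F ->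
  cont_on D (fun t => g t *: F t).
Proof.
move=> cg cF p Dp e e0; have rZ (a : C^o) (x : V) : rnorm (a *: x) = rnorm a * rnorm x := rnormZ a x.
have half (r : R) : 0 <= r -> (r + 1) * (e / (2 * (r + 1))) <= e / 2.
  by move=> r0; apply: eq_lerR; field; rewrite lt0r_neq0 // ltr_wpDl.
have q0 : 0 < 2 * (rnorm (F p) + 1) by rewrite mulr_gt0 // ltr_wpDl ?rnorm_ge0.
pose e1 := Num.min 1 (e / (2 * (rnorm (F p) + 1))).
have e10 : 0 < e1 by rewrite lt_min ltr01 divr_gt0.
have [d d0 hd] := cg p Dp _ e10.
have r0 : 0 < 2 * (rnorm (g p) + 1) by rewrite mulr_gt0 // ltr_wpDl ?rnorm_ge0.
have [d' d'0 hd'] := cF p Dp _ (divr_gt0 e0 r0).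
exists (Num.min d d'); first by rewrite lt_min d0.
move=> u Du; rewrite lt_min => /andP[/(hd _ Du) h1 /(hd' _ Du) h2].
have -> : g u *: F u - g p *: F p = g u *: (F u - F p) + (g u - g p) *: F p by lmod.
rewrite (le_trans (rnormD _ _)) // !rZ.
have a1 : rnorm (g u) <= rnorm (g p) + 1.
  have h := rnorm_dist_ge (g u) (g p); apply: le_trans h _.
  by rewrite lerD2l (le_trans h1) // ge_min lexx.
have a2 : rnorm (g u) * rnorm (F u - F p) <= e / 2.
  apply: le_trans (ler_pM (rnorm_ge0 _) (rnorm_ge0 _) a1 h2) _.
  exact: half (rnorm_ge0 _).
have a3 : rnorm (g u - g p) * rnorm (F p) <= e / 2.
  have h3 : rnorm (g u - g p) <= e / (2 * (rnorm (F p) + 1)) by rewrite (le_trans h1) // ge_min lexx orbT.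
  have h4 : rnorm (F p) <= rnorm (F p) + 1 by rewrite lerDl.
  apply: le_trans (ler_pM (rnorm_ge0 _) (rnorm_ge0 _) h3 h4) _.
  by rewrite mulrC; exact: half (rnorm_ge0 _).
lra.
Qed.

Lemma cont_on_real (D : set R) (g : R -> R) : continuous g -> cont_on D (fun t => (g t)%:C : C^o).
Proof.
move=> cg p _ e e0; have /cvgrPdist_le/(_ _ e0)/nbhs_ballP[d /= d0 hd] := cg p.
exists d => // u _ up; rewrite -[X in rnorm X]/((g u)%:C - (g p)%:C) -rcN -rcD /rnorm normcRe.
by rewrite distrC; apply: hd; rewrite /ball /= distrC.
Qed.

Lemma cont_on_sum {V} (D : set R) (I : Type) (r : seq I) (F : I -> R -> V) :
  (forall i, cont_on D (F i)) -> cont_on D (fun t => \sum_(i <- r) F i t).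
Proof.
move=> cF; elim: r => [|i r IH].
  by move=> p _ e e0; exists 1 => // u _ _; rewrite !big_nil subrr rnorm0 ltW.
under eq_fun do rewrite big_cons; exact: cont_onD.
Qed.

Lemma cont_on_ext {V} (D : set R) (f g : R -> V) : (forall t, D t -> f t = g t) ->
  cont_on D g -> cont_on D f.
Proof.
move=> fg cg p Dp e e0; have [d d0 hd] := cg p Dp e e0; exists d => // u Du ud.
by rewrite !fg //; exact: hd.
Qed.

End Continuity.

(** * Admissible observation *)

Section Observation.
Context {R : realType}.
Local Notation C := R[i].
Context {X Y : normedModType C}.
Context {T : R -> X -> X} {A : unbounded_op X X}.
Hypothesis hT : C0_semigroup T.
Hypothesis hA : generator_of A T.
Context {M w : R}.
Hypothesis hM : exp_bounded T M w.
Context {Cop : X -> Y} {Kc : R}.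
Hypothesis Clin : forall (a : C) x y, dom A x -> dom A y ->
  Cop (a *: x + y) = a *: Cop x + Cop y.
Hypothesis Kc0 : 0 <= Kc.
Hypothesis Cb : forall x, dom A x -> rnorm (Cop x) <= Kc * (rnorm x + rnorm (A x)).
Local Notation pos := (`[0, +oo[%classic : set R).

Lemma obsD x y : dom A x -> dom A y -> Cop (x + y) = Cop x + Cop y.
Proof. by move=> dx dy; have := Clin 1 dx dy; rewrite !scale1r. Qed.

Lemma obs0 : Cop 0 = 0.
Proof.
have [d0 _] := dom_generator0 hT hA.
by apply: (@addrI _ (Cop 0)); rewrite -obsD // !addr0.
Qed.

Lemma obsZ a x : dom A x -> Cop (a *: x) = a *: Cop x.
Proof. by move=> dx; have := Clin a dx (dom_generator0 hT hA).1; rewrite obs0 !addr0. Qed.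

Lemma obsB x y : dom A x -> dom A y -> Cop (x - y) = Cop x - Cop y.
Proof.
move=> dx dy; have [dy' _] := dom_generatorZ hT hA (-1) dy.
have -> : x - y = x + -1 *: y by rewrite scaleN1r.
by rewrite obsD // obsZ // scaleN1r.
Qed.

Lemma graph_cont (D : set R) (F : R -> X) : (forall p, D p -> dom A (F p)) ->
  cont_on D F -> cont_on D (fun t => A (F t)) -> cont_on D (fun t => Cop (F t)).
Proof.
move=> dF cF cAF p Dp e e0; have K0 : 0 < 2 * Kc + 1 by rewrite ltr_wpDl // mulr_ge0.
have e1 : 0 < e / (2 * Kc + 1) by rewrite divr_gt0.
have [d1 d10 h1] := cF p Dp _ e1; have [d2 d20 h2] := cAF p Dp _ e1.
exists (Num.min d1 d2); first by rewrite lt_min d10.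
move=> u Du; rewrite lt_min => /andP[u1 u2].
have {}h1 := h1 u Du u1; have {}h2 := h2 u Du u2.
have [dB eB] := dom_generatorB hT hA (dF u Du) (dF p Dp).
rewrite -obsB ?(le_trans (Cb dB)) // ?eB; try exact: dF.
rewrite (le_trans (ler_wpM2l Kc0 (lerD h1 h2))) //.
by rewrite -mulrDl mulrA ler_pdivrMr //; nra.
Qed.

Lemma obs_cont x : dom A x -> cont_on pos (fun t => Cop (T t x)).
Proof.
move=> dx; apply: graph_cont.
- by move=> p /posP p0; exact: (generator_orbit hT hA dx p0).1.
- exact: (orbit_cont hT hM).
- move=> p Dp e e0; have [d d0 hd] := orbit_cont hT hM (A x) Dp e0.
  exists d => // u Du ud; move: Dp Du => /posP p0 /[dup] Du /posP u0.
  by rewrite !(generator_orbit hT hA dx _).2 // hd.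
Qed.

(* [Num.max 0 s]: the orbit is only continuous on [0, oo), [prim] needs a
   continuous function on the whole line. *)
Definition obs2 x (s : R) : R := rnorm (Cop (T (Num.max 0 s) x)) ^+ 2.

Lemma obs2_cont x : dom A x -> continuous (obs2 x).
Proof. by move=> dx; apply: cont_sqr; exact: cont_rnorm_max0 (obs_cont dx). Qed.

Lemma obs2_ge0 x s : 0 <= obs2 x s. Proof. exact: sqr_ge0. Qed.

Context {tau K2 : R}.
Hypothesis tau0 : 0 < tau.
Hypothesis K20 : 0 <= K2.
Hypothesis adm : forall x, dom A x -> prim (obs2 x) tau - prim (obs2 x) 0 <= K2 * rnorm x ^+ 2.

(* The weight vanishes at [tau], so the derivative along an orbit is
   [- obs2 x 0] plus a term which admissibility bounds by [|x|^2]. *)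
Let gi x (s : R) : R := (1 - s / tau) * obs2 x s.
Definition gram x : R := prim (gi x) tau - prim (gi x) 0.

Lemma cont_aff : continuous (fun s : R => 1 - s / tau).
Proof.
move=> s; apply: cvgB; first exact: cvg_cst.
by apply: cvgM; [exact: cvg_id|exact: cvg_cst].
Qed.

Let gi_cont x : dom A x -> continuous (gi x).
Proof. by move=> dx; apply: contM (cont_aff) (obs2_cont dx). Qed.

Let wt01 s : 0 <= s <= tau -> 0 <= 1 - s / tau <= 1.
Proof.
move=> /andP[s0 st]; rewrite subr_ge0 ler_pdivrMr // mul1r st gerBl.
by rewrite divr_ge0 // ltW.
Qed.

Lemma gram_le x : dom A x -> gram x <= K2 * rnorm x ^+ 2.
Proof.
move=> dx; apply: le_trans (adm dx).
apply: prim_le (gi_cont dx) (obs2_cont dx) (lexx _) (ltW tau0) _ => s /wt01 /andP[h0 h1].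
by rewrite /gi ler_piMl // obs2_ge0.
Qed.

Lemma sqr_young (a b c eta : R) : 0 < eta -> 0 <= a -> 0 <= b -> 0 <= c -> c <= a + b ->
  c ^+ 2 <= (1 + eta) * a ^+ 2 + (1 + eta^-1) * b ^+ 2.
Proof.
move=> e0 a0 b0 c0 cab.
have h1 : c ^+ 2 <= (a + b) ^+ 2 by rewrite ler_sqr ?nnegrE // addr_ge0.
apply: le_trans h1 _; rewrite -subr_ge0.
have -> : (1 + eta) * a ^+ 2 + (1 + eta^-1) * b ^+ 2 - (a + b) ^+ 2 = eta^-1 * (eta * a - b) ^+ 2.
  by field; exact: lt0r_neq0.
by rewrite mulr_ge0 ?sqr_ge0 // invr_ge0 ltW.
Qed.

(** The weight [eta] is kept free: along a step of length [h] it is taken proportional to [h], so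
    the factor of [gram x] exceeds 1 only by a term of order [h]. *)
Lemma gram_add x y eta : 0 < eta -> dom A x -> dom A y ->
  gram (x + y) <= (1 + eta) * gram x + (1 + eta^-1) * gram y.
Proof.
move=> e0 dx dy; have [dxy _] := dom_generatorD hT hA dx dy.
have dp z : dom A z -> forall t, 0 <= t <= tau -> is_derive t 1 (prim (gi z)) (gi z t).
  by move=> dz t /andP[t0 _]; exact: prim_deriv (gi_cont dz) t0.
have := @deriv_le _ (prim (gi (x + y))) (fun s => (1 + eta) * prim (gi x) s + (1 + eta^-1) * prim (gi y) s)
  (gi (x + y)) (fun s => (1 + eta) * gi x s + (1 + eta^-1) * gi y s) 0 tau (ltW tau0) (dp _ dxy).
move=> h; apply: le_trans (h _ _) _; last by rewrite /gram; apply: eq_lerR; ring.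
- move=> t t0; have h1 := dp x dx t t0; have h2 := dp y dy t t0.
  exact: is_deriveD (is_deriveZ (1 + eta) h1) (is_deriveZ (1 + eta^-1) h2).
move=> t t0; have /andP[w0 _] := wt01 t0; have /andP[t00 _] := t0.
rewrite /gi /obs2 max0l //.
have [[d1 _] [d2 _]] := (generator_orbit hT hA dx t00, generator_orbit hT hA dy t00).
rewrite (linfD (C0_lin hT t00)) obsD //.
have := sqr_young e0 (rnorm_ge0 (Cop (T t x))) (rnorm_ge0 (Cop (T t y))) (rnorm_ge0 _) (rnormD _ _).
by nra.
Qed.

(** Continuity of [gram] in the norm of [X] alone, although it is built from the observation. It
    comes from [gram_add] with [eta = |x - y|] and serves the left-limit step of the real
    induction. *)
Lemma gram_lip x y : dom A x -> dom A y ->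
  gram x <= gram y + rnorm (x - y) * (K2 * (rnorm y ^+ 2 + 1 + rnorm (x - y))).
Proof.
move=> dx dy; have [dB _] := dom_generatorB hT hA dx dy.
have [d0|] := ltP 0 (rnorm (x - y)); last first.
  move=> /rnorm_le0/eqP; rewrite subr_eq0 => /eqP ->.
  by rewrite subrr rnorm0 mul0r addr0.
have -> : gram x = gram (y + (x - y)) by rewrite addrC subrK.
rewrite (le_trans (gram_add d0 dy dB)) //.
move: d0 (gram_le dB) (gram_le dy); set d := rnorm (x - y) => d0 h1 h2.
have h3 : (1 + d^-1) * gram (x - y) <= (1 + d^-1) * (K2 * d ^+ 2).
  by rewrite ler_wpM2l // addr_ge0 // invr_ge0 ltW.
have e1 : (1 + d^-1) * (K2 * d ^+ 2) = K2 * d ^+ 2 + K2 * d by field; exact: lt0r_neq0.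
rewrite e1 in h3.
have h4 : d * gram y <= d * (K2 * rnorm y ^+ 2) by rewrite ler_wpM2l // ltW.
by nra.
Qed.

(** [gram (T h x)] after the substitution [s -> s + h], which turns the weight into
    [(1 - s / tau) + h / tau]. Only primitives for the fixed [x] occur, so this is differentiable in
    [h]. *)
Let gP x (h : R) : R := prim (gi x) (h + tau) - prim (gi x) h +
  h / tau * (prim (obs2 x) (h + tau) - prim (obs2 x) h).

Let gram_shift x h : dom A x -> 0 <= h -> gram (T h x) = gP x h.
Proof.
move=> dx h0; have [dTx _] := generator_orbit hT hA dx h0.
have := @deriv_eq _ (prim (gi (T h x)))
  (fun s => prim (gi x) (s + h) + h / tau * prim (obs2 x) (s + h)) (gi (T h x)) 0 tau (ltW tau0).
move=> E; apply: etrans (E _ _) _; last by rewrite /gP ![_ + h]addrC addr0; ring.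
  by move=> t /andP[t0 _]; exact: prim_deriv (gi_cont dTx) t0.
move=> t /andP[t0 _]; have th : 0 <= t + h by rewrite addr_ge0.
have h1 := is_derive_shift (prim_deriv (gi_cont dx) th).
have h2 := is_derive_shift (prim_deriv (obs2_cont dx) th).
apply: (@is_derive_eq _ _ _ _ _ _ _ _ (is_deriveD h1 (is_deriveZ (h / tau) h2))).
rewrite /gi /obs2 !max0l // (C0_D hT) //.
by rewrite /GRing.scale /=; field; exact: lt0r_neq0.
Qed.

Let gP_deriv x : dom A x ->
  is_derive (0 : R) 1 (gP x) (- obs2 x 0 + (prim (obs2 x) tau - prim (obs2 x) 0) / tau).
Proof.
move=> dx; have t0 : 0 <= 0 + tau by rewrite add0r ltW.
have h1 := is_derive_shift (prim_deriv (gi_cont dx) t0).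
have h2 := is_derive_shift (prim_deriv (obs2_cont dx) t0).
have h3 := prim_deriv (gi_cont dx) (lexx 0).
have h4 := prim_deriv (obs2_cont dx) (lexx 0).
have h5 : is_derive (0 : R) 1 (fun h : R => h / tau) tau^-1.
  by under eq_fun do rewrite mulrC; apply: is_derive_eq; rewrite /GRing.scale /= mulr1.
apply: (@is_derive_eq _ _ _ _ _ _ _ _ (is_deriveD (is_deriveB h1 h3) (is_deriveM h5 (is_deriveB h2 h4)))).
rewrite /gi -[(_ - _) 0]/(prim (obs2 x) (0 + tau) - prim (obs2 x) 0) /GRing.scale /= !add0r.
field; exact: lt0r_neq0.
Qed.

Let gP0 x : dom A x -> gP x 0 = gram x.
Proof. by move=> dx; rewrite -gram_shift // (C0_0 hT). Qed.

(** * The Lyapunov estimate along a trajectory of [x' = A x + f] *)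

Section Trajectory.
Context {x f : R -> X} {m : R -> R} {b : R}.
Hypothesis b0 : 0 <= b.
Hypothesis m0 : forall t, 0 <= m t.
Hypothesis mc : continuous m.
Hypothesis xA : forall t, 0 <= t -> dom A (x t).
Hypothesis xd : deriv_on pos x (fun t => A (x t) + f t).
Hypothesis xC : cont_on pos (fun t => Cop (x t)).
Hypothesis fb : forall t, 0 <= t -> rnorm (f t) ^+ 2 <= b * rnorm (Cop (x t)) ^+ 2 + m t.

(** [gram_add] is used with [eta = kap h]. Since [kap >= 2 K2 b], the observed part of
    [kap^-1 K2 |f|^2] is at most half of [|C x|^2], and [kap >= 1] keeps the part from [m] below
    [K2 m]. In [gam], the term [kap K2] comes from [kap * gram], and [K2 / tau] from the derivative
    of [gram] along the free orbit. *)
Let kap : R := 2 * K2 * b + 1.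
Let psi (s : R) : R := rnorm (Cop (x (Num.max 0 s))) ^+ 2.
Let xi (s : R) : R := rnorm (x (Num.max 0 s)) ^+ 2.
Let gam (s : R) : R := (kap * K2 + K2 / tau) * xi s + K2 * m s.

Let kap1 : 1 <= kap. Proof. by rewrite lerDr !mulr_ge0. Qed.
Let psi_cont : continuous psi. Proof. exact: cont_sqr (cont_rnorm_max0 xC). Qed.
Let xi_cont : continuous xi.
Proof. exact: cont_sqr (cont_rnorm_max0 (deriv_on_cont xd)). Qed.
Let gam_cont : continuous gam.
Proof. by apply: contD; apply: contM => //; exact: cont_cst. Qed.

(** Compares [x (s + h)] with the free orbit [T h (x s)], for which [gram] is differentiable in [h].
    Their difference has norm of order [h], so its contribution, multiplied by [1 + (kap h)^-1], is
    still of order [h]. *)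
Let step s eps : 0 <= s -> 0 < eps -> exists2 d : R, 0 < d & forall h, 0 < h -> h < d ->
  gram (x (s + h)) + 2^-1 * (prim psi (s + h) - prim psi s) <=
  gram (x s) + (prim gam (s + h) - prim gam s) + eps * h.
Proof.
move=> s0 eps0; set a := rnorm (f s); have a0 : 0 <= a := rnorm_ge0 _.
have q0 : 0 < 8 * (K2 + 1) * (a + 1) by rewrite !mulr_gt0 // ltr_wpDl.
(* Makes the cross term [K2 * (4 e (a + 1))], produced by squaring [a + 2 e] with [e <= 1], smaller
   than [eps]. *)
pose e := Num.min 1 (eps / (8 * (K2 + 1) * (a + 1))).
have e0 : 0 < e by rewrite lt_min ltr01 divr_gt0.
have e1 : e <= 1 by rewrite ge_min lexx.
have ee : 8 * (K2 + 1) * (a + 1) * e <= eps.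
  by rewrite mulrC -ler_pdivlMr // ge_min lexx orbT.
have dxs := xA s0.
(* Upper bound for the left side of the claim minus its right side. It vanishes at 0 and its
   derivative [Dd] there is negative, so it is nonpositive for small [h]. *)
pose D (h : R) := (1 + kap * h) * gP (x s) h + (h * h + h * kap^-1) * (K2 * (a + 2 * e) ^+ 2)
   + 2^-1 * (prim psi (h + s) - prim psi s) - gram (x s) - (prim gam (h + s) - prim gam s) - eps * h.
have kap0 : 0 < kap by rewrite (lt_le_trans ltr01).
have xs : Num.max 0 s = s by rewrite max0l.
pose Dd := (kap * gram (x s) + (- obs2 (x s) 0 + (prim (obs2 (x s)) tau - prim (obs2 (x s)) 0) / tau))
   + kap^-1 * (K2 * (a + 2 * e) ^+ 2) + 2^-1 * psi s - gam s - eps.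
have dD : is_derive (0 : R) 1 D Dd.
  have s0' : 0 <= 0 + s by rewrite add0r.
  have h1 := is_derive_shift (prim_deriv psi_cont s0').
  have h2 := is_derive_shift (prim_deriv gam_cont s0').
  have h3 := gP_deriv dxs.
  apply: is_derive_eq; rewrite /Dd -(gP0 dxs) /GRing.scale /= !add0r.
  by ring.
have D0 : D 0 = 0 by rewrite /D gP0 // !mulr0 !mul0r !add0r; ring.
have psiE : obs2 (x s) 0 = psi s by rewrite /obs2 /psi max0l // (C0_0 hT) xs.
have Dneg : Dd < 0.
  have g1 := gram_le dxs; have g2 := adm dxs; rewrite -[rnorm (x s)]/(rnorm (x s)) in g1 g2.
  have xiE : xi s = rnorm (x s) ^+ 2 by rewrite /xi xs.
  rewrite -xiE in g1 g2.
  have f1 : a ^+ 2 <= b * psi s + m s by rewrite /psi xs; exact: fb.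
  have k1 : kap^-1 * (K2 * (a + 2 * e) ^+ 2) <= 2^-1 * psi s + K2 * m s + K2 * (4 * e * (a + 1)).
    rewrite ler_pdivrMl //.
    have p0 : 0 <= psi s by exact: sqr_ge0.
    have : (a + 2 * e) ^+ 2 <= (b * psi s + m s) + 4 * e * (a + 1) by nra.
    move=> /(ler_wpM2l K20) h; apply: le_trans h _.
    have n1 : 0 <= K2 * m s by rewrite mulr_ge0.
    have n2 : 0 <= K2 * (4 * e * (a + 1)) by rewrite !mulr_ge0 ?(ltW e0) // addr_ge0.
    have n3 : K2 * m s <= kap * (K2 * m s) by rewrite ler_peMl.
    have n4 : K2 * (4 * e * (a + 1)) <= kap * (K2 * (4 * e * (a + 1))) by rewrite ler_peMl.
    have n5 : K2 * b * psi s <= kap * (2^-1 * psi s) by rewrite /kap; nra.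
    by lra.
  have g3 : kap * gram (x s) <= kap * K2 * xi s by rewrite -mulrA ler_wpM2l // ltW.
  have g4 : (prim (obs2 (x s)) tau - prim (obs2 (x s)) 0) / tau <= K2 / tau * xi s.
    by rewrite ler_pdivrMr // mulrAC divfK // lt0r_neq0.
  have g5 : K2 * (4 * e * (a + 1)) < eps.
    apply: lt_le_trans ee; have : 0 < e * (a + 1) by rewrite mulr_gt0 // ltr_wpDl.
    by nra.
  by rewrite /Dd psiE /gam; nra.
have [d1 d10 h1] := is_derive_neg dD Dneg D0.
have [d2 d20 h2] := xd ((posP _).2 s0) e0.
have [d3 d30 h3] := (generatorP hT hA _ _).1 (conj dxs erefl) e e0.
exists (Num.min d1 (Num.min d2 d3)); first by rewrite !lt_min d10 d20.
move=> h h0; rewrite !lt_min => /andP[hd1 /andP[hd2 hd3]].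
have sh0 : 0 <= s + h by rewrite addr_ge0 // ltW.
have {}h2 := h2 (s + h) ((posP _).2 sh0); rewrite (addrC s) addrK gtr0_norm // in h2.
have {}h2 := h2 hd2; have {}h3 := h3 h ((posP _).2 (ltW h0)).
rewrite subr0 gtr0_norm // (C0_0 hT) in h3; have {}h3 := h3 hd3.
have [dT _] := generator_orbit hT hA dxs (ltW h0).
have dxh := xA sh0; have [dy _] := dom_generatorB hT hA dxh dT.
(* [A (x s)] cancels between the first-order expansions of the trajectory and of the free orbit;
   what is left is [h f(s)] and two remainders of size [e h]. *)
have ny : rnorm (x (s + h) - T h (x s)) <= h * (a + 2 * e).
  rewrite [s + h]addrC.
  have -> : x (h + s) - T h (x s) = (x (h + s) - x s - h%:C *: (A (x s) + f s))
     - (T h (x s) - x s - h%:C *: A (x s)) + h%:C *: f s by lmod.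
  rewrite (le_trans (rnormD _ _)) // rnormZr gtr0_norm // -/a.
  have := rnormB (x (h + s) - x s - h%:C *: (A (x s) + f s)) (T h (x s) - x s - h%:C *: A (x s)).
  by nra.
have kh : 0 < kap * h by rewrite mulr_gt0.
have := gram_add kh dT dy; rewrite addrC subrK => g1.
have g2 := gram_le dy.
have g3 : (1 + (kap * h)^-1) * gram (x (s + h) - T h (x s)) <= (h * h + h * kap^-1) * (K2 * (a + 2 * e) ^+ 2).
  have c1 : 0 <= 1 + (kap * h)^-1 by rewrite addr_ge0 // invr_ge0 ltW.
  apply: le_trans (ler_wpM2l c1 g2) _.
  have -> : (h * h + h * kap^-1) * (K2 * (a + 2 * e) ^+ 2) = (1 + (kap * h)^-1) * (K2 * (h * (a + 2 * e)) ^+ 2).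
    by field; rewrite !lt0r_neq0.
  rewrite ler_wpM2l // ler_wpM2l // ler_sqr ?nnegrE ?rnorm_ge0 //.
  by rewrite mulr_ge0 ?(ltW h0) // addr_ge0 // mulr_ge0 ?(ltW e0).
rewrite (gram_shift dxs (ltW h0)) in g1.
have := h1 h h0 hd1; rewrite /D [h + s]addrC.
by lra.
Qed.

(** The short steps are summed by real induction: a right step is [step], and at a limit point
    [gram_lip] passes the inequality to the left limit. Then [gram (x t) >= 0] is dropped and
    [gram (x 0)] is bounded by admissibility. *)
Lemma trajectory_observed t : 0 <= t ->
  2^-1 * (prim psi t - prim psi 0) <= K2 * rnorm (x 0) ^+ 2 + (prim gam t - prim gam 0).
Proof.
move=> t0; apply: (@le_epsM _ _ _ t) => eps eps0.
suff : gram (x t) + 2^-1 * (prim psi t - prim psi 0) <=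
    gram (x 0) + (prim gam t - prim gam 0) + eps * t.
  have := gram_le (xA (lexx 0)); have : 0 <= gram (x t).
    rewrite /gram subr_ge0; apply: prim_homo (gi_cont (xA t0)) (lexx _) (ltW tau0) _.
    by move=> s /wt01 /andP[h _]; rewrite mulr_ge0 // obs2_ge0.
  by lra.
pose rhs u := gram (x 0) + (prim gam u - prim gam 0) + eps * u - 2^-1 * (prim psi u - prim psi 0).
suff : gram (x t) <= rhs t by rewrite /rhs; lra.
have rhs_cont u : 0 <= u -> {for u, continuous rhs}.
  move=> u0; have h1 := prim_deriv gam_cont u0; have h2 := prim_deriv psi_cont u0.
  have : exists d, is_derive u 1 rhs d by eexists; rewrite /rhs; apply: is_derive_eq.
  by move=> [d /is_derive_cont].
apply: (@real_induction _ 0 t (fun u => gram (x u) <= rhs u)) => //.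
- by rewrite /rhs !subrr !mulr0 !addr0 subr0.
- move=> s s0 st hu; apply: (@le_epsM _ _ _ 2) => e e0.
  have /cvgrPdist_le/(_ e e0)/nbhs_ballP[d1 /= d10 h1] := rhs_cont s (ltW s0).
  (* Bounds the factor in [gram_lip] for all points [u] with [|x u - x s| <= 1]. *)
  pose B := K2 * ((rnorm (x s) + 1) ^+ 2 + 2) + 1.
  have B0 : 0 < B by rewrite ltr_wpDl // mulr_ge0 // addr_ge0 // sqr_ge0.
  have e1 : 0 < Num.min 1 (e / B) by rewrite lt_min ltr01 divr_gt0.
  have [d2 d20 h2] := deriv_on_cont xd ((posP _).2 (ltW s0)) e1.
  pose d := Num.min s (Num.min d1 d2); have d0 : 0 < d by rewrite !lt_min s0 d10.
  pose u := s - d / 2.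
  have ds : d <= s by rewrite ge_min lexx.
  have dd1 : d <= d1 by rewrite !ge_min lexx orbT.
  have dd2 : d <= d2 by rewrite !ge_min lexx !orbT.
  have u0 : 0 <= u by rewrite /u; lra.
  have us : u < s by rewrite /u; lra.
  have su : `|u - s| = d / 2 by rewrite distrC gtr0_norm /u; lra.
  have := h2 u ((posP _).2 u0); rewrite su => /(_ _) h2'.
  have {}h2' : rnorm (x u - x s) <= Num.min 1 (e / B) by apply: h2'; lra.
  have {}h1 : `|rhs s - rhs u| <= e by apply: h1; rewrite /ball /= distrC su; lra.
  have := gram_lip (xA (ltW s0)) (xA u0); have := hu u u0 us.
  move: h2'; rewrite rnorm_distC le_min => /andP[k1 k2] k3 k4.
  have nu : rnorm (x u) <= rnorm (x s) + 1.
    by rewrite (le_trans (rnorm_dist_ge _ (x s))) // rnorm_distC lerD2l.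
  have k5 : K2 * (rnorm (x u) ^+ 2 + 1 + rnorm (x s - x u)) <= B.
    rewrite /B; have : rnorm (x u) ^+ 2 <= (rnorm (x s) + 1) ^+ 2.
      by rewrite ler_sqr ?nnegrE ?addr_ge0 ?rnorm_ge0.
    by move=> k; rewrite -[leLHS]addr0 lerD // ler_wpM2l //; lra.
  have k6 : rnorm (x s - x u) * (K2 * (rnorm (x u) ^+ 2 + 1 + rnorm (x s - x u))) <= e.
    rewrite ler_pdivlMr // in k2; apply: le_trans k2.
    by rewrite ler_wpM2l ?rnorm_ge0.
  by move: h1; rewrite ler_norml => /andP[]; lra.
move=> s s0 st hs; have [d d0 hd] := step s0 eps0; exists d => // v sv vd _.
have := hd (v - s); have -> : s + (v - s) = v by ring.
rewrite subr_gt0 ltrBlDl => /(_ sv vd).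
by move: hs; rewrite /rhs; lra.
Qed.

End Trajectory.

End Observation.

(** * The observed resolvent for large real parameters *)

Section ObservedResolvent.
Context {R : realType}.
Local Notation C := R[i].
Context {X Y : normedModType C} (cX : complete_rn X).
Context {T : R -> X -> X} {A : unbounded_op X X}.
Hypothesis hT : C0_semigroup T.
Hypothesis hA : generator_of A T.
Context {M w : R}.
Hypothesis M0 : 0 <= M.
Hypothesis hM : exp_bounded T M w.
Context {Cop : X -> Y} {Kc : R}.
Hypothesis Clin : forall (a : C) x y, dom A x -> dom A y ->
  Cop (a *: x + y) = a *: Cop x + Cop y.
Hypothesis Kc0 : 0 <= Kc.
Hypothesis Cb : forall x, dom A x -> rnorm (Cop x) <= Kc * (rnorm x + rnorm (A x)).
Local Notation pos := (`[0, +oo[%classic : set R).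

Lemma large_real (l : R) : 2 * `|w| + 1 <= l -> [/\ 1 <= l & w < complex.Re l%:C].
Proof. by move=> h; have := ler_norm w; have := normr_ge0 w; split=> /=; lra. Qed.

Lemma obs_resolvent_bound (l : R) y : 2 * `|w| + 1 <= l ->
  rnorm (Cop (resolvent A l%:C y)) <= Kc * (4 * M + 1) * rnorm y.
Proof.
move=> hl; have [l1 wl] := large_real hl.
have [dQ eQ] := resolventP cX hT hA M0 hM wl y.
have b1 := resolvent_real_bound cX hT hA M0 hM y hl.
rewrite (le_trans (Cb dQ)) // -mulrA ler_wpM2l //.
have -> : A (resolvent A l%:C y) = l%:C *: resolvent A l%:C y - y by rewrite -[in X in _ - X]eQ; lmod.
have b2 : rnorm (resolvent A l%:C y) <= 2 * M * rnorm y.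
  apply: le_trans b1; rewrite rnormZr ler_peMl ?rnorm_ge0 // ger0_norm //.
  exact: le_trans l1.
rewrite (le_trans (lerD b2 (le_trans (rnormB _ _) (lerD b1 (lexx _))))) //.
by apply: eq_lerR; ring.
Qed.

Lemma obs_resolvent_approx x (e : R) : dom A x -> 0 < e -> exists L, forall l : R, L <= l ->
  rnorm (l%:C *: Cop (resolvent A l%:C x) - Cop x) <= e.
Proof.
move=> dx e0; have K0 : 0 < 2 * Kc + 1 by rewrite ltr_wpDl // mulr_ge0.
have e1 : 0 < e / (2 * Kc + 1) by rewrite divr_gt0.
have [L1 h1] := resolvent_approx cX hT hA M0 hM x e1.
have [L2 h2] := resolvent_approx cX hT hA M0 hM (A x) e1.
exists (Num.max (2 * `|w| + 1) (Num.max L1 L2)) => l.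
rewrite !ge_max => /andP[hl /andP[/h1 {}h1 /h2 {}h2]]; have [l1 wl] := large_real hl.
have [dQ eQ] := resolventP cX hT hA M0 hM wl x.
have [dZ eZ] := dom_generatorZ hT hA l%:C dQ.
have [dB eB] := dom_generatorB hT hA dZ dx.
rewrite -(obsZ hT hA Clin) // -(obsB hT hA Clin) // (le_trans (Cb dB)) // eB eZ.
rewrite (resolvent_comm cX hT hA M0 hM wl dx).
rewrite (le_trans (ler_wpM2l Kc0 (lerD h1 h2))) //.
by rewrite -mulrDl mulrA ler_pdivrMr //; nra.
Qed.

(** On the domain [l C R(l) z] converges, so [C R(l) z] is of order [1 / l]; the bound of [C R(l)]
    uniform in [l] extends this by density. *)
Lemma obs_resolvent_small x (e : R) : 0 < e -> exists L, forall l : R, L <= l ->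
  rnorm (Cop (resolvent A l%:C x)) <= e.
Proof.
move=> e0; have K0 : 0 < 2 * (Kc * (4 * M + 1) + 1).
  by rewrite mulr_gt0 // ltr_wpDl // mulr_ge0 // addr_ge0 // mulr_ge0.
have [z dz zx] := generator_dense cX hT hA hM x (divr_gt0 e0 K0).
have [L1 h1] := obs_resolvent_approx dz ltr01.
have z1 : 0 < rnorm (Cop z) + 1 by rewrite ltr_wpDl ?rnorm_ge0.
exists (Num.max (2 * `|w| + 1) (Num.max L1 (2 * (rnorm (Cop z) + 1) / e))) => l.
rewrite !ge_max => /andP[hl /andP[/h1 {}h1 h2]]; have [l1 wl] := large_real hl.
have lin := resolvent_linear cX hT hA M0 hM wl.
have dQ y := (resolventP cX hT hA M0 hM wl y).1.
have b1 := obs_resolvent_bound (x - z) hl.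
have e1 : Kc * (4 * M + 1) * rnorm (x - z) <= e / 2.
  have q0 : 0 <= Kc * (4 * M + 1) by rewrite mulr_ge0 // addr_ge0 // mulr_ge0.
  rewrite rnorm_distC (le_trans (ler_wpM2l q0 zx)) // mulrA ler_pdivrMr //; nra.
have b2 : rnorm (Cop (resolvent A l%:C z)) <= e / 2.
  have : rnorm (l%:C *: Cop (resolvent A l%:C z)) <= rnorm (Cop z) + 1.
    by rewrite (le_trans (rnorm_dist_ge _ (Cop z))) // lerD2l.
  have l0 : 0 < l by rewrite (lt_le_trans ltr01).
  rewrite rnormZr gtr0_norm // -ler_pdivlMl // => h; apply: le_trans h _.
  by move: h2; rewrite ler_pdivrMr // ler_pdivrMl //; nra.
have -> : Cop (resolvent A l%:C x) = Cop (resolvent A l%:C (x - z)) + Cop (resolvent A l%:C z).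
  by rewrite -(obsD Clin) // -(linfD lin) subrK.
by rewrite (le_trans (rnormD _ _)) // [e]splitr lerD // (le_trans b1).
Qed.

(** The observation is bounded only in the graph norm, so the orbits of both [x] and [A x] have to
    be differentiable. *)
Lemma obs_deriv x : dom A x -> dom A (A x) ->
  deriv_on pos (fun t => Cop (T t x)) (fun t => Cop (T t (A x))).
Proof.
move=> dx dAx p Dp e e0; have K0 : 0 < 2 * Kc + 1 by rewrite ltr_wpDl // mulr_ge0.
have e1 : 0 < e / (2 * Kc + 1) by rewrite divr_gt0.
have [d1 d10 h1] := orbit_deriv hT hA hM dx Dp e1.
have [d2 d20 h2] := orbit_deriv hT hA hM dAx Dp e1.
exists (Num.min d1 d2); first by rewrite lt_min d10.
move=> u Du; rewrite lt_min => /andP[u1 u2].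
have {}h1 := h1 u Du u1; have {}h2 := h2 u Du u2.
move/posP : Dp => p0; move/posP : Du => u0.
have [du eu] := generator_orbit hT hA dx u0; have [dp ep] := generator_orbit hT hA dx p0.
have [dp' ep'] := generator_orbit hT hA dAx p0.
have [dZ eZ] := dom_generatorZ hT hA (u - p)%:C dp'.
have [dB eB] := dom_generatorB hT hA du dp.
have [dB' eB'] := dom_generatorB hT hA dB dZ.
rewrite -(obsZ hT hA Clin) // -!(obsB hT hA Clin) // (le_trans (Cb dB')) //.
rewrite eB' eB eZ eu ep ep' (le_trans (ler_wpM2l Kc0 (lerD h1 h2))) //.
have -> a h : Kc * (a * h + a * h) = 2 * Kc * a * h by ring.
by rewrite ler_wpM2r // mulrA ler_pdivrMr //; nra.
Qed.

(* Integrating by parts, an averaged bound on the output controls the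
   Laplace transform of the output, which is the observed resolvent. *)
Lemma obs_resolvent_average x (l d a : R) : 0 < l -> w < l -> 0 <= d -> 0 <= a -> dom A x ->
  (forall s, 0 <= s <= d -> prim (fun s => rnorm (Cop (T (Num.max 0 s) x))) s -
     prim (fun s => rnorm (Cop (T (Num.max 0 s) x))) 0 <= a * s) ->
  l * rnorm (Cop (resolvent A l%:C x)) <= a + l * (expR (- l * d) * rnorm (Cop (T d (resolvent A l%:C x)))).
Proof.
move=> l0 wl d0 a0 dx; set g := fun s => rnorm (Cop (T (Num.max 0 s) x)) => hG.
have wl' : w < complex.Re l%:C by [].
set z := resolvent A l%:C x; have [dz ez] := resolventP cX hT hA M0 hM wl' x.
rewrite -/z in dz ez.
have eAz : A z = l%:C *: z - x by rewrite -[in X in _ - X]ez; lmod.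
have [dlz _] := dom_generatorZ hT hA l%:C dz.
have [dAz _] := dom_generatorB hT hA dlz dx; rewrite -eAz in dAz.
have cg : continuous g := cont_rnorm_max0 (obs_cont hT hA hM Clin Kc0 Cb dx).
(* Since [A z = l z - x], the terms with [z] cancel in the derivative, which is minus the weighted
   output of [x]. *)
pose psi s : Y := (expR (- l * s))%:C *: Cop (T s z).
have dpsi : deriv_on `[0, d] psi (fun s => - (expR (- l * s))%:C *: Cop (T s x)).
  move=> s; rewrite /= in_itv /= => /andP[s0 sd].
  have da : is_derive s 1 (fun s => expR (- l * s)) (1 * (- l * expR (- l * s))).
    by have := is_derive_expM 1 (- l) s; under eq_fun do rewrite mul1r.
  have Ds : `[0, d]%classic s by rewrite /= in_itv /= s0.
  have sub : `[0, d]%classic `<=` pos by move=> r /=; rewrite !in_itv /= andbT => /andP[].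
  have h := deriv_at_scal Ds (deriv_at_real _ da) (deriv_atS sub (obs_deriv dz dAz ((posP s).2 s0))).
  apply: deriv_at_eq h _.
  rewrite eAz (linfB (C0_lin hT s0)) (linfZ (C0_lin hT s0)).
  have [d1 _] := generator_orbit hT hA dz s0; have [d2 _] := generator_orbit hT hA dx s0.
  have [d3 _] := dom_generatorZ hT hA l%:C d1.
  by rewrite (obsB hT hA Clin) // (obsZ hT hA Clin) //; lmod.
(* Integration by parts in differential form. The averaged bound says that [l a s] outweighs
   [l (prim g s - prim g 0)], so the derivative of [k] dominates [exp(- l s) g(s)]; the increment of
   [k] is at most [a / l]. *)
pose k s := expR (- l * s) * (prim g s - prim g 0) - a * ((s + l^-1) * expR (- l * s)).
have dk s : 0 <= s <= d -> is_derive s 1 k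
    (expR (- l * s) * (g s - l * (prim g s - prim g 0) + l * a * s)).
  move=> /andP[s0 _]; have h1 := prim_deriv cg s0.
  have da : is_derive s 1 (fun s => expR (- l * s)) (1 * (- l * expR (- l * s))).
    by have := is_derive_expM 1 (- l) s; under eq_fun do rewrite mul1r.
  apply: is_derive_eq; rewrite /GRing.scale /=.
  by field; exact: lt0r_neq0.
have := @mean_value _ _ 0 d psi _ k _ d0 dpsi dk.
have bnd : forall t, 0 <= t <= d -> rnorm (- (expR (- l * t))%:C *: Cop (T t x)) <=
     expR (- l * t) * (g t - l * (prim g t - prim g 0) + l * a * t).
  move=> t td; rewrite scaleNr rnormN rnormZr ger0_norm ?expR_ge0 //.
  rewrite ler_wpM2l ?expR_ge0 // /g max0l; last by case/andP: td.
  have := hG t td; rewrite -/g => h; have := ler_wpM2l (ltW l0) h; lra.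
move=> /(_ bnd) h.
have psi0 : psi 0 = Cop z by rewrite /psi mulr0 expR0 scale1r (C0_0 hT).
have psid : rnorm (psi d) = expR (- l * d) * rnorm (Cop (T d z)).
  by rewrite /psi rnormZr ger0_norm // expR_ge0.
have kd : k d - k 0 <= a / l.
  rewrite /k mulr0 expR0 subrr mulr0 add0r mulr1.
  have dd : 0 <= d <= d by rewrite d0 lexx.
  have := hG d dd; rewrite -/g => hd; have E := expR_ge0 (- l * d).
  have li : 0 <= a * l^-1 by rewrite mulr_ge0 // invr_ge0 ltW.
  have := mulr_ge0 E li; have := ler_wpM2l E hd; lra.
have h2 : rnorm (Cop z) <= expR (- l * d) * rnorm (Cop (T d z)) + a / l.
  rewrite -psi0 -psid (le_trans (rnorm_dist_ge _ (psi d))) // lerD2l rnorm_distC.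
  exact: le_trans kd.
rewrite (le_trans (ler_wpM2l (ltW l0) h2)) // mulrDr addrC lerD2r.
by rewrite mulrC divfK // lt0r_neq0.
Qed.

End ObservedResolvent.

(** * Almost everywhere defined outputs *)

Section AlmostEverywhere.
Context {R : realType}.
Local Notation mu := (@lebesgue_measure R).
Implicit Types (g : R -> R).

Lemma integral_halfline_le g (c : R) : continuous g -> (forall t, 0 <= g t) ->
  (forall b, 0 <= b -> prim g b - prim g 0 <= c) ->
  (\int[mu]_(t in `[0%R, +oo[) (g t)%:E <= c%:E)%E.
Proof.
move=> cg g0 hc; rewrite itv_bndy_bigcup_BRight.
have mg (D : set R) : measurable_fun D (EFin \o g).
  by apply/measurable_EFinP; apply: measurable_funTS; exact: continuous_measurable_fun.
have nd : nondecreasing_seq (fun k : nat => `[0%R, (0 + k%:R)%R]%classic : set R).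
  move=> m n mn; rewrite subsetEset => x /=; rewrite !in_itv /= => /andP[-> h] /=.
  by rewrite (le_trans h) // lerD2l ler_nat.
have h : (\int[mu]_(t in `[0%R, (0 + k%:R)%R]) (g t)%:E)%E @[k --> \oo] -->
    (\int[mu]_(t in \bigcup_n `[0%R, (0 + n%:R)%R]%classic) (g t)%:E)%E.
  by apply: ge0_nondecreasing_set_cvg_integral => // i *; [exact: mg|rewrite lee_fin].
rewrite -(cvg_lim _ h) //; apply: lime_le; first by apply/cvg_ex; eexists; exact: h.
apply: nearW => n; rewrite /= add0r (@integral_prim _ g 0 n%:R) // lee_fin.
by apply: hc.
Qed.

Lemma cont_sum (g : nat -> R -> R) N : (forall m, continuous (g m)) ->
  continuous (fun t => \sum_(m < N) g m t).
Proof.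
move=> cg; elim: N => [|N IH].
  rewrite (_ : (fun _ => _) = cst 0); last by apply/funext => x; rewrite big_ord0.
  exact: cont_cst.
rewrite (_ : (fun _ => _) = (fun t => (\sum_(m < N) g m t) + g N t)); last first.
  by apply/funext => x; rewrite big_ord_recr.
exact: contD.
Qed.

Lemma sum_prim (g : nat -> R -> R) (a b : R) N : (forall m, continuous (g m)) -> 0 <= a -> a <= b ->
  prim (fun t => \sum_(m < N) g m t) b - prim (fun t => \sum_(m < N) g m t) a =
  \sum_(m < N) (prim (g m) b - prim (g m) a).
Proof.
move=> cg a0 ab; rewrite sumrB.
apply: (@deriv_eq _ _ (fun t => \sum_(m < N) prim (g m) t) (fun t => \sum_(m < N) g m t)) => // t /andP[at_ _].
  apply: prim_deriv; last exact: le_trans at_.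
  exact: cont_sum.
have t0 : 0 <= t by exact: le_trans at_.
elim: N => [|N IH].
  rewrite (_ : (fun _ => _) = cst 0); last by apply/funext => x; rewrite big_ord0.
  by rewrite big_ord0; exact: is_derive_cst.
rewrite (_ : (fun _ => _) = (fun t => \sum_(m < N) prim (g m) t) + prim (g N)); last first.
  by apply/funext => x; rewrite big_ord_recr.
by rewrite big_ord_recr /=; apply: is_deriveD => //; exact: prim_deriv.
Qed.

(** The sum of the series is integrable by monotone convergence, and [L] is its value at a Lebesgue
    point [t]. Each partial sum lies below the full sum, which makes the bound on the averages
    uniform in [N]. *)
Lemma series_lebesgue_points (g : nat -> R -> R) (c : nat -> R) (K : R) :
  (forall m, continuous (g m)) -> (forall m t, 0 <= g m t) ->
  (forall m b, 0 <= b -> prim (g m) b - prim (g m) 0 <= c m) ->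
  (forall N, \sum_(m < N) c m <= K) ->
  {ae mu, forall t, 0 < t -> exists L, 
     (forall e : R, 0 < e -> exists N0, forall N, (N0 <= N)%N -> `|\sum_(m < N) g m t - L| <= e) /\
     (forall e : R, 0 < e -> exists2 d : R, 0 < d & forall s N, 0 <= s -> s <= d ->
        \sum_(m < N) (prim (g m) (t + s) - prim (g m) t) <= s * (L + e))}.
Proof.
move=> cg g0 hc hK.
pose F t : \bar R := (\sum_(m <oo) (g m t)%:E)%E.
pose D : set R := `[0%R, +oo[%classic.
have mg m (E : set R) : measurable_fun E (EFin \o g m).
  by apply/measurable_EFinP; apply: measurable_funTS; exact: continuous_measurable_fun.
have gE0 m t : (0 <= (g m t)%:E)%E by rewrite lee_fin.
have F0 t : (0 <= F t)%E by apply: nneseries_ge0.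
have mF (E : set R) : measurable_fun E F.
  by apply: (ge0_emeasurable_sum (h := fun m t => (g m t)%:E) (P := xpredT)) => [k t _ _|k _]; [exact: gE0|exact: mg].
have mD : measurable (D : set (measurableTypeR R)) by exact: measurable_itv.
have iF : (\int[mu]_(t in D) F t <= K%:E)%E.
  rewrite /F integral_nneseries //; last by move=> n; exact: mg.
  apply: lime_le; first by apply: is_cvg_nneseries => n _ _; apply: integral_ge0 => t _; exact: gE0.
  apply: nearW => N; rewrite big_mkord.
  apply: (@le_trans _ _ (\sum_(m < N) (c m)%:E)%E).
    by apply: lee_sum => m _; apply: integral_halfline_le => // b; exact: hc.
  by rewrite sumEFin lee_fin.
have intF : mu.-integrable D F.
  apply/integrableP; split; first exact: mF.
  under eq_integral => t _ do rewrite gee0_abs //.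
  exact: le_lt_trans iF (ltry _).
have finF := integrable_ae mD intF.
have intf : mu.-integrable D (EFin \o (fine \o F)).
  apply/integrableP; split.
    by apply/measurable_EFinP; apply: measurableT_comp => //; exact: mF.
  apply: le_lt_trans (le_lt_trans iF (ltry _)).
  apply: ge0_le_integral => //.
  - by apply: measurableT_comp => //; apply/measurable_EFinP; apply: measurableT_comp => //; exact: mF.
  - exact: mF.
  - move=> t _ /=; rewrite ger0_norm ?fine_ge0 //.
    by have := F0 t; case: (F t) => //= r; rewrite leey.
(* Finite values and extension by 0 give a locally integrable function on the whole line, as
   Lebesgue differentiation requires. *)
pose f := (fine \o F) \_ D.
have lf : locally_integrable [set: R] f by exact: integrable_locally.
have := lebesgue_differentiation lf; move: finF.
apply: filterS2 => t finFt lt t0; have Dt s : 0 <= s -> D s by move=> s0; rewrite /D /= in_itv /= s0.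
have {}finFt := finFt (Dt _ (ltW t0)).
have fE s : 0 <= s -> f s = fine (F s) by move=> s0; rewrite /f patchE mem_set //; exact: Dt.
exists (f t); have ft0 : 0 <= f t by rewrite fE ?(ltW t0) // fine_ge0.
have FtE : F t = (f t)%:E by rewrite fE ?(ltW t0) // fineK.
split=> [e e0|e e0].
  have : (\sum_(0 <= m < N) (g m t)%:E)%E @[N --> \oo] --> (f t)%:E.
    by rewrite -FtE; apply: is_cvg_nneseries.
  move=> /fine_cvgP[_ /cvgrPdist_le/(_ e e0)[N0 _ h]]; exists N0 => N /h /=.
  by rewrite distrC big_mkord sumEFin.
have e4 : 0 < e / 4 by rewrite divr_gt0.
move: lt; rewrite /lebesgue_pt => /fine_cvgP[[d1 /= d10 h1] /cvgrPdist_le/(_ _ e4)[d2 /= d20 h2]].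
exists (Num.min d1 d2 / 4); first by rewrite divr_gt0 // lt_min d10.
move=> s N; rewrite le_eqVlt => /predU1P[<- _|s0 sd].
  by rewrite mul0r addr0; rewrite big1 // => i _; rewrite subrr.
have m1 : Num.min d1 d2 <= d1 by rewrite ge_min lexx.
have m2 : Num.min d1 d2 <= d2 by rewrite ge_min lexx orbT.
(* The closed interval from [t] to [t + s] lies in the open ball of radius [2 s]. This ball has
   measure [4 s], so a mean deviation of [e / 4] integrates to [s * e]. *)
pose r := 2 * s; have r0 : 0 < r by rewrite mulr_gt0.
have rd1 : `|0 - r| < d1 by rewrite sub0r normrN gtr0_norm // /r; lra.
have rd2 : `|0 - r| < d2 by rewrite sub0r normrN gtr0_norm // /r; lra.
have {}h1 := h1 r rd1 r0; have {}h2 := h2 r rd2 r0.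
have avg : (\int[mu]_(y in ball t r) `|(f y - f t)%:E| <= (s * e)%:E)%E.
  move: h1 h2; rewrite /= sub0r normrN /davg /iavg => h1 h2.
  have mb : (mu (ball t r) = (r *+ 2)%:E)%E by rewrite lebesgue_measure_ball // ltW.
  rewrite mb in h1 h2; set I := (\int[mu]_(y in ball t r) _)%E in h1 h2 *.
  have I0 : (0 <= I)%E by apply: integral_ge0.
  have rr : 0 < r *+ 2 by rewrite mulrn_wgt0.
  have inv : ((r *+ 2)%:E^-1 = ((r *+ 2)^-1)%:E)%E by rewrite inver gt_eqF.
  rewrite inv in h1 h2.
  have If : I \is a fin_num.
    by clear h2; move: h1 I0; case: (I) => [//| |//]; rewrite gt0_muley // lte_fin invr_gt0.
  rewrite -(fineK If) lee_fin; move: h2; rewrite fineM // ger0_norm; last first.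
    by rewrite mulr_ge0 ?fine_ge0 // lee_fin invr_ge0 ltW.
  by rewrite /= mulrC ler_pdivrMr // /r -mulr_natr; lra.
have ts : t <= t + s by rewrite lerDl ltW.
have sub : `[t, t + s]%classic `<=` ball t r.
  move=> y /=; rewrite in_itv /= => /andP[ty yt]; rewrite /ball /=.
  by rewrite distrC ger0_norm ?subr_ge0 // /r; lra.
have cS : continuous (fun y => \sum_(m < N) g m y).
  exact: cont_sum.
rewrite -(sum_prim _ cg (ltW t0) ts) -lee_fin -(integral_prim cS (ltW t0) ts).
have mI : measurable `[t, t + s]%classic by exact: measurable_itv.
have mf (E : set R) : measurable_fun E f by apply: measurable_funTS; case: lf.
have mff (E : set R) : measurable_fun E (fun y => `|(f y - f t)%:E|%E).
  apply: measurableT_comp => //; apply/measurable_EFinP; exact: measurable_funB.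
apply: (@le_trans _ _ (\int[mu]_(y in `[t, (t + s)%R]) ((f t)%:E + `|(f y - f t)%:E|)%E)%E).
  apply: ae_ge0_le_integral => //.
  - by move=> y _; rewrite lee_fin sumr_ge0.
  - by apply/measurable_EFinP; apply: measurable_funTS; exact: continuous_measurable_fun.
  - by move=> y _; rewrite -EFinD lee_fin addr_ge0.
  - apply: emeasurable_funD => //; exact: mff.
  move: (integrable_ae mD intF); apply: filterS => y finFy.
  rewrite /= in_itv /= => /andP[ty _]; have y0 : 0 <= y by rewrite (le_trans (ltW t0)).
  apply: (@le_trans _ _ (F y)).
    rewrite -sumEFin -(big_mkord xpredT (fun m => (g m y)%:E)); apply: nneseries_lim_ge => k _ _.
    exact: gE0.
  rewrite -(fineK (finFy (Dt _ y0))) -fE // -EFinD lee_fin.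
  by have := ler_norm (f y - f t); lra.
rewrite ge0_integralD //; last exact: mff.
have cI : (\int[mu]_(y in `[t, (t + s)%R]) (f t)%:E)%E = (s * f t)%:E.
  rewrite (integral_prim (@cont_cst R (f t)) (ltW t0) ts); congr EFin.
  apply: etrans (@deriv_eq _ _ (fun y => f t * y) (cst (f t)) _ _ ts _ _) _; last by rewrite -mulrBr addrAC subrr add0r mulrC.
  - by move=> y /andP[ty _]; apply: (prim_deriv (@cont_cst R (f t))); rewrite (le_trans (ltW t0)).
  - by move=> y _; apply: is_derive_eq; rewrite /GRing.scale /= mulr1.
apply: (@le_trans _ _ ((s * f t)%:E + (s * e)%:E)%E); last by rewrite -EFinD mulrDr.
apply: leeD; first by rewrite cI.
apply: le_trans avg; apply: ge0_subset_integral => //.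
  exact: measurable_ball.
exact: mff.
Qed.

End AlmostEverywhere.

Lemma prim_window {R : realType} (f g h : R -> R) (t s : R) :
  continuous f -> continuous g -> continuous h -> 0 <= t -> 0 <= s ->
  (forall r, 0 <= r <= s -> f r <= g (r + t) - h (r + t)) ->
  prim f s - prim f 0 <= (prim g (t + s) - prim g t) - (prim h (t + s) - prim h t).
Proof.
move=> cf cg ch t0 s0 le; pose Q (r : R) := prim g (r + t) - prim h (r + t).
have -> : (prim g (t + s) - prim g t) - (prim h (t + s) - prim h t) = Q s - Q 0.
  by rewrite /Q add0r [s + t]addrC; ring.
apply: (@deriv_le R (prim f) Q f (fun r => g (r + t) - h (r + t))) => //.
  by move=> r /andP[r0 _]; exact: prim_deriv.
move=> r /andP[r0 _]; apply: is_deriveB; apply: is_derive_shift; apply: prim_deriv => //; exact: addr_ge0.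
Qed.

Section OutputAlmostEverywhere.
Context {R : realType}.
Local Notation C := R[i].
Local Notation mu := (@lebesgue_measure R).
Context {V Y : normedModType C} (cV : complete_rn V) (cY : complete_rn Y).
Context {S : R -> V -> V} {B : unbounded_op V V}.
Hypothesis hS : C0_semigroup S.
Hypothesis hB : generator_of B S.
Context {N om : R}.
Hypothesis N0 : 0 <= N.
Hypothesis om0 : 0 < om.
Hypothesis hN : exp_bounded S N (- om).
Context {Cob : V -> Y} {Kb c : R}.
Hypothesis Clin : forall (a : C) x y, dom B x -> dom B y ->
  Cob (a *: x + y) = a *: Cob x + Cob y.
Hypothesis Kb0 : 0 <= Kb.
Hypothesis Cb : forall x, dom B x -> rnorm (Cob x) <= Kb * (rnorm x + rnorm (B x)).
Hypothesis c0 : 0 <= c.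
Hypothesis adm : forall v, dom B v -> forall t, 0 <= t ->
  prim (fun s => expR (om * s) * @obs2 _ _ _ S Cob v s) t -
  prim (fun s => expR (om * s) * @obs2 _ _ _ S Cob v s) 0 <= c * rnorm v ^+ 2.

Lemma S_contr t x : 0 <= t -> rnorm (S t x) <= N * rnorm x.
Proof.
move=> t0; rewrite (le_trans (hN x t0)) // ler_wpM2r ?rnorm_ge0 // ler_piMr //.
by rewrite -expR0 ler_expR mulNr oppr_le0 mulr_ge0 // ltW.
Qed.

Lemma dom_sub x y : dom B x -> dom B y -> dom B (x - y).
Proof. by move=> dx dy; exact: (dom_generatorB hS hB dx dy).1. Qed.

Lemma obs_orbitB t x y : 0 <= t -> dom B x -> dom B y ->
  Cob (S t (x - y)) = Cob (S t x) - Cob (S t y).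
Proof.
move=> t0 dx dy; rewrite (linfB (C0_lin hS t0)) (obsB hS hB Clin) //.
  exact: (generator_orbit hS hB dx t0).1.
exact: (generator_orbit hS hB dy t0).1.
Qed.

(** Young's inequality [a <= (eta exp(- om t) + eta^-1 exp(om t) a^2) / 2], integrated. The free
    [eta] lets an [L^1] bound follow the size of [v]. *)
Lemma obs_L1 (eta : R) v b : 0 < eta -> dom B v -> 0 <= b ->
  prim (fun t => rnorm (Cob (S (Num.max 0 t) v))) b - prim (fun t => rnorm (Cob (S (Num.max 0 t) v))) 0
  <= 2^-1 * (eta / om + c * rnorm v ^+ 2 / eta).
Proof.
move=> e0 dv b0; set g := fun t => _.
have cg : continuous g := cont_rnorm_max0 (obs_cont hS hB hN Clin Kb0 Cb dv).
have cw : continuous (fun s : R => expR (om * s) * @obs2 _ _ _ S Cob v s).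
  by apply: contM; [exact: cont_expM|exact: (obs2_cont hS hB hN Clin Kb0 Cb dv)].
set W := fun s : R => expR (om * s) * @obs2 _ _ _ S Cob v s in cw.
pose G s := 2^-1 * ((- (eta / om)) * expR (- om * s) + eta^-1 * prim W s).
have := @deriv_le _ (prim g) G g (fun s => 2^-1 * (eta * expR (- om * s) + eta^-1 * W s)) 0 b b0.
move=> h; apply: le_trans (h _ _ _) _.
- by move=> t /andP[t0 _]; exact: prim_deriv.
- move=> t /andP[t0 _]; have h1 := is_derive_expM (- (eta / om)) (- om) t.
  have h2 := prim_deriv cw t0.
  apply: (@is_derive_eq _ _ _ _ _ _ _ _ (is_deriveZ 2^-1 (is_deriveD h1 (is_deriveZ eta^-1 h2)))).
  by rewrite /GRing.scale /=; field; rewrite !lt0r_neq0.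
- move=> t _; rewrite /g /W /obs2; set a := rnorm _.
  have E0 := expR_gt0 (om * t); rewrite mulNr expRN.
  rewrite -subr_ge0.
  have -> : 2^-1 * (eta / expR (om * t) + eta^-1 * (expR (om * t) * a ^+ 2)) - a =
     (2 * eta * expR (om * t))^-1 * (expR (om * t) * a - eta) ^+ 2.
    by field; rewrite !lt0r_neq0.
  by rewrite mulr_ge0 ?sqr_ge0 // invr_ge0 !mulr_ge0 // ltW.
rewrite /G -mulrBr ler_wpM2l ?invr_ge0 // mulr0 expR0 mulr1.
have E0 := expR_ge0 (- om * b).
have h1 : 0 <= eta / om * expR (- om * b) by rewrite mulr_ge0 // divr_ge0 // ltW.
have h2 : eta^-1 * (prim W b - prim W 0) <= eta^-1 * (c * rnorm v ^+ 2).
  by rewrite ler_wpM2l ?invr_ge0 ?(ltW e0) // adm.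
by rewrite [c * _ / eta]mulrC; lra.
Qed.

(** Uses [exp(l d) >= (l d / 2)^2], which leaves a factor [1 / l]. *)
Lemma large_exp_small (K d e : R) : 0 < d -> 0 < e -> exists L, forall l : R, L <= l ->
  l * (expR (- l * d) * K) <= e.
Proof.
move=> d0 e0; have [L0 hL] : exists L, 0 < L /\ 4 * `|K| / (d ^+ 2 * e) <= L.
  exists (4 * `|K| / (d ^+ 2 * e) + 1); split; last by rewrite lerDl.
  by rewrite ltr_wpDl // divr_ge0 ?mulr_ge0 ?sqr_ge0 // ltW.
exists L0 => l Ll; have [L00 h] := hL; have l0 : 0 < l by exact: lt_le_trans Ll.
have ld0 : 0 < l * d / 2 by rewrite divr_gt0 // mulr_gt0.
have hE : (l * d / 2) ^+ 2 <= expR (l * d).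
  have -> : expR (l * d) = expR (l * d / 2) ^+ 2.
    by rewrite expr2 -expRD; congr expR; field.
  rewrite ler_sqr ?nnegrE ?expR_ge0 ?(ltW ld0) //.
  by have := expR_ge1Dx (l * d / 2); lra.
have sq0 : 0 < (l * d / 2) ^+ 2 by rewrite exprn_gt0.
rewrite mulNr expRN mulrCA (@le_trans _ _ ((expR (l * d))^-1 * (l * `|K|))) //.
  by rewrite ler_wpM2l ?invr_ge0 ?expR_ge0 // ler_wpM2l ?(ltW l0) // ler_norm.
rewrite (@le_trans _ _ (((l * d / 2) ^+ 2)^-1 * (l * `|K|))) //.
  rewrite ler_wpM2r ?mulr_ge0 ?(ltW l0) // lef_pV2 ?posrE ?expR_gt0 //.
have -> : ((l * d / 2) ^+ 2)^-1 * (l * `|K|) = 4 * `|K| / d ^+ 2 / l.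
  by field; rewrite !lt0r_neq0.
rewrite ler_pdivrMr // ler_pdivrMr ?exprn_gt0 //.
move: h; rewrite ler_pdivrMr ?mulr_gt0 ?exprn_gt0 // => h; apply: le_trans h _.
have -> : e * l * d ^+ 2 = l * (d ^+ 2 * e) by ring.
by rewrite ler_wpM2r // mulr_ge0 ?sqr_ge0 // ltW.
Qed.

Lemma output_ae x : exists xs : nat -> V, [/\ forall n, dom B (xs n), tends xs x &
  {ae mu, forall t, 0 < t -> exists y,
    tends_infty (fun l => l%:C *: Cob (resolvent B l%:C (S t x))) y /\
    tends (fun n => Cob (S t (xs n))) y}].
Proof.
(* With distances [4^-n] to [x], the increments have squared norm of order [16^-m]; [obs_L1] with
   [eta = 2^-m] then bounds their outputs in [L^1] by a multiple of [2^-m], which is summable. *)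
have q0 n : 0 < ((2 ^+ n)^-1) ^+ 2 :> R by rewrite exprn_gt0 // invr_gt0 expn2_gt0.
have ex n : exists z, dom B z /\ rnorm (z - x) <= ((2 ^+ n)^-1) ^+ 2.
  by have [z dz zx] := generator_dense cV hS hB hN x (q0 n); exists z.
have [xs hxs] := choice ex; have dxs n := (hxs n).1.
have p1 m : (2 ^+ m)^-1 <= 1 :> R by rewrite invf_le1 ?expn2_gt0 // exprn_ege1 // ler1n.
have txs : tends xs x.
  move=> e e0; have [M hM] := expn2_small e0; exists M => n /hM h.
  rewrite (le_trans (hxs n).2) // (le_trans _ h) // expr2 ler_piMl ?invr_ge0 ?(ltW (expn2_gt0 _)) ?p1 //.
exists xs; split => //.
pose dd m := xs m.+1 - xs m; have ddd m : dom B (dd m) by exact: dom_sub.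
pose g m t := rnorm (Cob (S (Num.max 0 t) (dd m))).
have cg m : continuous (g m) := cont_rnorm_max0 (obs_cont hS hB hN Clin Kb0 Cb (ddd m)).
have ndd m : rnorm (dd m) <= 2 * ((2 ^+ m)^-1) ^+ 2.
  rewrite (le_trans (rnorm_triangle _ x _)) // [X in _ + X]rnorm_distC.
  have h1 := (hxs m).2; have h2 := (hxs m.+1).2; have h3 := q0 m.
  have h4 : ((2 ^+ m.+1)^-1) ^+ 2 <= ((2 ^+ m)^-1) ^+ 2 :> R.
    rewrite ler_sqr ?nnegrE ?invr_ge0 ?(ltW (expn2_gt0 _)) //.
    by rewrite lef_pV2 ?posrE ?expn2_gt0 // exprS ler_peMl ?(ltW (expn2_gt0 _)) // ler1n.
  by lra.
pose K := 2^-1 / om + 2 * c; have K0 : 0 <= K.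
  by apply: addr_ge0; [rewrite divr_ge0 // ltW | rewrite mulr_ge0].
pose cm m : R := K * (2 ^+ m)^-1.
have hcm m b : 0 <= b -> prim (g m) b - prim (g m) 0 <= cm m.
  move=> b0; have e0 : 0 < (2 ^+ m)^-1 :> R by rewrite invr_gt0 expn2_gt0.
  apply: le_trans (obs_L1 e0 (ddd m) b0) _.
  have e1 := p1 m.
  have h1 : rnorm (dd m) ^+ 2 <= 4 * ((2 ^+ m)^-1) ^+ 4.
    apply: (@le_trans _ _ ((2 * ((2 ^+ m)^-1) ^+ 2) ^+ 2)).
      by rewrite ler_sqr ?nnegrE ?rnorm_ge0 ?mulr_ge0 ?sqr_ge0.
    by apply: eq_lerR; ring.
  rewrite /cm /K; move: e0 e1 h1; set eta := (2 ^+ m)^-1; move=> e0 e1 h1.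
  have h2 : c * rnorm (dd m) ^+ 2 / eta <= 4 * c * eta.
    rewrite ler_pdivrMr // (le_trans (ler_wpM2l c0 h1)) //.
    have h3 : eta ^+ 4 <= eta * eta.
      rewrite (_ : eta ^+ 4 = (eta * eta) * (eta * eta)); last by ring.
      have ee : eta * eta <= 1 by rewrite mulr_ile1 // ltW.
      by rewrite ler_piMl // mulr_ge0 // ltW.
    by have := ler_wpM2l c0 h3; lra.
  have -> : (2^-1 / om + 2 * c) * eta = 2^-1 * (eta / om + 4 * c * eta) by field; exact: lt0r_neq0.
  by rewrite ler_wpM2l ?invr_ge0 // lerD2l.
have hsum M : \sum_(m < M) cm m <= 2 * K.
  suff -> : \sum_(m < M) cm m = 2 * K - 2 * K * (2 ^+ M)^-1.
    by rewrite gerBl !mulr_ge0 // invr_ge0 ltW ?expn2_gt0.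
  elim: M => [|M IH]; first by rewrite big_ord0 expr0 invr1 mulr1 subrr.
  by rewrite big_ord_recr /= IH /cm exprS; field; rewrite lt0r_neq0 ?expn2_gt0.
have := series_lebesgue_points cg (fun m t => rnorm_ge0 _) hcm hsum.
apply: (@filterS _ _ (ae_filter_ringOfSetsType _)) => t ht t0; have [L [sL avg]] := ht t0; have t0' := ltW t0.
have dS v s : dom B v -> 0 <= s -> dom B (S s v).
  by move=> dv s0; exact: (generator_orbit hS hB dv s0).1.
(* Telescoping: the output of [xs (n + k) - xs n] is dominated by a segment of the series. *)
have gdiff (s : R) n k : 0 <= s -> rnorm (Cob (S s (xs (n + k)%N - xs n))) <=
    \sum_(m < (n + k)%N) g m s - \sum_(m < n) g m s.
  move=> s0; elim: k => [|k IH].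
    by rewrite addn0 !subrr (linf0 (C0_lin hS s0)) (obs0 hS hB Clin) rnorm0.
  rewrite addnS big_ord_recr /=.
  have -> : xs (n + k).+1 - xs n = dd (n + k)%N - (xs n - xs (n + k)%N) by rewrite /dd; lmod.
  rewrite obs_orbitB //; last exact: dom_sub.
  have -> : Cob (S s (xs n - xs (n + k)%N)) = - Cob (S s (xs (n + k)%N - xs n)).
    by rewrite !obs_orbitB // opprB.
  rewrite opprK (le_trans (rnormD _ _)) //.
  have -> : rnorm (Cob (S s (dd (n + k)%N))) = g (n + k)%N s by rewrite /g max0l.
  by lra.
have cau n k (e : R) : 0 < e -> (forall M, (n <= M)%N -> `|\sum_(m < M) g m t - L| <= e) ->
    rnorm (Cob (S t (xs (n + k)%N)) - Cob (S t (xs n))) <= 2 * e.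
  move=> e0 h; rewrite -obs_orbitB // (le_trans (gdiff _ _ _ t0')) //.
  have := h (n + k)%N (leq_addr _ _); have := h n (leqnn _).
  by rewrite !ler_norml; lra.
have [|y hy] := @cY (fun n => Cob (S t (xs n))).
  move=> e e0; have e4 : 0 < e / 4 by rewrite divr_gt0.
  have [M hM] := sL _ e4; exists M => m n Mm Mn.
  rewrite (le_trans (rnorm_triangle _ (Cob (S t (xs M))) _)) // [X in _ + X]rnorm_distC.
  rewrite -(subnKC Mm) -(subnKC Mn).
  by have := cau M (m - M)%N _ e4 hM; have := cau M (n - M)%N _ e4 hM; lra.
exists y; split => // e e0.
(* The total error is [5 e'] for [x - xs n], [e'] for the resolvent limit at [xs n] and [e'] for the
   distance of outputs. *)
pose e' := e / 8; have e'0 : 0 < e' by rewrite divr_gt0.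
have [n0 hn0] := sL _ e'0; have [n1 hn1] := hy _ e'0; pose n := maxn n0 n1.
have {}hn1 := hn1 n (leq_maxr _ _).
have hn M : (n <= M)%N -> `|\sum_(m < M) g m t - L| <= e'.
  by move=> nM; apply: hn0; exact: leq_trans (leq_maxl _ _) nM.
have [d1 d10 h1] := avg _ e'0.
have csum := @cont_sum _ g n cg.
have [d2 d20 h2] := is_derive_eps (prim_deriv csum t0') e'0.
pose d := Num.min d1 (d2 / 2); have d0 : 0 < d by rewrite lt_min d10 divr_gt0.
have dd1 : d <= d1 by rewrite ge_min lexx.
have dd2 : d < d2.
  by rewrite gt_min; apply/orP; right; rewrite ltr_pdivrMr // ltr_pMr // ltr1n.
(* The full sum averages to at most [L + e'] after [t]. The first [n] terms average to at least
   their value at [t] minus [e'], hence at least [L - 2 e']. The segment in between is thus small,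
   uniformly in [k]. *)
have key k (s : R) : 0 <= s <= d ->
   prim (fun r => rnorm (Cob (S (Num.max 0 r) (S t (xs (n + k)%N - xs n))))) s -
   prim (fun r => rnorm (Cob (S (Num.max 0 r) (S t (xs (n + k)%N - xs n))))) 0 <= 4 * e' * s.
  move=> /andP[s0 sd]; have dz := dS _ _ (dom_sub (dxs (n + k)%N) (dxs n)) t0'.
  have cz := cont_rnorm_max0 (obs_cont hS hB hN Clin Kb0 Cb dz).
  apply: le_trans (prim_window cz (@cont_sum _ g (n + k)%N cg) csum t0' s0 _) _.
    move=> r /andP[r0 _]; rewrite max0l // -(C0_D hS) //; apply: gdiff.
    by rewrite addr_ge0.
  have ts : t <= t + s by rewrite lerDl.
  have a1 := h1 s (n + k)%N s0 (le_trans sd dd1).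
  rewrite -(sum_prim _ cg t0' ts) in a1.
  have a2 := h2 (t + s); have eq1 : t + s - t = s by ring.
  rewrite eq1 ger0_norm // in a2; have {}a2 := a2 (le_lt_trans sd dd2).
  have := hn n (leqnn _); move: a1 a2; rewrite !ler_norml => a1 /andP[a2 _] /andP[a3 _].
  by nra.
(* Bounds the boundary term of [obs_resolvent_average] uniformly in [k] and in large [l], so that
   the factor [l exp(- l d)] makes it negligible. *)
pose Kd := Kb * (N * (4 * N + 1)) * (N * 2).
have [L1 hL1] := large_exp_small Kd d0 e'0.
have [L2 hL2] := obs_resolvent_approx cV hS hB N0 hN Clin Kb0 Cb (dS _ _ (dxs n) t0') e'0.
exists (Num.max (2 * `|- om| + 1) (Num.max L1 L2)) => l.
rewrite !ge_max => /andP[hl /andP[/hL1 {}hL1 /hL2 {}hL2]].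
have [l1 wl] := large_real hl; have l0 : 0 < l by rewrite (lt_le_trans ltr01).
have lQ := resolvent_linear cV hS hB N0 hN wl.
have dQ v := (resolventP cV hS hB N0 hN wl v).1.
have wl' : - om < l by exact: wl.
have bQ v : rnorm (Cob (S d (resolvent B l%:C v))) <= Kb * (N * (4 * N + 1)) * rnorm v.
  have [dq eq] := resolventP cV hS hB N0 hN wl v; set z := resolvent B l%:C v in dq eq *.
  have [dSz eSz] := generator_orbit hS hB dq (ltW d0).
  rewrite (le_trans (Cb dSz)) // -mulrA ler_wpM2l // eSz.
  rewrite (le_trans (lerD (S_contr _ (ltW d0)) (S_contr _ (ltW d0)))) // -mulrDr -mulrA ler_wpM2l //.
  have b1 : rnorm (l%:C *: z) <= 2 * N * rnorm v := resolvent_real_bound cV hS hB N0 hN v hl.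
  have b2 : rnorm z <= 2 * N * rnorm v.
    apply: le_trans b1; rewrite rnormZr gtr0_norm // ler_peMl ?rnorm_ge0 //.
  have -> : B z = l%:C *: z - v by rewrite -[in X in _ - X]eq; lmod.
  have := rnormB (l%:C *: z) v; lra.
have xs1 m : rnorm (xs m - x) <= 1.
  rewrite (le_trans (hxs m).2) // exprn_ile1 // ?invr_ge0 ?(ltW (expn2_gt0 _)) ?p1.
have bound k : l * rnorm (Cob (resolvent B l%:C (S t (xs (n + k)%N - xs n)))) <= 5 * e'.
  have dz := dS _ _ (dom_sub (dxs (n + k)%N) (dxs n)) t0'.
  have a0 : 0 <= 4 * e' by rewrite mulr_ge0 // ltW.
  have := obs_resolvent_average cV hS hB N0 hN Clin Kb0 Cb l0 wl' (ltW d0) a0 dz (key k).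
  move=> h; apply: le_trans h _.
  have h3 : rnorm (Cob (S d (resolvent B l%:C (S t (xs (n + k)%N - xs n))))) <= Kd.
    rewrite (le_trans (bQ _)) // /Kd ler_wpM2l ?mulr_ge0 ?addr_ge0 ?mulr_ge0 //.
    rewrite (le_trans (S_contr _ t0')) // ler_wpM2l //.
    rewrite (le_trans (rnorm_triangle _ x _)) // [X in _ + X]rnorm_distC.
    by have := xs1 (n + k)%N; have := xs1 n; lra.
  have h4 : l * (expR (- l * d) * rnorm (Cob (S d (resolvent B l%:C (S t (xs (n + k)%N - xs n)))))) <=
      l * (expR (- l * d) * Kd).
    by rewrite ler_wpM2l ?(ltW l0) // ler_wpM2l ?expR_ge0.
  by lra.
(* For fixed [l] the observed resolvent is bounded, so [k] may tend to infinity. *)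
have lim : rnorm (l%:C *: Cob (resolvent B l%:C (S t (x - xs n)))) <= 5 * e'.
  rewrite rnormZr gtr0_norm //.
  apply: (@le_epsM _ _ _ (l * (Kb * (4 * N + 1) * N))) => h h0; have [k hk] := txs h h0.
  have -> : Cob (resolvent B l%:C (S t (x - xs n))) =
    Cob (resolvent B l%:C (S t (xs (n + k)%N - xs n))) - Cob (resolvent B l%:C (S t (xs (n + k)%N - x))).
    rewrite -(obsB hS hB Clin) // -(linfB lQ) -(linfB (C0_lin hS t0')); congr (Cob (resolvent _ _ (S _ _))).
    by lmod.
  apply: le_trans (ler_wpM2l (ltW l0) (rnormB _ _)) _; rewrite mulrDr lerD //.
  rewrite -mulrA ler_wpM2l ?(ltW l0) //.
  rewrite (le_trans (obs_resolvent_bound cV hS hB N0 hN Kb0 Cb _ hl)) // -!mulrA ler_wpM2l // ler_wpM2l //.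
    by rewrite addr_ge0 // mulr_ge0.
  by rewrite (le_trans (S_contr _ t0')) // ler_wpM2l // hk // leq_addl.
have -> : l%:C *: Cob (resolvent B l%:C (S t x)) - y =
    l%:C *: Cob (resolvent B l%:C (S t (x - xs n))) +
    (l%:C *: Cob (resolvent B l%:C (S t (xs n))) - Cob (S t (xs n))) + (Cob (S t (xs n)) - y).
  rewrite (linfB (C0_lin hS t0')) (linfB lQ) (obsB hS hB Clin) //; lmod.
rewrite (le_trans (rnormD _ _)) // (le_trans (lerD (rnormD _ _) (lexx _))) //.
rewrite (le_trans (lerD (lerD lim hL2) hn1)) //.
by rewrite /e'; lra.
Qed.

End OutputAlmostEverywhere.

(** * Square integrability of almost everywhere limits *)

Section SquareIntegrable.
Context {R : realType}.
Local Notation C := R[i].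
Local Notation mu := (@lebesgue_measure R).
Context {V : normedModType C}.

Lemma simple_function0 : simple_function (fun _ : R => 0 : V).
Proof.
split; first by apply: sub_finite_set (finite_set1 (0 : V)) => _ [t _ <-].
by move=> y; rewrite preimage_cst; case: ifP => _; [exact: measurableT|exact: measurable0].
Qed.

Lemma simple_function_paste (s : R -> V) (I : interval R) (y : V) : simple_function s ->
  simple_function (fun t => if t \in I then y else s t).
Proof.
move=> [fs ms]; split.
  have fy : finite_set ([set y] `|` range s) by rewrite finite_setU.
  apply: sub_finite_set fy => _ [t _ <-].
  by case: ifP => _; [left|right; exists t].
move=> z; have mI : measurable ([set` I] : set (measurableTypeR R)) by exact: measurable_itv.
have -> : (fun t => if t \in I then y else s t) @^-1` [set z] =
    ([set` I] `&` (fun _ => y) @^-1` [set z]) `|` (s @^-1` [set z] `\` [set` I]).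
  apply/seteqP; split => t /=; case: (boolP (t \in I)) => tI.
  - by move=> yz; left.
  - by move=> sz; right.
  - by case=> [[]|[_ []]].
  - by case=> [[]|[]].
apply: measurableU; first apply: measurableI => //.
  by rewrite preimage_cst; case: ifP => _; [exact: measurableT|exact: measurable0].
exact: measurableD.
Qed.

Lemma simple_approx (f : R -> V) (n : nat) (e : R) : cont_on `[0, +oo[ f -> 0 < e ->
  exists2 s, simple_function s & forall t, 0 <= t -> t < n%:R -> rnorm (s t - f t) <= e.
Proof.
move=> cf e0; have cfn : cont_on `[0, n%:R] f.
  by apply: cont_onS cf => t /=; rewrite !in_itv /= => /andP[-> _].
have [d d0 hd] := unif_cont (ler0n R n) cfn e0.
pose h := d / 2; have h0 : 0 < h by rewrite divr_gt0.
have [k0 /(_ _ (leqnn _)) nK] := archi_lt (n%:R / h); set K := k0.+1 in nK.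
have {}nK : n%:R < K%:R * h by rewrite -ltr_pdivrMr.
suff [s ss hs] : exists2 s, simple_function s & forall t, 0 <= t -> t < n%:R -> t < K%:R * h ->
    rnorm (s t - f t) <= e.
  by exists s => // t t0 tn; apply: hs => //; exact: lt_trans nK.
elim: (K) => [|k [s ss hs]].
  by exists (fun _ => 0); [exact: simple_function0|move=> t t0 _; rewrite mul0r ltNge t0].
exists (fun t => if t \in `[k%:R * h, k.+1%:R * h[ then f (k%:R * h) else s t).
  exact: simple_function_paste.
move=> t t0 tn tk; rewrite in_itv /= tk andbT; case: (lerP (k%:R * h) t) => kt; last exact: hs.
have kh0 : 0 <= k%:R * h by rewrite mulr_ge0 ?ler0n // ltW.
apply: hd; rewrite ?kh0 ?t0 ?(ltW tn) ?(le_trans kt (ltW tn)) //.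
rewrite distrC ger0_norm ?subr_ge0 //.
have : t - k%:R * h < h by rewrite ltrBlDl (lt_le_trans tk) // mulrSr mulrDl mul1r.
by move/lt_trans; apply; rewrite /h ltr_pdivrMr // ltr_pMr // ltr1n.
Qed.

Import HBNNSimple.

(* [f] may be non-measurable: its integral is still the supremum of those of
   the simple functions below it. *)
Lemma ae_le_integral_bound (f G : R -> \bar R) (D : set R) (c : R) :
  measurable (D : set (measurableTypeR R)) ->
  measurable_fun (D : set (measurableTypeR R)) G ->
  (forall t, D t -> 0 <= f t)%E -> (forall t, D t -> 0 <= G t)%E ->
  {ae mu, forall t, D t -> f t <= G t}%E ->
  (\int[mu]_(t in D) G t <= c%:E)%E -> (\int[mu]_(t in D) f t <= c%:E)%E.
Proof.
move=> mD mG f0 G0 fG Gc; rewrite integral_mkcond ge0_integralTE; last first.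
  by move=> t; rewrite patchE; case: ifPn => // /set_mem /f0.
apply: ge_ereal_sup => _ [h hf <-].
have hN t : ~ D t -> h t = 0.
  move=> nD; apply/eqP; rewrite eq_le fun_ge0 andbT -lee_fin (le_trans (hf t)) //.
  by rewrite patchE memNset.
have -> : sintegral mu h = (\int[mu]_(t in D) (h t)%:E)%E.
  rewrite -integralT_nnsfun [RHS]integral_mkcond; apply: eq_integral => t _.
  by rewrite patchE; case: ifPn => // /negP nD; rewrite hN // => Dt; apply: nD; exact/mem_set.
apply: le_trans Gc; apply: ae_ge0_le_integral => //.
- by move=> t _; rewrite lee_fin.
- by apply/measurable_EFinP; exact: measurable_funTS.
apply: (@filterS _ _ (ae_filter_ringOfSetsType _)) fG => t tG Dt.
apply: le_trans (tG Dt); apply: le_trans (hf t) _.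
by rewrite patchE mem_set.
Qed.

Lemma limn_einf_le (u : nat -> \bar R) (c : \bar R) : (forall n, u n <= c)%E -> (limn_einf u <= c)%E.
Proof.
move=> uc; rewrite limn_einf_lim; apply: lime_le; first exact: is_cvg_einfs.
by apply: nearW => n; apply: le_trans (uc n); apply: ereal_inf_lbound; exists n => /=.
Qed.

Lemma tends_cvg (u : nat -> V) (x : V) : tends u x -> u n @[n --> \oo] --> x.
Proof.
move=> ux; apply/cvgrPdist_le => e e0; have [-> e'0] := posc_real e0.
have [N hN] := ux _ e'0; exists N => // n /= /hN h.
by rewrite normE lecR rnorm_distC.
Qed.

Lemma tends_rnorm (u : nat -> V) (x : V) : tends u x -> rnorm (u n) @[n --> \oo] --> rnorm x.
Proof.
move=> ux; apply/cvgrPdist_le => e e0; have [N hN] := ux _ e0; exists N => // n /= /hN h.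
have h1 := rnorm_dist_ge (u n) x; have h2 := rnorm_dist_ge x (u n).
by rewrite rnorm_distC in h2; rewrite ler_norml; lra.
Qed.

(** Fatou's lemma bounds the lower limit [G] of the squares. [G] is measurable and agrees with
    [|f|^2] almost everywhere on the half-line, which is enough for [ae_le_integral_bound]. *)
Lemma limit_in_L2_pos (F : nat -> R -> V) (f : R -> V) (D : set R) (c : R) :
  (forall n, cont_on `[0, +oo[ (F n)) ->
  (forall n (b : R), 0 <= b -> prim (fun t : R => rnorm (F n (Num.max 0 t)) ^+ 2) b -
     prim (fun t : R => rnorm (F n (Num.max 0 t)) ^+ 2) 0 <= c) ->
  {ae mu, forall t, 0 < t -> D t /\ tends (fun n => F n t) (f t)} ->
  in_L2_pos D f.
Proof.
move=> cF Fc lim; have ae_F := ae_filter_ringOfSetsType mu.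
pose F2 n (t : R) := rnorm (F n (Num.max 0 t)) ^+ 2.
have cF2 n : continuous (F2 n) by apply: cont_sqr; exact: cont_rnorm_max0.
split.
- by apply: (@filterS _ _ ae_F) lim => t h /h[].
- have ex n : exists s, simple_function s /\
      forall t, 0 <= t -> t < n%:R -> rnorm (s t - F n t) <= (2 ^+ n)^-1.
    have p0 : 0 < (2 ^+ n)^-1 :> R by rewrite invr_gt0 expn2_gt0.
    by have [s ss hs] := simple_approx n (cF n) p0; exists s.
  have [s hs] := choice ex.
  exists s; split => [n|]; first exact: (hs n).1.
  apply: (@filterS _ _ ae_F) lim => t h t0; have [_ {}h] := h t0.
  apply: tends_cvg => e e0; have e2 : 0 < e / 2 by rewrite divr_gt0.
  have [N1 h1] := h _ e2; have [N2 h2] := expn2_small e2; have [N3 h3] := archi_lt t.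
  exists (maxn N1 (maxn N2 N3.+1)) => n; rewrite !geq_max => /and3P[/h1 {}h1 /h2 {}h2 N3n].
  have tn : t < n%:R by case: n N3n {h1 h2} => // n; exact: h3.
  have := (hs n).2 t (ltW t0) tn.
  by have := rnorm_triangle (s n t) (F n t) (f t); lra.
- pose G t := limn_einf (fun n => (F2 n t)%:E).
  have mF n (D' : set R) : measurable_fun (D' : set (measurableTypeR R)) (fun t => (F2 n t)%:E).
    by apply/measurable_EFinP; apply: measurable_funTS; exact: continuous_measurable_fun.
  have m0 : measurable (`]0%R, +oo[%classic : set (measurableTypeR R)) by exact: measurable_itv.
  apply: (@le_lt_trans _ _ c%:E); last exact: ltry.
  apply: (@ae_le_integral_bound _ G) => //.
  + rewrite /G /limn_einf; apply: measurableT_comp => //.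
    by apply: measurable_fun_limn_esup => n; apply: measurableT_comp.
  + by move=> t _; rewrite lee_fin sqr_ge0.
  + move=> t _; rewrite /G limn_einf_lim; apply: lime_ge; first exact: is_cvg_einfs.
    by apply: nearW => n; apply: le_ereal_inf_tmp => _ [m _ <-]; rewrite lee_fin sqr_ge0.
  + apply: (@filterS _ _ ae_F) lim => t h; rewrite /= in_itv /= andbT => t0; have [_ {}h] := h t0.
    have cv : (F2 n t)%:E @[n --> \oo] --> (rnorm (f t) ^+ 2)%:E.
      apply: cvg_EFin; first by apply: nearW.
      rewrite (_ : fine \o _ = fun n => rnorm (F n t) ^+ 2); last first.
        by apply/funext => n; rewrite /= /F2 max0l // ltW.
      by have h2 := tends_rnorm h; under eq_fun do rewrite expr2; rewrite expr2; exact: cvgM.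
    rewrite /G is_cvg_limn_einfE; last by apply/cvg_ex; eexists; exact: cv.
    by rewrite (cvg_lim _ cv).
  + apply: le_trans (fatou _ _ _ _) _ => //; first by move=> n t _; rewrite lee_fin sqr_ge0.
    apply: limn_einf_le => n.
    have bnd := integral_halfline_le (cF2 n) (fun t => sqr_ge0 _) (Fc n).
    apply: le_trans bnd; apply: ge0_subset_integral => //.
    * by move=> t _; rewrite lee_fin sqr_ge0.
    * by move=> t /=; rewrite !in_itv /= !andbT; exact: ltW.
Qed.

End SquareIntegrable.

(** * Output feedback around an admissible observation *)

Section ObservedPerturbation.
Context {R : realType}.
Local Notation C := R[i].
Context {X Y V : normedModType C} (cX : complete_rn X) (cY : complete_rn Y) (cV : complete_rn V).
Context {T : R -> X -> X} {A : unbounded_op X X}.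
Hypothesis hT : C0_semigroup T.
Hypothesis hA : generator_of A T.
Context {M w : R}.
Hypothesis M0 : 0 <= M.
Hypothesis hM : exp_bounded T M w.
Context {Cop : unbounded_op X Y} {Kc : R}.
Hypothesis Clin : forall (a : C) x y, dom A x -> dom A y ->
  Cop (a *: x + y) = a *: Cop x + Cop y.
Hypothesis Kc0 : 0 <= Kc.
Hypothesis Cb : forall x, dom A x -> rnorm (Cop x) <= Kc * (rnorm x + rnorm (A x)).
Context {tau K2 : R}.
Hypothesis tau0 : 0 < tau.
Hypothesis K20 : 0 <= K2.
Hypothesis adm : forall x, dom A x -> prim (@obs2 _ _ _ T Cop x) tau - prim (@obs2 _ _ _ T Cop x) 0 <= K2 * rnorm x ^+ 2.
Context {S : R -> V -> V} {B : unbounded_op V V}.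
Hypothesis hS : C0_semigroup S.
Hypothesis hB : generator_of B S.
Context {N om : R}.
Hypothesis N0 : 0 <= N.
Hypothesis om0 : 0 < om.
Hypothesis hN : exp_bounded S N (- om).
Context {pr : V -> X} {L1 : Y -> X} {L2 : V -> X} {L3 : V -> Y} {Kb : R}.
Hypothesis pilin : linear pr.
Hypothesis pib : forall v, rnorm (pr v) <= rnorm v.
Hypothesis L1b : bounded_linear L1.
Hypothesis L2b : bounded_linear L2.
Hypothesis L3b : bounded_linear L3.
Hypothesis pidom : forall v, dom B v -> dom A (pr v).
Hypothesis piB : forall v, dom B v -> pr (B v) = A (pr v) + L1 (Cop (pr v)) + L2 v.
Hypothesis Kb0 : 0 <= Kb.
Hypothesis piC : forall v, dom B v -> rnorm (Cop (pr v)) <= Kb * (rnorm v + rnorm (B v)).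
Local Notation mu := (@lebesgue_measure R).
Local Notation pos := (`[0, +oo[%classic : set R).
Local Notation CV := (fun v => Cop (pr v)).

Lemma piClin (a : C) x y : dom B x -> dom B y -> CV (a *: x + y) = a *: CV x + CV y.
Proof. by move=> dx dy /=; rewrite pilin Clin //; exact: pidom. Qed.

(** For [u = l R(l, B) z], projecting the resolvent equation gives
    [(l - A) pr u = l pr z + L1 C pr u + L2 u]. Hence [C pr u] and [l C R(l, A) pr z] differ by
    [C R(l, A)] applied to a convergent vector, and this tends to 0. *)
Lemma lambda_transfer z y :
  tends_infty (fun l => l%:C *: CV (resolvent B l%:C z)) y ->
  tends_infty (fun l => l%:C *: Cop (resolvent A l%:C (pr z))) y.
Proof.
move=> h e e0; have [lL1 _] := L1b; have [lL2 _] := L2b.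
have [l1 l10 hl1] := bounded_linear_ge0 L1b; have [l2 l20 hl2] := bounded_linear_ge0 L2b.
set Kd := Kc * (4 * M + 1); have Kd0 : 0 <= Kd by rewrite mulr_ge0 // addr_ge0 // mulr_ge0.
have q0 : 0 < 3 * (Kd * (l1 + l2) + 1) by rewrite mulr_gt0 // ltr_wpDl // mulr_ge0 // addr_ge0.
have e3 : 0 < e / 3 by rewrite divr_gt0.
pose e' := Num.min (e / 3) (e / (3 * (Kd * (l1 + l2) + 1))).
have e'0 : 0 < e' by rewrite lt_min e3 divr_gt0.
have [La ha] := h _ e'0; have [Lb hb] := resolvent_approx cV hS hB N0 hN z e'0.
pose F := L1 y + L2 z; have [Lc hc] := obs_resolvent_small cX hT hA M0 hM Clin Kc0 Cb F e3.
exists (Num.max (2 * `|w| + 1) (Num.max (2 * `|- om| + 1) (Num.max La (Num.max Lb Lc)))) => l.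
rewrite !ge_max => /andP[hl /andP[hl' /andP[/ha {}ha /andP[/hb {}hb /hc {}hc]]]].
have [_ wl] := large_real hl; have [_ ol] := large_real hl'.
have [dv ev] := resolventP cV hS hB N0 hN ol z; set v := resolvent B l%:C z in ha hb dv ev.
have lQ := resolvent_linear cX hT hA M0 hM wl.
have dQ x := (resolventP cX hT hA M0 hM wl x).1.
have [dlv elv] := dom_generatorZ hS hB l%:C dv.
set u := l%:C *: v in hb dlv elv.
have CVu : CV u = l%:C *: CV v by rewrite /u (linfZ pilin) (obsZ hT hA Clin) //; exact: pidom.
pose Fl := L1 (CV u) + L2 u.
have eu : l%:C *: pr u - A (pr u) = l%:C *: pr z + Fl.
  have e1 : pr (l%:C *: u - B u) = l%:C *: pr z.
    by rewrite elv -(linfZ pilin) -[in RHS]ev /u; congr pr; lmod.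
  rewrite -e1 (linfB pilin) (linfZ pilin l%:C u) (piB dlv) /Fl /=; lmod.
have := resolvent_unique cX hT hA M0 hM wl (pidom dlv) eu.
rewrite (linfD lQ) (linfZ lQ) => e2.
have e4 : CV u = l%:C *: Cop (resolvent A l%:C (pr z)) + Cop (resolvent A l%:C Fl).
  by rewrite -(Clin _ (dQ _) (dQ _)) e2.
have nF : rnorm (Fl - F) <= (l1 + l2) * e'.
  have -> : Fl - F = L1 (CV u - y) + L2 (u - z) by rewrite (linfB lL1) (linfB lL2) /F /Fl; lmod.
  rewrite (le_trans (rnormD _ _)) // mulrDl lerD //.
    by rewrite (le_trans (hl1 _)) // ler_wpM2l // CVu.
  by rewrite (le_trans (hl2 _)) // ler_wpM2l.
have -> : l%:C *: Cop (resolvent A l%:C (pr z)) - y =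
   (l%:C *: CV v - y) - Cop (resolvent A l%:C (Fl - F)) - Cop (resolvent A l%:C F).
  rewrite -CVu e4 (linfB lQ) (obsB hT hA Clin) //; lmod.
have b2 := obs_resolvent_bound cX hT hA M0 hM Kc0 Cb (Fl - F) hl.
have b3 : Kd * rnorm (Fl - F) <= e / 3.
  rewrite (le_trans (ler_wpM2l Kd0 nF)) // mulrA.
  have : e' <= e / (3 * (Kd * (l1 + l2) + 1)) by rewrite ge_min lexx orbT.
  rewrite ler_pdivlMr // => hh.
  by rewrite ler_pdivlMr //; have := ltW e'0; nra.
rewrite (le_trans (rnormB _ _)) // (le_trans (lerD (rnormB _ _) (lexx _))) //.
have : e' <= e / 3 by rewrite ge_min lexx.
move: b2 b3 ha hc; rewrite -/Kd; lra.
Qed.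

(** The exponential weight is absorbed into the trajectory [x s = exp(om s / 2) pr (S s v)], which
    solves [x' = A x + f] with an admissible forcing, so [trajectory_observed] applies directly. *)
Lemma perturbed_admissible : exists2 c : R, 0 <= c & forall v, dom B v -> forall t, 0 <= t ->
  prim (fun s => expR (om * s) * @obs2 _ _ _ S CV v s) t -
  prim (fun s => expR (om * s) * @obs2 _ _ _ S CV v s) 0 <= c * rnorm v ^+ 2.
Proof.
have [lL1 _] := L1b; have [lL2 _] := L2b.
have [l1 l10 hl1] := bounded_linear_ge0 L1b; have [l2 l20 hl2] := bounded_linear_ge0 L2b.
(* The weighted orbit still decays at rate [om / 2]; its square is bounded by [q], whose integral is
   finite. *)
pose al := om / 2; have al0 : 0 < al by rewrite divr_gt0.
(* The factor 3 here and in [cm] comes from squaring a sum of three terms: the drift of the weight,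
   [L1] of the output, and [L2] of the state. *)
pose b := 3 * l1 ^+ 2; have b0 : 0 <= b by rewrite mulr_ge0 // sqr_ge0.
pose cm := 3 * (al ^+ 2 + l2 ^+ 2).
have cm0 : 0 <= cm by rewrite mulr_ge0 // addr_ge0 // sqr_ge0.
pose c0 := ((2 * K2 * b + 1) * K2 + K2 / tau) + K2 * cm.
have c00 : 0 <= c0.
  have ti : 0 <= tau^-1 by rewrite invr_ge0 ltW.
  apply: addr_ge0; last exact: mulr_ge0.
  by apply: addr_ge0; apply: mulr_ge0 => //; apply: addr_ge0 => //; rewrite !mulr_ge0.
exists (2 * (K2 + c0 * N ^+ 2 / om)).
  by rewrite mulr_ge0 // addr_ge0 // divr_ge0 ?mulr_ge0 ?sqr_ge0 // ltW.
move=> v dv t t0.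
pose q s := N ^+ 2 * rnorm v ^+ 2 * expR (- om * s).
have q0 s : 0 <= q s by rewrite mulr_ge0 ?expR_ge0 // mulr_ge0 ?sqr_ge0.
pose x s := (expR (al * s))%:C *: pr (S s v).
pose f s := al%:C *: x s + (expR (al * s))%:C *: L1 (CV (S s v)) + (expR (al * s))%:C *: L2 (S s v).
pose m s := cm * q s.
have m0 s : 0 <= m s by rewrite mulr_ge0.
have mc : continuous m.
  by apply: contM; [exact: cont_cst|apply: contM; [exact: cont_cst|exact: cont_expM]].
have dS s : 0 <= s -> dom B (S s v) by move=> s0; exact: (generator_orbit hS hB dv s0).1.
have xA s : 0 <= s -> dom A (x s).
  by move=> s0; apply: (dom_generatorZ hT hA _ _).1; apply: pidom; exact: dS.
have eE s : expR (al * s) * (N * expR (- om * s) * rnorm v) = N * rnorm v * expR (- al * s).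
  have -> : - om * s = - (al * s) + (- al * s) by rewrite /al; field.
  by rewrite expRD expRN; field; rewrite lt0r_neq0 // expR_gt0.
have qE s : (N * rnorm v * expR (- al * s)) ^+ 2 = q s.
  by rewrite /q !exprMn; congr (_ * _); rewrite expr2 -expRD; congr expR; rewrite /al; field.
have nx s : 0 <= s -> rnorm (x s) ^+ 2 <= q s.
  move=> s0; rewrite -qE ler_sqr ?nnegrE ?rnorm_ge0 //; last first.
    by rewrite mulr_ge0 ?expR_ge0 // mulr_ge0 // rnorm_ge0.
  rewrite /x rnormZr ger0_norm ?expR_ge0 // -eE ler_wpM2l ?expR_ge0 //.
  by rewrite (le_trans (pib _)) // hN.
have Cx s : 0 <= s -> Cop (x s) = (expR (al * s))%:C *: CV (S s v).
  by move=> s0; rewrite /x (obsZ hT hA Clin) //; apply: pidom; exact: dS.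
have xd : deriv_on pos x (fun t => A (x t) + f t).
  move=> s Ds; have s0 := (posP s).1 Ds.
  have da : is_derive s 1 (fun s => expR (al * s)) (1 * (al * expR (al * s))).
    by have := is_derive_expM 1 al s; under eq_fun do rewrite mul1r.
  have bpi : bounded_linear pr by split => //; exists 1 => u; rewrite mul1r.
  have h := deriv_at_scal Ds (deriv_at_real _ da) (deriv_atL bpi (orbit_deriv hS hB hN dv Ds)).
  apply: deriv_at_eq h _; rewrite /= -(generator_orbit hS hB dv s0).2 (piB (dS s s0)).
  rewrite {1}/x (dom_generatorZ hT hA _ (pidom (dS s s0))).2 /f /x; lmod.
have cCV := obs_cont hS hB hN piClin Kb0 piC dv.
have xC : cont_on pos (fun t => Cop (x t)).
  apply: (cont_on_ext (g := fun s => (expR (al * s))%:C *: CV (S s v))).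
    by move=> s /posP; exact: Cx.
  by apply: cont_onZ; [apply: cont_on_real; exact: cont_expM|exact: cCV].
have fb s : 0 <= s -> rnorm (f s) ^+ 2 <= b * rnorm (Cop (x s)) ^+ 2 + m s.
  move=> s0; set a1 := al * rnorm (x s); set a2 := l1 * rnorm (Cop (x s)).
  set a3 := l2 * (N * rnorm v * expR (- al * s)).
  have h1 : rnorm (f s) <= a1 + a2 + a3.
    rewrite /f (le_trans (rnormD _ _)) // lerD //.
      rewrite (le_trans (rnormD _ _)) // lerD //.
        by rewrite (rnormZr al) gtr0_norm.
      by rewrite /a2 Cx // -(linfZ lL1); exact: hl1.
    rewrite /a3 rnormZr ger0_norm ?expR_ge0 // -eE mulrCA ler_wpM2l ?expR_ge0 //.
    by rewrite (le_trans (hl2 _)) // ler_wpM2l // hN.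
  have h2 := nx s s0; have h3 := qE s.
  have h4 : rnorm (f s) ^+ 2 <= (a1 + a2 + a3) ^+ 2.
    by rewrite ler_sqr ?nnegrE ?rnorm_ge0 // (le_trans (rnorm_ge0 _) h1).
  apply: le_trans h4 _.
  have h5 : (a1 + a2 + a3) ^+ 2 <= 3 * (a1 ^+ 2 + a2 ^+ 2 + a3 ^+ 2).
    by have := sqr_ge0 (a1 - a2); have := sqr_ge0 (a2 - a3); have := sqr_ge0 (a1 - a3); nra.
  have g1 : a1 ^+ 2 = al ^+ 2 * rnorm (x s) ^+ 2 by rewrite [LHS]exprMn.
  have g2 : a2 ^+ 2 = l1 ^+ 2 * rnorm (Cop (x s)) ^+ 2 by rewrite [LHS]exprMn.
  have g3 : a3 ^+ 2 = l2 ^+ 2 * q s by rewrite [LHS]exprMn h3.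
  apply: le_trans h5 _; rewrite g1 g2 g3 /m /b /cm.
  have : al ^+ 2 * rnorm (x s) ^+ 2 <= al ^+ 2 * q s by rewrite ler_wpM2l // sqr_ge0.
  by lra.
pose psi' (s : R) := rnorm (Cop (x (Num.max 0 s))) ^+ 2.
pose gam' (s : R) := ((2 * K2 * b + 1) * K2 + K2 / tau) * rnorm (x (Num.max 0 s)) ^+ 2 + K2 * m s.
have main : 2^-1 * (prim psi' t - prim psi' 0) <= K2 * rnorm (x 0) ^+ 2 + (prim gam' t - prim gam' 0).
  exact: (trajectory_observed hT hA hM Clin Kc0 Cb tau0 K20 adm b0 m0 mc xA xd xC fb t0).
have h0 : x 0 = pr v by rewrite /x mulr0 expR0 scale1r (C0_0 hS).
rewrite h0 in main.
have nv : rnorm (pr v) ^+ 2 <= rnorm v ^+ 2 by rewrite ler_sqr ?nnegrE ?rnorm_ge0.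
have cpsi : continuous psi' := cont_sqr (cont_rnorm_max0 xC).
have cobs := @obs2_cont _ _ _ _ _ hS hB _ _ hN _ _ piClin Kb0 piC v dv.
have le1 : prim (fun s => expR (om * s) * @obs2 _ _ _ S CV v s) t -
   prim (fun s => expR (om * s) * @obs2 _ _ _ S CV v s) 0 <= prim psi' t - prim psi' 0.
  have cw : continuous (fun s : R => expR (om * s) * @obs2 _ _ _ S CV v s).
    by apply: contM; [exact: cont_expM|exact: cobs].
  apply: (prim_le cw cpsi (lexx 0) t0).
  move=> s /andP[s0 _]; rewrite /obs2 /psi' max0l // Cx // rnormZr ger0_norm ?expR_ge0 // exprMn.
  by apply: eq_lerR; congr (_ * _); rewrite expr2 -expRD; congr expR; rewrite /al; field.
have cxi : continuous (fun s : R => rnorm (x (Num.max 0 s)) ^+ 2).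
  exact: cont_sqr (cont_rnorm_max0 (deriv_on_cont xd)).
have cgam : continuous gam' by apply: contD; apply: contM => //; exact: cont_cst.
have le2 : prim gam' t - prim gam' 0 <= c0 * N ^+ 2 / om * rnorm v ^+ 2.
  pose Q s := - (c0 * N ^+ 2 / om * rnorm v ^+ 2) * expR (- om * s).
  have := @deriv_le _ (prim gam') Q gam' _ 0 t t0 (fun s hs => prim_deriv cgam (proj1 (andP hs)))
     (fun s _ => is_derive_expM (- (c0 * N ^+ 2 / om * rnorm v ^+ 2)) (- om) s).
  move=> h; apply: le_trans (h _) _.
    move=> s /andP[s0 _]; rewrite /gam' max0l //.
    apply: (@le_trans _ _ (c0 * q s)); last first.
      by apply: eq_lerR; rewrite /q; field; exact: lt0r_neq0.
    have -> : c0 * q s = ((2 * K2 * b + 1) * K2 + K2 / tau) * q s + K2 * m s by rewrite /c0 /m; ring.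
    rewrite lerD2r.
    rewrite ler_wpM2l ?nx // addr_ge0 //; last by rewrite divr_ge0 // ltW.
    by apply: mulr_ge0 => //; rewrite addr_ge0 // !mulr_ge0.
  rewrite /Q mulr0 expR0 mulr1 mulNr opprK addrC gerBl.
  by rewrite mulr_ge0 ?expR_ge0 // mulr_ge0 ?sqr_ge0 // divr_ge0 ?mulr_ge0 ?sqr_ge0 // ltW.
have K2n := ler_wpM2l K20 nv.
apply: le_trans le1 _; move: main le2 K2n.
by rewrite [2 * (_ + _)]mulrDr [(_ + _) * rnorm v ^+ 2]mulrDl; lra.
Qed.

Lemma lambda_extP x y :
  tends_infty (fun l => l%:C *: Cop (resolvent A l%:C x)) y ->
  dom (lambda_ext A Cop) x /\ lambda_ext A Cop x = y.
Proof.
move=> h; have cv : l%:C *: Cop (resolvent A l%:C x) @[l --> (+oo : set_system R)] --> y.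
  apply/cvgrPdist_le => e e0; have [-> e'0] := posc_real e0; have [L hL] := h _ e'0.
  exists L; split; first exact: num_real.
  by move=> l /ltW/hL hl; rewrite normE lecR rnorm_distC.
by split; [apply/cvg_ex; exists y|exact: cvg_lim cv].
Qed.

Lemma lambda_ext_id x : dom A x -> dom (lambda_ext A Cop) x /\ lambda_ext A Cop x = Cop x.
Proof.
move=> dx; apply: lambda_extP => e e0.
exact: (obs_resolvent_approx cX hT hA M0 hM Clin Kc0 Cb dx e0).
Qed.

(** [D] and [f] are constrained only at times where the Lambda-limit exists. This allows [D] to be
    the domain condition on the full state, which differs from the transient by an element of
    [D(A)]. *)
Lemma weighted_output_L2 x (D : set R) (f : R -> Y) :
  (forall t, 0 < t -> dom (lambda_ext A Cop) (pr (S t x)) -> D t /\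
     f t = (expR (om / 2 * t))%:C *: (lambda_ext A Cop (pr (S t x)) + L3 (S t x))) ->
  in_L2_pos D f.
Proof.
move=> Df.
have [c c0 hc] := perturbed_admissible.
have CVlin := piClin.
have [xs [dxs txs ae_lim]] := output_ae cV cY hS hB N0 om0 hN CVlin Kb0 piC c0 hc x.
have [bx bx0 hbx] := tends_bounded txs.
have [l3 l30 hl3] := bounded_linear_ge0 L3b.
pose F n t := (expR (om / 2 * t))%:C *: (Cop (pr (S t (xs n))) + L3 (S t (xs n))).
pose W n (s : R) := expR (om * s) * @obs2 _ _ _ S (fun v => Cop (pr v)) (xs n) s.
have cF n : cont_on `[0, +oo[ (F n).
  apply: cont_onZ; first by apply: cont_on_real; exact: cont_expM.
  apply: cont_onD; first exact: (obs_cont hS hB hN CVlin Kb0 piC (dxs n)).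
  apply: (cont_onL L3b); exact: (orbit_cont hS hN (xs n)).
have cW n : continuous (W n).
  by apply: contM; [exact: cont_expM|exact: (obs2_cont hS hB hN CVlin Kb0 piC (dxs n))].
(* The [L3] part squared decays like [exp(- 2 om t)]; against the weight [exp(om t)] it leaves
   [k exp(- om t)], with integral at most [k / om]. *)
pose k := 2 * l3 ^+ 2 * N ^+ 2 * bx ^+ 2.
have k0 : 0 <= k by rewrite !mulr_ge0 ?sqr_ge0.
apply: (@limit_in_L2_pos _ _ F _ _ (2 * (c * bx ^+ 2) + k / om)) => // [n b b0|].
  pose G (t : R) := 2 * prim (W n) t + (- (k / om)) * expR (- om * t).
  have cFn := cont_sqr (cont_rnorm_max0 (cF n)).
  have mono := @deriv_le R (prim (fun t : R => rnorm (F n (Num.max 0 t)) ^+ 2)) G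
    (fun t : R => rnorm (F n (Num.max 0 t)) ^+ 2) (fun t => 2 * W n t + k * expR (- om * t)) 0 b b0.
  apply: le_trans (mono _ _ _) _.
  - by move=> t /andP[t0 _]; exact: prim_deriv.
  - move=> t /andP[t0 _]; have h1 := prim_deriv (cW n) t0.
    have h2 := is_derive_expM (- (k / om)) (- om) t.
    apply: (@is_derive_eq _ _ _ _ _ _ _ _ (is_deriveD (is_deriveZ 2 h1) h2)).
    by rewrite /GRing.scale /=; field; rewrite lt0r_neq0.
  - move=> t /andP[t0 _]; rewrite max0l // /F /W /obs2 max0l // rnormZr ger0_norm ?expR_ge0 // exprMn.
    have -> : expR (om / 2 * t) ^+ 2 = expR (om * t).
      by rewrite expr2 -expRD; congr expR; field.
    set a := Cop _; set d := L3 _; set E := expR (om * t); have E0 : 0 < E by exact: expR_gt0.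
    have Ei : expR (- om * t) = E^-1 by rewrite mulNr expRN.
    have hd : rnorm d <= l3 * (N * E^-1 * bx).
      rewrite (le_trans (hl3 _)) // ler_wpM2l // (le_trans (hN _ t0)) // -Ei ler_wpM2l //.
      by rewrite mulr_ge0 ?expR_ge0.
    have hd2 : rnorm d ^+ 2 <= (l3 * (N * E^-1 * bx)) ^+ 2.
      by rewrite ler_sqr ?nnegrE ?rnorm_ge0 // (le_trans (rnorm_ge0 d)).
    have had : rnorm (a + d) ^+ 2 <= 2 * rnorm a ^+ 2 + 2 * rnorm d ^+ 2.
      have := rnormD a d; have := rnorm_ge0 (a + d); have := sqr_ge0 (rnorm a - rnorm d).
      by rewrite !expr2; nra.
    apply: (@le_trans _ _ (E * (2 * rnorm a ^+ 2 + 2 * (l3 * (N * E^-1 * bx)) ^+ 2))).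
      by rewrite ler_wpM2l ?(ltW E0) // (le_trans had) // lerD2l ler_wpM2l.
    by rewrite Ei /k; apply: eq_lerR; field; rewrite lt0r_neq0.
  have h := hc _ (dxs n) b b0; rewrite -/(W n) in h.
  have nb : c * rnorm (xs n) ^+ 2 <= c * bx ^+ 2.
    by rewrite ler_wpM2l // ler_sqr ?nnegrE ?rnorm_ge0.
  rewrite /G mulr0 expR0 mulr1.
  have : 0 <= k / om * expR (- om * b) by rewrite mulr_ge0 ?expR_ge0 // divr_ge0 // ltW.
  lra.
apply: (@filterS _ _ (ae_filter_ringOfSetsType mu)) ae_lim => t h t0.
have [y [ylim ty]] := h t0.
have [dL eL] := lambda_extP (lambda_transfer ylim).
have [Dt ->] := Df t t0 dL; split => //; rewrite eL.
have [l hl] : exists l : R, 0 < l /\ expR (om / 2 * t) * (1 + l3 * N) <= l.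
  exists (expR (om / 2 * t) * (1 + l3 * N) + 1); split; last by rewrite lerDl.
  by rewrite ltr_wpDl // mulr_ge0 ?expR_ge0 // addr_ge0 // mulr_ge0.
have [l0 hle] := hl => e e0; have el : 0 < e / l by rewrite divr_gt0.
have [n1 h1] := ty _ el; have [n2 h2] := txs _ el.
exists (maxn n1 n2) => n; rewrite geq_max => /andP[/h1 {}h1 /h2 {}h2].
rewrite /F -scalerBr rnormZr ger0_norm ?expR_ge0 //.
have -> : Cop (pr (S t (xs n))) + L3 (S t (xs n)) - (y + L3 (S t x)) =
    (Cop (pr (S t (xs n))) - y) + L3 (S t (xs n - x)).
  rewrite (linfB (C0_lin hS (ltW t0))) (linfB L3b.1); lmod.
have h3 : rnorm (L3 (S t (xs n - x))) <= l3 * N * (e / l).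
  rewrite (le_trans (hl3 _)) // -mulrA ler_wpM2l // (le_trans (S_contr N0 om0 hN _ (ltW t0))) //.
  by rewrite ler_wpM2l.
apply: (@le_trans _ _ (expR (om / 2 * t) * ((1 + l3 * N) * (e / l)))).
  by rewrite ler_wpM2l ?expR_ge0 // (le_trans (rnormD _ _)) // mulrDl mul1r lerD.
rewrite mulrA (le_trans (ler_wpM2r (ltW el) hle)) //.
by apply: eq_lerR; field; rewrite lt0r_neq0.
Qed.

End ObservedPerturbation.

(** * Output regulation *)

Section Exosystem.
Context {R : realType}.
Local Notation C := R[i].
Context {q : nat}.
Local Notation W := ('cV[C]_q : normedModType C).

Lemma rnorm_coord (v : W) i : rnorm (v i 0 : C^o) <= rnorm v.
Proof.
rewrite -lecR -!normE [leRHS]mx_normE.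
rewrite -[leLHS]nngE num_le.
by apply/bigmax_geP; right; exists (i, 0).
Qed.

Lemma row_functional_bounded (psi : 'rV[C]_q) : bounded_linear (fun v : W => (psi *m v) 0 0 : C^o).
Proof.
split=> [a x y|]; first by rewrite mulmxDr -scalemxAr !mxE.
exists (\sum_i rnorm (psi 0 i : C^o)) => v; rewrite mxE mulr_suml.
elim/big_ind2: _ => [|a b c d h1 h2|i _]; first by rewrite rnorm0.
  by rewrite (le_trans (rnormD _ _)) // lerD.
apply: le_trans (ler_wpM2l (rnorm_ge0 (psi 0 i : C^o)) (rnorm_coord v i)).
by rewrite -[psi 0 i * v i 0]/(psi 0 i *: (v i 0 : C^o)) rnormZ.
Qed.

Lemma deriv_at_quotient {V : normedModType C} (F : R -> V) p y :
  (h^-1)%:C *: (F (p + h) - F p) @[h --> within [set h | 0 <= p + h] (0 : R)^'] --> y ->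
  deriv_at `[0, +oo[ F p y.
Proof.
move=> h e e0; have e0c : 0 < e%:C :> C by rewrite ltcR.
have /cvgrPdist_le/(_ _ e0c)/nbhs_ballP[d /= d0 hd] := h; exists d => // u /posP u0 ud.
have [->|up] := eqVneq u p; first by rewrite !subrr scale0r subr0 rnorm0 normr0 mulr0.
have h0 : u - p != 0 by rewrite subr_eq0.
have pu : p + (u - p) = u by rewrite addrC subrK.
have := hd (u - p); rewrite /ball /= sub0r normrN => /(_ ud h0); rewrite pu => /(_ u0).
rewrite normE lecR rnorm_distC => h1.
have -> : F u - F p - (u - p)%:C *: y = (u - p)%:C *: (((u - p)^-1)%:C *: (F u - F p) - y).
  by rewrite [RHS]scalerBr scalerA -rcM divff // scale1r.
by rewrite rnormZr mulrC ler_wpM2r.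
Qed.

Lemma exosystem_deriv (S : 'M[C]_q) v0 (v : R -> W) : exosystem_solution S v0 v ->
  deriv_on `[0, +oo[ v (fun t => S *m v t).
Proof. by move=> [_ h] p /posP p0; apply: deriv_at_quotient; exact: h. Qed.

(** Left eigenvectors for distinct eigenvalues are independent, so the matrix with rows [psi k] is
    invertible; the columns of its inverse are the dual basis and consist of right eigenvectors. *)
Lemma eigenbasis (S : 'M[C]_q) (omega : 'I_q -> R) : simple_imaginary_spectrum S omega ->
  exists psi : 'I_q -> 'rV[C]_q, exists phi : 'I_q -> 'cV[C]_q,
  [/\ forall k, psi k *m S = iomega (omega k) *: psi k,
      forall k, S *m phi k = iomega (omega k) *: phi k
    & forall v : W, v = \sum_k (psi k *m v) 0 0 *: phi k].
Proof.
move=> [om_inj ev _].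
have ex k : exists psi : 'rV[C]_q, psi *m S = iomega (omega k) *: psi /\ psi != 0.
  have /eigenvalueP[psi h1 h2] : eigenvalue S (iomega (omega k)) by apply/ev; exists k.
  by exists psi.
have [psi hpsi] := choice ex; pose Psi := \matrix_k psi k.
have rPsi k : row k Psi = psi k by rewrite rowK.
have io_inj : injective (fun k => iomega (omega k)) by move=> k l [] /om_inj.
have dx : mxdirect (\sum_(k | predT k) eigenspace S (iomega (omega k))).
  by apply: mxdirect_sum_eigenspace => k l _ _; exact: io_inj.
have Psi_unit : Psi \in unitmx.
  rewrite -row_free_unit; apply/inj_row_free => c cPsi.
  have cE k : c 0 k *: psi k = 0.
    have sub0 : ((0 : 'rV[C]_q) <= \sum_(k | predT k) eigenspace S (iomega (omega k)))%MS by exact: sub0mx.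
    have [A_ _ _ uniq] := sub_dsumsmx dx sub0.
    have eA := uniq (fun k => c 0 k *: psi k); have e0 := uniq (fun k => 0).
    rewrite eA //; last 2 first.
    - by move=> i _; apply: scalemx_sub; apply/eigenspaceP; exact: (hpsi i).1.
    - rewrite -[LHS]cPsi mulmx_sum_row; by apply: eq_bigr => i _; rewrite rPsi.
    by rewrite -e0 //; [move=> *; exact: sub0mx|rewrite big1].
  apply/rowP => k; rewrite mxE; apply/eqP; have /eqP := cE k.
  by rewrite scaler_eq0 (negbTE (hpsi k).2) orbF.
exists psi, (fun k => col k (invmx Psi)); split => [k|k|v].
- exact: (hpsi k).1.
- pose D := diag_mx (\row_k iomega (omega k)).
  have PS : Psi *m S = D *m Psi.
    apply/row_matrixP => i; rewrite !row_mul rPsi (hpsi i).1 row_diag_mx mxE -scalemxAl -rowE.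
    by rewrite rPsi.
  have SP : S *m invmx Psi = invmx Psi *m D.
    by apply: (canRL (mulKmx Psi_unit)); rewrite mulmxA PS -mulmxA mulmxV // mulmx1.
  by rewrite {1}colE mulmxA SP -colE; rewrite mul_mx_diag; apply/colP => i; rewrite !mxE mulrC.
- rewrite -[LHS](mulKmx Psi_unit); apply/colP => i; rewrite mxE summxE; apply: eq_bigr => k _.
  rewrite !mxE mulrC; congr (_ * _).
  by apply: eq_bigr => j _; rewrite mxE.
Qed.

End Exosystem.

(** * The closed loop and its regulation error *)

Section ClosedLoopRegulation.
Context {R : realType}.
Local Notation C := R[i].
Implicit Types V W : normedModType C.

Lemma bounded_linear_comp {V1 V2 V3 : normedModType C} (f : V2 -> V3) (g : V1 -> V2) :
  bounded_linear f -> bounded_linear g -> bounded_linear (fun x => f (g x)).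
Proof.
move=> [lf [Mf hf]] bg; have [lg _] := bg; have [Mg Mg0 hg] := bounded_linear_ge0 bg.
have [M M0 hM] := bounded_linear_ge0 (conj lf (ex_intro _ Mf hf)).
split=> [a x y|]; first by rewrite lg lf.
by exists (M * Mg) => x; rewrite (le_trans (hM _)) // -mulrA ler_wpM2l.
Qed.

Lemma bounded_linear_add {V W} (f g : V -> W) :
  bounded_linear f -> bounded_linear g -> bounded_linear (fun x => f x + g x).
Proof.
move=> [lf [Mf hf]] [lg [Mg hg]]; split=> [a x y|].
  by rewrite lf lg scalerDr addrACA.
by exists (Mf + Mg) => x; rewrite (le_trans (rnormD _ _)) // mulrDl lerD.
Qed.

Lemma bounded_linear_opp {V W} (f : V -> W) :
  bounded_linear f -> bounded_linear (fun x => - f x).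
Proof. by move=> bf; exact: (bounded_linear_comp (bounded_linearN (V := W)) bf). Qed.

Lemma rnorm_fst {V W} (x : (V * W)%type) : rnorm x.1 <= rnorm x.
Proof. by case: x => x y; rewrite rnorm_pair le_max lexx. Qed.

Lemma rnorm_snd {V W} (x : (V * W)%type) : rnorm x.2 <= rnorm x.
Proof. by case: x => x y; rewrite rnorm_pair le_max lexx orbT. Qed.

Lemma bounded_linear_snd {V W} : bounded_linear (snd : (V * W)%type -> W).
Proof. by split => //; exists 1 => x; rewrite mul1r rnorm_snd. Qed.

Lemma semigroup_ofP {V} (A : unbounded_op V V) : generates_C0_semigroup A ->
  C0_semigroup (semigroup_of A) /\ generator_of A (semigroup_of A).
Proof.
move=> h; exact: (@getPex _ [set T | C0_semigroup T /\ generator_of A T] h).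
Qed.

Lemma exp_stable_bounded {V} (A : unbounded_op V V) : exp_stable A ->
  exists N om, [/\ 0 <= N, 0 < om & exp_bounded (semigroup_of A) N (- om)].
Proof.
move=> [_ /ereal_inf_lt[_ [w [M hM] <-]]]; rewrite lte_fin => w0.
exists `|M|, (- w); split=> [//||t x t0]; first by rewrite oppr_gt0.
rewrite opprK (le_trans (hM t x t0)) // ler_wpM2r ?rnorm_ge0 //.
by rewrite ler_wpM2r ?expR_ge0 // ler_norm.
Qed.

Context {X U Y Z : completeNormedModType C} {q : nat}.
Local Notation W := ('cV[C]_q : normedModType C).
Context {P : plant X U Y q} {G1 : Z -> Z} {G2 : Y -> Z} {K : Z -> U}.
Hypothesis bc : bc_system P.
Hypothesis G1b : bounded_linear G1.
Hypothesis G2b : bounded_linear G2.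
Hypothesis Kbd : bounded_linear K.
Hypothesis G2inj : forall y, G2 y = 0 -> y = 0.
Hypothesis gen_Ae : generates_C0_semigroup (Ae P G1 G2 K).
Local Notation A := (opA0 P).
Local Notation BK := (fun z => rinv P (K z)).
Local Notation ABK := (fun z => opA P (rinv P (K z))).
Local Notation CBK := (fun z => opC P (rinv P (K z))).
Local Notation CL := (lambda_ext (opA0 P) (opC P)).
Local Notation AE := (Ae P G1 G2 K).

Lemma dom_opA_opC x : dom (opA P) x -> dom (opC P) x.
Proof. by case: bc => _ [_ h] _ _ _; exact: h. Qed.

Lemma dom_A_opC x : dom A x -> dom (opC P) x.
Proof. by move=> [dx _]; exact: dom_opA_opC. Qed.

Lemma opC_linear (a : C) x y : dom (opC P) x -> dom (opC P) y ->
  opC P (a *: x + y) = a *: opC P x + opC P y.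
Proof. by move=> dx dy; case: bc => -[_ _ [_ h]] _ _ _ _; exact: (h a x y dx dy).2. Qed.

Lemma rinv_dom u : dom (opC P) (rinv P u).
Proof. by apply: dom_opA_opC; case: bc => _ _ _ [_ h _ _] _; apply: h; exists u. Qed.

Lemma BK_bounded : bounded_linear BK.
Proof. by case: bc => _ _ _ [h _ _ _] _; exact: bounded_linear_comp h Kbd. Qed.

Lemma ABK_bounded : bounded_linear ABK.
Proof. by case: bc => _ _ _ [_ _ h _] _; exact: (bounded_linear_comp (f := opA P \o rinv P) h Kbd). Qed.

Lemma opCE (a : C) x y : dom A x -> dom A y -> opC P (a *: x + y) = a *: opC P x + opC P y.
Proof. by move=> /dom_A_opC dx /dom_A_opC dy; exact: opC_linear. Qed.

Lemma graph_bound : exists2 Kc, 0 <= Kc &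
  forall x, dom A x -> rnorm (opC P x) <= Kc * (rnorm x + rnorm (A x)).
Proof.
case: bc => _ _ _ _ [M hM]; exists `|M| => // x dx; apply: le_trans (hM x dx) _.
by rewrite ler_wpM2r ?ler_norm // addr_ge0 // rnorm_ge0.
Qed.

Let hA0 : generates_C0_semigroup A. Proof. by case: bc. Qed.
Let hT := (semigroup_ofP hA0).1.
Let hA := (semigroup_ofP hA0).2.
Let hS := (semigroup_ofP gen_Ae).1.
Let hB := (semigroup_ofP gen_Ae).2.
Let cX := complete_rnP (V := X).
Let cXZ := complete_rn_prod (complete_rnP (V := X)) (complete_rnP (V := Z)).

Lemma CL_id x : dom A x -> dom CL x /\ CL x = opC P x.
Proof.
move=> dx; have [M [w [M1 w0 hM]]] := C0_exp_bounded cX hT.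
have [Kc Kc0 Cb] := graph_bound.
exact: (lambda_ext_id cX hT hA (le_trans ler01 M1) hM opCE Kc0 Cb).
Qed.

(** The steady state lies in [D(A)], so additivity with one summand in [D(A)] is enough to separate
    it from the transient. *)
Lemma CL_add x d : dom CL x -> dom A d -> dom CL (x + d) /\ CL (x + d) = CL x + opC P d.
Proof.
move=> dx dd; have [M [w [M1 w0 hM]]] := C0_exp_bounded cX hT.
have M0 := le_trans ler01 M1; have [Kc Kc0 Cb] := graph_bound.
apply: lambda_extP => e e0; have e2 : 0 < e / 2 by rewrite divr_gt0.
have [L1 h1] := obs_resolvent_approx cX hT hA M0 hM opCE Kc0 Cb dd e2.
have e2c : 0 < (e / 2)%:C :> C by rewrite ltcR.
have /cvgrPdist_le/(_ _ e2c)[L2 [_ h2]] := dx.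
exists (Num.max (2 * `|w| + 1) (Num.max L1 (L2 + 1))) => l.
rewrite !ge_max => /andP[hl /andP[/h1 {}h1 L2l]].
have [l1 wl] := large_real hl; have lQ := resolvent_linear cX hT hA M0 hM wl.
have dQ y := (resolventP cX hT hA M0 hM wl y).1.
have {}h2 := h2 l (lt_le_trans (ltr_pwDr ltr01 (lexx _)) L2l).
rewrite normE lecR rnorm_distC -[lim _]/(CL x) in h2.
rewrite (linfD lQ) (obsD opCE) // scalerDr opprD addrACA (le_trans (rnormD _ _)) //.
lra.
Qed.

Lemma CBK_lin : linear CBK.
Proof.
move=> a x y /=; have [lBK _] := BK_bounded; rewrite lBK opC_linear //; exact: rinv_dom.
Qed.

Lemma Ae_fst xi : dom AE xi -> (AE xi).1 = A xi.1 + (- BK (G2 (opC P xi.1))) +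
  (ABK xi.2 - BK (G1 xi.2 + G2 (CBK xi.2))).
Proof. by move=> dxi; rewrite -(CL_id dxi).2. Qed.

Lemma Ae_snd xi : dom AE xi -> (AE xi).2 = G2 (opC P xi.1) + (G1 xi.2 + G2 (CBK xi.2)).
Proof. by move=> dxi; rewrite -(CL_id dxi).2. Qed.

(* Closed graph: the second row of the closed operator [Ae] contains
   [G2 (CBK z)] and [G2] is injective. *)
Lemma CBK_bounded : bounded_linear CBK.
Proof.
have [Me [we [Me1 we0 hMe]]] := C0_exp_bounded cXZ hS.
apply: closed_linear_bounded; [exact: complete_rnP|exact: complete_rnP|exact: CBK_lin|].
move=> u z y hu hy; have [d0 A0] := dom_generator0 hT hA.
have C0 : opC P 0 = 0 := obs0 hT hA opCE.
have dxi (z' : Z) : dom AE (0 : X, z') by exact: d0.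
have G20 : G2 0 = 0 := linf0 G2b.1.
have BK0 : BK 0 = 0 := linf0 BK_bounded.1.
have e1 (z' : Z) : (AE (0 : X, z')) = (ABK z' - BK (G1 z' + G2 (CBK z')), G1 z' + G2 (CBK z')).
  rewrite [LHS]surjective_pairing (Ae_fst (dxi z')) (Ae_snd (dxi z')) /=.
  by rewrite [opA P 0]A0 C0 G20 BK0 oppr0 addr0 !add0r.
have [k1 k10 hk1] := bounded_linear_ge0 G1b; have [k2 k20 hk2] := bounded_linear_ge0 G2b.
have [k3 k30 hk3] := bounded_linear_ge0 ABK_bounded; have [k4 k40 hk4] := bounded_linear_ge0 BK_bounded.
pose Lz := (ABK z - BK (G1 z + G2 y), G1 z + G2 y).
have [] := @generator_closed _ _ _ _ hS hB _ _ hMe (fun n => (0 : X, u n)) (0, z) Lz.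
- by move=> n; exact: dxi.
- move=> e e0; have [n0 h] := hu e e0; exists n0 => n /h {}h.
  have -> : (0 : X, u n) - (0, z) = (0, u n - z) by congr pair; rewrite /= subrr.
  by rewrite rnorm_pair rnorm0 ge_max (ltW e0).
- move=> e e0; pose k := (k3 + k4 * (k1 + k2)) + (k1 + k2) + 1.
  have k0 : 0 < k by rewrite ltr_wpDl // !addr_ge0 ?mulr_ge0 ?addr_ge0.
  have ek : 0 < e / k by rewrite divr_gt0.
  have [n1 h1] := hu _ ek; have [n2 h2] := hy _ ek.
  exists (maxn n1 n2) => n; rewrite geq_max => /andP[/h1 {}h1 /h2 {}h2].
  rewrite e1 /Lz; set a := u n in h1 *; set b := CBK a.
  have -> : (ABK a - BK (G1 a + G2 b), G1 a + G2 b) - (ABK z - BK (G1 z + G2 y), G1 z + G2 y) =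
     (ABK (a - z) - BK (G1 (a - z) + G2 (b - y)), G1 (a - z) + G2 (b - y)).
    rewrite (linfB ABK_bounded.1) (linfB G1b.1) (linfB G2b.1).
    have -> : G1 a - G1 z + (G2 b - G2 y) = (G1 a + G2 b) - (G1 z + G2 y) by lmod.
    rewrite (linfB BK_bounded.1); congr pair; rewrite //=; lmod.
  have h3 : rnorm (G1 (a - z) + G2 (b - y)) <= (k1 + k2) * (e / k).
    rewrite (le_trans (rnormD _ _)) // mulrDl lerD //.
      by rewrite (le_trans (hk1 _)) // ler_wpM2l.
    by rewrite (le_trans (hk2 _)) // ler_wpM2l.
  have h4 : rnorm (ABK (a - z) - BK (G1 (a - z) + G2 (b - y))) <= (k3 + k4 * (k1 + k2)) * (e / k).
    rewrite (le_trans (rnormB _ _)) // mulrDl lerD //.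
      by rewrite (le_trans (hk3 _)) // ler_wpM2l.
    by rewrite (le_trans (hk4 _)) // -mulrA ler_wpM2l.
  have h5 : k * (e / k) = e by field; rewrite lt0r_neq0.
  have k12 : 0 <= k1 + k2 by rewrite addr_ge0.
  have k34 : 0 <= k3 + k4 * (k1 + k2) by rewrite addr_ge0 ?mulr_ge0.
  rewrite rnorm_pair ge_max -h5; apply/andP; split.
    by apply: le_trans h4 _; rewrite ler_wpM2r ?(ltW ek) // /k; lra.
  by apply: le_trans h3 _; rewrite ler_wpM2r ?(ltW ek) // /k; lra.
move=> _; rewrite e1 => -[_ /addrI/eqP]; rewrite -subr_eq0 -(linfB G2b.1) => /eqP/G2inj/eqP.
by rewrite subr_eq0 => /eqP.
Qed.

(** The first row of [Ae] is [A] plus [L1op] of the output plus the bounded remainder [L2op] of the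
    whole state. *)
Definition L1op (y : Y) : X := - BK (G2 y).
Definition L2op (xi : (X * Z)%type) : X := ABK xi.2 - BK (G1 xi.2 + G2 (CBK xi.2)).

Lemma L1op_bounded : bounded_linear L1op.
Proof. by apply: bounded_linear_opp; exact: bounded_linear_comp BK_bounded G2b. Qed.

Lemma L2op_bounded : bounded_linear L2op.
Proof.
apply: bounded_linear_add; first exact: bounded_linear_comp ABK_bounded bounded_linear_snd.
apply: bounded_linear_opp; apply: (bounded_linear_comp BK_bounded); apply: bounded_linear_add.
  exact: bounded_linear_comp G1b bounded_linear_snd.
apply: (bounded_linear_comp G2b); exact: bounded_linear_comp CBK_bounded bounded_linear_snd.
Qed.

(** Adding [BK] of the second row of [Ae] to its first row cancels every term containing the output,
    so the graph norm of [Ae] controls that of [A]. *)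
Lemma output_graph_bound : exists2 Kb, 0 <= Kb &
  forall xi, dom AE xi -> rnorm (opC P xi.1) <= Kb * (rnorm xi + rnorm (AE xi)).
Proof.
have [Kc Kc0 Cb] := graph_bound.
have [k3 k30 hk3] := bounded_linear_ge0 ABK_bounded; have [k4 k40 hk4] := bounded_linear_ge0 BK_bounded.
exists (Kc * (1 + k3 + k4 + 1)) => [|xi dxi]; first by rewrite mulr_ge0 // !addr_ge0.
rewrite (le_trans (Cb _ dxi)) // -mulrA ler_wpM2l //.
have -> : A xi.1 = (AE xi).1 - ABK xi.2 + BK ((AE xi).2).
  rewrite (Ae_fst dxi) (Ae_snd dxi) (linfD BK_bounded.1 (G2 _)); lmod.
have h1 := rnorm_fst xi; have h2 := rnorm_snd xi; have h3 := rnorm_fst (AE xi); have h4 := rnorm_snd (AE xi).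
have h5 := rnormD ((AE xi).1 - ABK xi.2) (BK ((AE xi).2)); have h6 := rnormB (AE xi).1 (ABK xi.2).
have h7 : rnorm (ABK xi.2) <= k3 * rnorm xi by rewrite (le_trans (hk3 _)) // ler_wpM2l.
have h8 : rnorm (BK (AE xi).2) <= k4 * rnorm (AE xi) by rewrite (le_trans (hk4 _)) // ler_wpM2l.
have n1 := rnorm_ge0 xi; have n2 := rnorm_ge0 (AE xi).
have n3 := mulr_ge0 k30 n2; have n4 := mulr_ge0 k40 n1.
move: h1 h3 h5 h6 h7 h8 n1 n2 n3 n4; move: (rnorm xi) (rnorm (AE xi)) (rnorm xi.1) (rnorm (AE xi).1).
move: (rnorm (ABK xi.2)) (rnorm (BK (AE xi).2)) (rnorm (_ - _)) (rnorm (_ + _)).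
by move=> *; lra.
Qed.

Lemma admissible_prim : admissible P -> exists tau K2, [/\ 0 < tau, 0 <= K2 & forall x, dom A x ->
  prim (@obs2 _ _ _ (semigroup_of A) (opC P) x) tau -
  prim (@obs2 _ _ _ (semigroup_of A) (opC P) x) 0 <= K2 * rnorm x ^+ 2].
Proof.
move=> [tau tau0 [K2 h]]; exists tau, (K2 ^+ 2); split=> [//||x dx]; first exact: sqr_ge0.
have [M [w [M1 w0 hM]]] := C0_exp_bounded cX hT; have [Kc Kc0 Cb] := graph_bound.
rewrite -lee_fin -integral_prim ?(ltW tau0) //; last exact: (obs2_cont hT hA hM opCE Kc0 Cb dx).
apply: le_trans (h x dx); rewrite le_eqVlt; apply/orP; left; apply/eqP.
by apply: eq_integral => t; rewrite inE /= in_itv /= => /andP[t0 _]; rewrite /obs2 max0l.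
Qed.

Lemma closed_loop_output_L2 N om xi (D : set R) (f : R -> Y) : admissible P ->
  0 <= N -> 0 < om -> exp_bounded (semigroup_of AE) N (- om) ->
  (forall t, 0 < t -> dom CL (semigroup_of AE t xi).1 -> D t /\
    f t = (expR (om / 2 * t))%:C *: (CL (semigroup_of AE t xi).1 + CBK (semigroup_of AE t xi).2)) ->
  in_L2_pos D f.
Proof.
move=> /admissible_prim[tau [K2 [tau0 K20 adm]]] N0 om0 hN hf.
have [M [w [M1 w0 hM]]] := C0_exp_bounded cX hT; have [Kc Kc0 Cb] := graph_bound.
have [Kb Kb0 piC] := output_graph_bound.
apply: (weighted_output_L2 cX (complete_rnP (V := Y)) cXZ hT hA (le_trans ler01 M1) hM opCE Kc0 Cb tau0 K20 adm
  hS hB N0 om0 hN (pr := fst) (L1 := L1op) (L2 := L2op) (L3 := fun xi => CBK xi.2) (Kb := Kb)) hf => //.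
- exact: rnorm_fst.
- exact: L1op_bounded.
- exact: L2op_bounded.
- exact: bounded_linear_comp CBK_bounded bounded_linear_snd.
- exact: Ae_fst.
Qed.

Context {S : 'M[C]_q}.
Hypothesis opEb : bounded_linear (opE P).
Hypothesis opFb : bounded_linear (opF P).

Lemma De_lin : linear (De P).
Proof.
move=> a x y; rewrite /De opEb.1 opFb.1; case: bc => _ _ _ [[lr _] _ _ _] _.
by rewrite lr opC_linear; [lmod|exact: rinv_dom|exact: rinv_dom].
Qed.

Lemma Be_lin : linear (Be S P G2 K).
Proof.
move=> a x y; case: (bc) => _ _ _ [[lr _] _ [lAr _] _] _.
have lABE : opA P (rinv P (opE P (a *: x + y))) = a *: opA P (rinv P (opE P x)) + opA P (rinv P (opE P y)).
  by rewrite opEb.1; exact: lAr.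
rewrite /Be lABE De_lin mulmxDr -scalemxAr opEb.1 lr G2b.1 BK_bounded.1.
congr pair; rewrite //=; lmod.
Qed.

Lemma regulator_equation (om : R) (pi : (X * Z)%type) (phi : W) :
  range (fun z => iomega om *: z - G1 z) `&` range G2 = [set 0] ->
  dom AE pi -> iomega om *: pi - AE pi = Be S P G2 K phi ->
  opC P pi.1 + CBK pi.2 + De P phi = 0.
Proof.
move=> rg dpi epi; apply: G2inj; set e := _ + _ + _.
have e2 : iomega om *: pi.2 - G1 pi.2 = G2 e.
  have : iomega om *: pi.2 - (AE pi).2 = G2 (De P phi) by rewrite -[RHS](congr1 snd epi).
  rewrite (Ae_snd dpi) /e !(linfD G2b.1) => <-; lmod.
have : [set 0] (G2 e) by rewrite -rg; split; [exists pi.2|exists e].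
by [].
Qed.

(** The Duhamel integrand has the explicit antiderivative [F s = sum_k p_k(s) Te(t - s) pi_k]:
    differentiating it produces [Te(t - s) (i omega_k - Ae) pi_k], which is [Te(t - s) Be phi_k].
    The integral is thus [F t - F 0]. *)
Lemma closed_loop_state_decomposition (omega : 'I_q -> R) (psi : 'I_q -> 'rV[C]_q)
    (phi : 'I_q -> 'cV[C]_q) (pi : 'I_q -> (X * Z)%type) v0 (v : R -> W) xi0 t :
  (forall k, psi k *m S = iomega (omega k) *: psi k) ->
  (forall w : W, w = \sum_k (psi k *m w) 0 0 *: phi k) ->
  (forall k, dom AE (pi k) /\ iomega (omega k) *: pi k - AE (pi k) = Be S P G2 K (phi k)) ->
  exosystem_solution S v0 v -> 0 <= t ->
  closed_loop_state S P G1 G2 K xi0 v t =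
    semigroup_of AE t (xi0 - \sum_k (psi k *m v0) 0 0 *: pi k) + \sum_k (psi k *m v t) 0 0 *: pi k.
Proof.
move=> hpsi hphi hpi hv t0; have [N [om [_ _ hN]]] := C0_exp_bounded cXZ hS; set Te := semigroup_of AE.
have lTe r : 0 <= r -> linear (Te r) := C0_lin hS (t := r).
pose p k (s : R) : C^o := (psi k *m v s) 0 0.
pose F (s : R) := \sum_k p k s *: Te (t - s) (pi k).
pose f (s : R) := Te (t - s) (Be S P G2 K (v s)).
have sub : (`[0, t]%classic : set R) `<=` `[0, +oo[.
  by move=> s /=; rewrite !in_itv /= => /andP[-> _].
have subt : `[0, t]%classic `<=` [set s | (`[0, +oo[%classic : set R) (t - s)].
  by move=> s /=; rewrite !in_itv /= => /andP[_ st]; rewrite andbT subr_ge0.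
have dp k s : `[0, t]%classic s -> deriv_at `[0, t] (p k) s (iomega (omega k) * p k s).
  move=> ds; apply: (deriv_atS sub).
  apply: deriv_at_eq (deriv_atL (row_functional_bounded (psi k)) (exosystem_deriv hv (sub _ ds))) _.
  by rewrite mulmxA hpsi -scalemxAl mxE.
have fE s : `[0, t]%classic s -> f s = \sum_k p k s *: Te (t - s) (Be S P G2 K (phi k)).
  move=> ds; have ts := (posP (t - s)).1 (subt _ ds).
  rewrite /f [in LHS](hphi (v s)) (linf_sum Be_lin) (linf_sum (lTe _ ts)).
  by apply: eq_bigr => k _; rewrite (linfZ Be_lin) (linfZ (lTe _ ts)).
have dF : deriv_on `[0, t] F f.
  move=> s ds; rewrite (fE s ds); apply: deriv_at_sum => k.
  have ts := (posP (t - s)).1 (subt _ ds).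
  have dT : deriv_at `[0, t] (fun u => Te (t - u) (pi k)) s (- Te (t - s) (AE (pi k))).
    apply: (@deriv_at_rev _ _ _ (fun u => Te u (pi k))).
    apply: (deriv_atS _ (orbit_deriv hS hB hN (hpi k).1 ((posP _).2 ts))).
    move=> u /= /subt /=; by rewrite subKr.
  apply: deriv_at_eq (deriv_at_scal ds (dp k s ds) dT) _.
  rewrite -(hpi k).2 (linfB (lTe _ ts)) (linfZ (lTe _ ts)).
  by lmod.
have cf : cont_on `[0, t] f.
  apply: cont_on_ext fE _; apply: cont_on_sum => k; apply: cont_onZ.
    by apply: deriv_on_cont => s ds; exact: dp.
  move=> s ds e e0; have [d d0 hd] := orbit_cont hS hN (Be S P G2 K (phi k)) (subt _ ds) e0.
  exists d => // u /subt du us; apply: (hd (t - u) du).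
  by rewrite opprB addrC subrKA distrC.
rewrite /closed_loop_state /mild_solution -/Te (riemann_ftc t0 dF cf).
rewrite (linfB (lTe _ t0)) (linf_sum (lTe _ t0)) /F subrr subr0.
have -> : \sum_k p k t *: Te 0 (pi k) = \sum_k (psi k *m v t) 0 0 *: pi k.
  by apply: eq_bigr => k _; rewrite [Te 0 _](C0_0 hS).
have -> : \sum_k p k 0 *: Te t (pi k) = \sum_k Te t ((psi k *m v0) 0 0 *: pi k).
  by apply: eq_bigr => k _; rewrite (linfZ (lTe _ t0)) /p hv.1.
by lmod.
Qed.

Lemma stable_output_regulated (omega : 'I_q -> R) : admissible P ->
  simple_imaginary_spectrum S omega -> exp_stable AE ->
  (forall k, range (fun z => iomega (omega k) *: z - G1 z) `&` range G2 = [set 0]) ->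
  output_regulated S P G1 G2 K.
Proof.
move=> admP spec stab rg; have [N [om [N0 om0 hN]]] := exp_stable_bounded stab.
have [psi [phi [hpsi _ hphi]]] := eigenbasis spec.
(* The spectrum of [S] is imaginary, hence to the right of the growth rate [- om], where the
   resolvent of [Ae] is available. *)
have wk k : - om < complex.Re (iomega (omega k)) by rewrite /= oppr_lt0.
pose pi k := resolvent AE (iomega (omega k)) (Be S P G2 K (phi k)).
have hpi k := resolventP cXZ hS hB N0 hN (wk k) (Be S P G2 K (phi k)); rewrite -/(pi _) in hpi.
exists (om / 2); first by rewrite divr_gt0.
move=> xi0 v0 v hv; set xi := xi0 - \sum_k (psi k *m v0) 0 0 *: pi k.
apply: (closed_loop_output_L2 (xi := xi) admP N0 om0 hN) => t t0 dt.
pose p k : C := (psi k *m v t) 0 0; pose d := \sum_k p k *: pi k.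
have eS : closed_loop_state S P G1 G2 K xi0 v t = semigroup_of AE t xi + d.
  exact: (closed_loop_state_decomposition xi0 hpsi hphi hpi hv (ltW t0)).
have dA0 := dom_generator0 hT hA.
(* [opC P] is additive only on its domain, so membership in [D(A)] is carried through the sum
   together with the vanishing of the error, matching the expansions of the state and of [v t] term
   by term. *)
have [dd ed] : dom A d.1 /\ opC P d.1 + CBK d.2 + De P (v t) = 0.
  rewrite [in De P _](hphi (v t)) /d.
  apply: (big_ind2 (fun (d' : (X * Z)%type) (w' : W) =>
    dom A d'.1 /\ opC P d'.1 + CBK d'.2 + De P w' = 0)) => [|x w y z [dx ex] [dy ey]|k _].
  - split; first exact: dA0.1.
    by rewrite (obs0 hT hA opCE) (linf0 CBK_lin) (linf0 De_lin) !addr0.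
  - split; first exact: (dom_generatorD hT hA dx dy).1.
    rewrite (obsD opCE dx dy) (linfD CBK_lin) (linfD De_lin).
    rewrite -[RHS]addr0 -{1}ex -ey; lmod.
  - have [dk ek] := hpi k; split; first exact: (dom_generatorZ hT hA _ dk).1.
    have /= e0 := regulator_equation (rg k) dk ek.
    rewrite (obsZ hT hA opCE _ dk) (linfZ CBK_lin) (linfZ De_lin) -!scalerDr.
    by rewrite [X in _ *: X]e0 scaler0.
have [dL eL] := CL_add dt dd.
split.
  by rewrite -[[set _ | _] t]/(dom CL (closed_loop_state S P G1 G2 K xi0 v t).1) eS; exact: dL.
congr (_ *: _); rewrite -[LHS]/(CL (closed_loop_state S P G1 G2 K xi0 v t).1 +
  CBK (closed_loop_state S P G1 G2 K xi0 v t).2 + De P (v t)) eS.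
rewrite -[(semigroup_of AE t xi + d).1]/((semigroup_of AE t xi).1 + d.1).
rewrite -[(semigroup_of AE t xi + d).2]/((semigroup_of AE t xi).2 + d.2).
rewrite eL (linfD CBK_lin) -[RHS]addr0 -ed; lmod.
Qed.

End ClosedLoopRegulation.

Theorem theorem4 (R : realType) (X U Y Z : completeNormedModType (complex R))
    (q : nat) (S : 'M[complex R]_q) (omega : 'I_q -> R) (P : plant X U Y q)
    (G1 : Z -> Z) (G2 : Y -> Z) (K : Z -> U) :
  hilbert X -> hilbert U -> hilbert Y ->
  simple_imaginary_spectrum S omega ->
  standing_assumptions omega P ->
  bounded_linear G1 -> bounded_linear G2 -> bounded_linear K ->
  exp_stable (Ae P G1 G2 K) ->
  G_conditions omega G1 G2 ->
  solves_robust_output_regulation S omega P G1 G2 K.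
Proof.
move=> _ _ _ spec hP G1b G2b Kb stab [rg kerG2].
have G2inj y : G2 y = 0 -> y = 0 by move=> Gy; have : [set y | G2 y = 0] y by []; rewrite kerG2.
(* The nominal plant is the instance [P' = P]. *)
have main P' : standing_assumptions omega P' -> exp_stable (Ae P' G1 G2 K) ->
    output_regulated S P' G1 G2 K.
  move=> [bc adm _ [opEb opFb]] stab'.
  exact: (stable_output_regulated bc G1b G2b Kb G2inj stab'.1 opEb opFb adm spec stab' rg).
by split => // [|P' hP']; exact: main.
Qed.
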